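(* Let $M\ge1$ be an integer, let $T$ be an invertible measure-preserving transformation on a probability space $(X,\mu)$, and let $0\le\gamma<2^{-M+1}$. Let $(n_k(\omega))_{k\in\mathbb{N}}$ be the random subsequence of $\mathbb{N}$ with parameter $\gamma$ defined in the context. Then for almost every $\omega\in\Omega$, for all $f_1,\dots,f_M\in L^\infty(X)$, \[ \lim_{N\to\infty}N^{-1}\sum_{k=1}^N f_1(T^{n_k(\omega)}(x))\,f_2(T^{2n_k(\omega)}(x))\cdots f_M(T^{Mn_k(\omega)}(x)) \] exists in $L^1(X,d\mu(x))$.
   Context: Let $\Omega$ be a probability space equipped with a family of jointly independent random variables $\{s_n(\omega):n\in\mathbb{N}\}$ such that $s_n(\omega)=1$ with probability $n^{-\gamma}$ and $s_n(\omega)=0$ otherwise. For each $\omega\in\Omega$, the random subsequence $(n_k(\omega))_{k\in\mathbb{N}}$ consists of all $n\in\mathbb{N}=\{1,2,\dots\}$ for which $s_n(\omega)=1$, listed in increasing order. The existence of the limit in $L^1$ means convergence in $L^1(X,\mu)$ norm. *)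

(* Defs.v *)
From HB Require Import structures.
From mathcomp Require Export all_boot all_order all_algebra finmap.
From mathcomp Require Export all_classical all_reals all_analysis.
From mathcomp Require Export complex.

Set Implicit Arguments.
Unset Strict Implicit.
Unset Printing Implicit Defensive.
Import Order.TTheory GRing.Theory Num.Theory.
Import numFieldNormedType.Exports.
Local Open Scope classical_set_scope.
Local Open Scope ring_scope.

(* Joint independence of the subfamily (Y i), i in A: the product rule over
   every finite set of indices contained in A. *)
Definition jointly_independent d (Omega : measurableType d) (R : realType)
    (P : probability Omega R) (I : choiceType) (A : set I)
    (Y : I -> {RV P >-> R}) : Prop :=
  forall (J : {fset I}) (B : I -> set R),
    [set` J] `<=` A ->
    (forall i, i \in J -> measurable (B i)) ->
    P (\bigcap_(i in [set` J]) Y i @^-1` B i) =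
      (\prod_(i <- J) P (Y i @^-1` B i))%E.

Definition measure_preserving d (X : measurableType d) (R : realType)
    (mu : {measure set X -> \bar R}) (T : X -> X) : Prop :=
  measurable_fun setT T /\
  forall A, measurable A -> mu (T @^-1` A) = mu A.

Definition invertible_measure_preserving d (X : measurableType d)
    (R : realType) (mu : {measure set X -> \bar R}) (T : X -> X) : Prop :=
  measure_preserving mu T /\
  exists S : X -> X, [/\ measurable_fun setT S, cancel T S & cancel S T].

(* (u 0, u 1, u 2, ...) lists all the elements of A in increasing order; this
   forces A to be infinite. *)
Definition increasing_listing (A : set nat) (u : nat -> nat) : Prop :=
  {homo u : i j / (i < j)%N} /\ range u = A.

(* The modulus of a complex number as an element of R: the norm `|z| of
   MathComp lives in R[i]. *)
Definition cmod (R : rcfType) (z : R[i]) : R := ComplexField.Normc.normc z.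

Definition cLnorm d (X : measurableType d) (R : realType)
    (mu : {measure set X -> \bar R}) (p : \bar R) (f : X -> R[i]) : \bar R :=
  'N[mu]_p[EFin \o (@cmod R \o f)]%E.

(* Complex-valued L^p functions (representatives).  No measurable structure is
   installed on R[i], so measurability is that of the two real components. *)
Definition cLfun d (X : measurableType d) (R : realType)
    (mu : {measure set X -> \bar R}) (p : \bar R) (f : X -> R[i]) : Prop :=
  [/\ measurable_fun setT (fun x => complex.Re (f x)),
      measurable_fun setT (fun x => complex.Im (f x)) &
      (cLnorm mu p f < +oo)%E].

Definition cvg_in_L1 d (X : measurableType d) (R : realType)
    (mu : {measure set X -> \bar R}) (F : nat -> X -> R[i]) (g : X -> R[i]) :
    Prop :=
  cLnorm mu 1%E (fun x => F N x - g x) @[N --> \oo] --> 0%E.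

(* The average of f_1(T^{n_k} x) f_2(T^{2 n_k} x) ... f_M(T^{M n_k} x) over the
   first N terms of the sequence n.  Indices start at 0: f j is f_{j+1} and
   n k is n_{k+1}. *)
Definition multiple_average (R : rcfType) (X : Type) (T : X -> X) (M : nat)
    (f : 'I_M -> X -> R[i]) (n : nat -> nat) (N : nat) (x : X) : R[i] :=
  N%:R^-1 * \sum_(k < N) \prod_(j < M) f j (iter (j.+1 * n k) T x).

(* Main.v *)
Require Import Defs.
From mathcomp Require Import cyclic separable cyclotomic.
From mathcomp Require Import measurable_realfun ess_sup_inf zify ring lra.

(** Write [r_n = s_n - n^-gamma] and [D = 2^(M-1)], so that [D * gamma < 1].

Almost surely, the sums [sum_(n <= N) r_n f_1(T^n x) ... f_M(T^(M n) x)] are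
[o(N^(1-gamma))] in [L^2], uniformly over the [f_i] bounded by 1.  Indeed
[M - 1] applications of van der Corput leave one function, and weights which
are products of [D] shifts of [r].  For one function the [L^2] norm is at most
twice the largest of the exponential sums of the weights over the [2N]-th roots
of unity, by transference to [Z/2N].  If the shifts are distinct, such a sum is
a martingale with conditional variance of order [N^(1 - D gamma)], so that its
exponential moments bound the mean of the maximum by
[N^((1 - D gamma)/2) log N]; coinciding shifts are rare enough for the trivial
bound.  Climbing back gives a mean [O(N^(1 - gamma - 2 kappa))] with
[kappa > 0], and Borel-Cantelli along [N = j^L] with [L] large finishes.

It remains to treat the weights [n^-gamma], hence by Abel summation the plain
averages, whose norm convergence follows an idea of Walsh.  If the average
[g] at scale [n] of [f_1, ..., f_(M-1), f_M - w] has norm more than [delta],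
then adding to [w] the dual function of [g] decreases [||f_M - w||^2] by
[delta^2].  Hence, but for boundedly many scales, [f_M] is a bounded
combination of dual functions of much larger scales up to an error with small
averages, and on such dual functions the averages are means of averages with
[M - 1] functions. *)

Set Implicit Arguments.
Unset Strict Implicit.
Unset Printing Implicit Defensive.
Import Order.TTheory GRing.Theory Num.Theory.
Import numFieldNormedType.Exports.
Local Open Scope classical_set_scope.
Local Open Scope ring_scope.

(** * Bounded measurable functions *)

Section BoundedMeasurable.
Context d (X : measurableType d) (R : realType) (mu : probability X R).
Implicit Types (f g : X -> R) (B C : R).

Definition bdd B f := measurable_fun setT f /\ forall x, `|f x| <= B.

Lemma bdd_le B C f : B <= C -> bdd B f -> bdd C f.
Proof. by move=> BC [mf fB]; split=> // x; exact: le_trans (fB x) BC. Qed.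

Lemma bdd_cst c : bdd `|c| (fun=> c).
Proof. by split=> // x. Qed.

Lemma bddD B C f g : bdd B f -> bdd C g -> bdd (B + C) (fun x => f x + g x).
Proof.
move=> [mf fB] [mg gC]; split; first exact: measurable_funD.
by move=> x; rewrite (le_trans (ler_normD _ _))// lerD.
Qed.

Lemma bddN B f : bdd B f -> bdd B (fun x => - f x).
Proof.
move=> [mf fB]; split; first exact: measurable_funN.
by move=> x; rewrite normrN.
Qed.

Lemma bddB B C f g : bdd B f -> bdd C g -> bdd (B + C) (fun x => f x - g x).
Proof. by move=> bf /bddN; exact: bddD. Qed.

Lemma bddM B C f g : bdd B f -> bdd C g -> bdd (B * C) (fun x => f x * g x).
Proof.
move=> [mf fB] [mg gC]; split; first exact: measurable_funM.
by move=> x; rewrite normrM ler_pM.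
Qed.

Lemma bddZ B c f : bdd B f -> bdd (`|c| * B) (fun x => c * f x).
Proof. exact: bddM (bdd_cst c). Qed.

Lemma bdd_comp B f (t : X -> X) : measurable_fun setT t -> bdd B f ->
  bdd B (fun x => f (t x)).
Proof. by move=> mt [mf fB]; split=> //; exact: measurableT_comp. Qed.

Lemma bdd_sum I (r : seq I) (B : I -> R) (f : I -> X -> R) :
  (forall i, bdd (B i) (f i)) ->
  bdd (\sum_(i <- r) B i) (fun x => \sum_(i <- r) f i x).
Proof.
move=> bf; elim: r => [|i r IHr].
  rewrite [fun x : X => _](_ : _ = fun=> (\big[+%R/0]_(i <- [::]) f i point));
    last by apply/funext => x; rewrite !big_nil.
  by rewrite !big_nil -[X in bdd X](@normr0 R R); exact: bdd_cst.
rewrite [fun x : X => _](_ : _ = fun x => f i x + \big[+%R/0]_(j <- r) f j x);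
  last by apply/funext => x; rewrite big_cons.
by rewrite big_cons; exact: bddD.
Qed.

Lemma bdd_prod1 (I : eqType) (r : seq I) (f : I -> X -> R) :
  (forall i, i \in r -> bdd 1 (f i)) ->
  bdd 1 (fun x => \prod_(i <- r) f i x).
Proof.
elim: r => [|i r IHr] bf.
  rewrite [fun x : X => _](_ : _ = fun=> (\big[*%R/1]_(i <- [::]) f i point));
    last by apply/funext => x; rewrite !big_nil.
  by rewrite big_nil -[X in bdd X](@normr1 R); exact: bdd_cst.
rewrite [fun x : X => _](_ : _ = fun x => f i x * \big[*%R/1]_(j <- r) f j x);
  last by apply/funext => x; rewrite big_cons.
rewrite -[X in bdd X]mulr1; apply: bddM; first by apply: bf; rewrite mem_head.
by apply: IHr => j jr; apply: bf; rewrite in_cons jr orbT.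
Qed.

Definition bm f := exists B, bdd B f.

Lemma bdd_bm B f : bdd B f -> bm f.
Proof. by exists B. Qed.

Lemma bm_cst c : bm (fun=> c).
Proof. by exists `|c|; exact: bdd_cst. Qed.

Lemma bmD f g : bm f -> bm g -> bm (fun x => f x + g x).
Proof. by move=> [B bf] [C bg]; exists (B + C); exact: bddD. Qed.

Lemma bmB f g : bm f -> bm g -> bm (fun x => f x - g x).
Proof. by move=> [B bf] [C bg]; exists (B + C); exact: bddB. Qed.

Lemma bmM f g : bm f -> bm g -> bm (fun x => f x * g x).
Proof. by move=> [B bf] [C bg]; exists (B * C); exact: bddM. Qed.

Lemma bmZ c f : bm f -> bm (fun x => c * f x).
Proof. exact: bmM (bm_cst c). Qed.

Lemma bmX2 f : bm f -> bm (fun x => f x ^+ 2).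
Proof. by move=> bf; apply: bmM. Qed.

Lemma bm_norm f : bm f -> bm (fun x => `|f x|).
Proof.
move=> [B [mf fB]]; exists B; split; first exact: measurableT_comp.
by move=> x; rewrite normr_id.
Qed.

Lemma bm_sum I (r : seq I) (f : I -> X -> R) :
  (forall i, bm (f i)) -> bm (fun x => \sum_(i <- r) f i x).
Proof.
move=> bf; have [B hB] := choice bf.
by exists (\sum_(i <- r) B i); exact: bdd_sum.
Qed.

Lemma bm_comp f (t : X -> X) : measurable_fun setT t -> bm f ->
  bm (fun x => f (t x)).
Proof. by move=> mt [B bf]; exists B; exact: bdd_comp. Qed.

Lemma bm_integrable f : bm f -> mu.-integrable setT (EFin \o f).
Proof.
move=> [B [mf fB]]; apply: measurable_bounded_integrable => //.
  by rewrite (le_lt_trans (probability_le1 _ _))// ltry.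
exists B; split; first exact: num_real.
by move=> M BM x _; exact: le_trans (fB x) (ltW BM).
Qed.

Definition Int f := (\int[mu]_x f x)%R.

Lemma Int_cst c : Int (fun=> c) = c.
Proof.
rewrite /Int Rintegral_cst// [X in fine X](_ : _ = 1%E) ?mulr1//.
exact: probability_setT.
Qed.

Lemma IntD f g : bm f -> bm g -> Int (fun x => f x + g x) = Int f + Int g.
Proof. by move=> bf bg; apply: RintegralD => //; exact: bm_integrable. Qed.

Lemma IntB f g : bm f -> bm g -> Int (fun x => f x - g x) = Int f - Int g.
Proof. by move=> bf bg; apply: RintegralB => //; exact: bm_integrable. Qed.

Lemma IntZ c f : bm f -> Int (fun x => c * f x) = c * Int f.
Proof. by move=> bf; apply: RintegralZl => //; exact: bm_integrable. Qed.

Lemma Int_sum I (r : seq I) (f : I -> X -> R) : (forall i, bm (f i)) ->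
  Int (fun x => \sum_(i <- r) f i x) = \sum_(i <- r) Int (f i).
Proof.
move=> bf; elim: r => [|i r IHr].
  rewrite [fun x : X => _](_ : _ = fun=> (\big[+%R/0]_(i <- [::]) f i point));
    last by apply/funext => x; rewrite !big_nil.
  by rewrite !big_nil Int_cst.
rewrite [fun x : X => _](_ : _ = fun x => f i x + \big[+%R/0]_(j <- r) f j x);
  last by apply/funext => x; rewrite big_cons.
by rewrite big_cons IntD ?IHr//; exact: bm_sum.
Qed.

Lemma Int_ge0 f : (forall x, 0 <= f x) -> 0 <= Int f.
Proof. by move=> f0; apply: Rintegral_ge0. Qed.

Lemma le_Int f g : bm f -> bm g -> (forall x, f x <= g x) -> Int f <= Int g.
Proof. by move=> bf bg fg; apply: le_Rintegral => //; exact: bm_integrable. Qed.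

Lemma Int_comp f (t : X -> X) : measure_preserving mu t -> bm f ->
  Int (fun x => f (t x)) = Int f.
Proof.
move=> [mt tP] bf; rewrite /Int /Rintegral; congr fine.
have if' : mu.-integrable (t @^-1` setT) ((EFin \o f) \o t).
  by rewrite preimage_setT; apply: (@bm_integrable (fun x => f (t x))); exact: bm_comp.
have mf : measurable_fun setT (EFin \o f).
  by case: bf => B [mf _]; exact/measurable_EFinP.
rewrite -[LHS](_ : \int[pushforward mu t]_x (f x)%:E = _)%E; last first.
  exact: (integral_pushforward mt mf if' measurableT).
by apply: eq_measure_integral => A mA _; exact: tP.
Qed.

Definition n2 f := Num.sqrt (Int (fun x => f x ^+ 2)).

Lemma n2_ge0 f : 0 <= n2 f.
Proof. exact: sqrtr_ge0. Qed.

Lemma sqr_n2 f : n2 f ^+ 2 = Int (fun x => f x ^+ 2).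
Proof. by rewrite sqr_sqrtr// Int_ge0// => x; exact: sqr_ge0. Qed.

Lemma n2_comp f (t : X -> X) : measure_preserving mu t -> bm f ->
  n2 (fun x => f (t x)) = n2 f.
Proof.
move=> mt bf; rewrite /n2 (@Int_comp (fun x => f x ^+ 2))//; exact: bmX2.
Qed.

Lemma n2Z c f : bm f -> n2 (fun x => c * f x) = `|c| * n2 f.
Proof.
move=> bf; rewrite /n2 (_ : (fun x => _) = fun x => c ^+ 2 * f x ^+ 2).
  rewrite IntZ; last exact: bmX2. by rewrite sqrtrM ?sqr_ge0// sqrtr_sqr.
by apply/funext => x; rewrite exprMn.
Qed.

Lemma n2N f : n2 (fun x => - f x) = n2 f.
Proof. by rewrite /n2; under [fun x => _]eq_fun do rewrite sqrrN. Qed.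

Lemma n2_le B f : bm f -> 0 <= B -> (forall x, `|f x| <= B) -> n2 f <= B.
Proof.
move=> bf B0 fB; rewrite -(ler_pXn2r (n:=2))// ?nnegrE ?n2_ge0// sqr_n2.
rewrite -[leRHS]Int_cst; apply: le_Int; [exact: bmX2|exact: bm_cst|].
by move=> x; rewrite -[leLHS]real_normK ?num_real// ler_pXn2r// nnegrE.
Qed.

Lemma le_n2 f g : bm f -> bm g -> (forall x, `|f x| <= `|g x|) -> n2 f <= n2 g.
Proof.
move=> bf bg fg; rewrite -(ler_pXn2r (n:=2))// ?nnegrE ?n2_ge0// !sqr_n2.
apply: le_Int; [exact: bmX2|exact: bmX2|].
move=> x; rewrite -[leLHS]real_normK ?num_real// -[leRHS]real_normK ?num_real//.
by rewrite ler_pXn2r// nnegrE.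
Qed.

Lemma Int_mul_le f g : bm f -> bm g -> Int (fun x => f x * g x) <= n2 f * n2 g.
Proof.
move=> bf bg.
have key (a b : R) : 0 < a -> 0 < b -> n2 f <= a -> n2 g <= b ->
    Int (fun x => f x * g x) <= a * b.
  move=> a0 b0 fa gb.
  have : 0 <= Int (fun x => (b * f x - a * g x) ^+ 2).
    by apply: Int_ge0 => x; exact: sqr_ge0.
  rewrite (_ : (fun x => _) = fun x =>
    b ^+ 2 * f x ^+ 2 + a ^+ 2 * g x ^+ 2 - (2 * a * b) * (f x * g x)); last first.
    by apply/funext => x; ring.
  have bf2 := bmX2 bf; have bg2 := bmX2 bg; have bfg := bmM bf bg.
  rewrite IntB; [|exact: bmD (bmZ _ _) (bmZ _ _)|exact: bmZ].
  rewrite IntD; [|exact: bmZ|exact: bmZ].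
  rewrite !IntZ// -!sqr_n2.
  have : n2 f ^+ 2 <= a ^+ 2 by rewrite ler_pXn2r// nnegrE ?n2_ge0// ltW.
  have : n2 g ^+ 2 <= b ^+ 2 by rewrite ler_pXn2r// nnegrE ?n2_ge0// ltW.
  move: (n2 f ^+ 2) (n2 g ^+ 2) (Int _) => u v w vb ua h.
  have ab0 : 0 < a * b by exact: mulr_gt0.
  rewrite -(ler_pM2l ab0).
  have : b ^+ 2 * u <= b ^+ 2 * a ^+ 2 by rewrite ler_wpM2l ?sqr_ge0.
  have : a ^+ 2 * v <= a ^+ 2 * b ^+ 2 by rewrite ler_wpM2l ?sqr_ge0.
  by nra.
apply/ler_addgt0Pr => e e0.
pose F := n2 f; pose G := n2 g.
have F0 : 0 <= F := n2_ge0 f; have G0 : 0 <= G := n2_ge0 g.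
pose t := Num.min 1 (e / (F + G + 1)).
have D0 : 0 < F + G + 1 by rewrite ltr_wpDl// addr_ge0.
have t0 : 0 < t by rewrite lt_min ltr01 divr_gt0.
have te : t * (F + G + 1) <= e by rewrite -ler_pdivlMr// ge_min lexx orbT.
have t1 : t <= 1 by rewrite ge_min lexx.
apply: (le_trans (key (F + t) (G + t) _ _ _ _)).
- by rewrite ltr_wpDl.
- by rewrite ltr_wpDl.
- by rewrite lerDl ltW.
- by rewrite lerDl ltW.
- by rewrite -/F -/G; nra.
Qed.

Lemma n2D f g : bm f -> bm g -> n2 (fun x => f x + g x) <= n2 f + n2 g.
Proof.
move=> bf bg; rewrite -(ler_pXn2r (n:=2))// ?nnegrE ?addr_ge0 ?n2_ge0//.
rewrite sqr_n2 (_ : (fun x => _) = fun x =>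
  f x ^+ 2 + 2 * (f x * g x) + g x ^+ 2); last by apply/funext => x; ring.
have bf2 := bmX2 bf; have bg2 := bmX2 bg; have bfg := bmM bf bg.
rewrite IntD; [|exact: bmD (bmZ _ _)|by []].
rewrite IntD; [|by []|exact: bmZ].
rewrite IntZ// -!sqr_n2.
have := Int_mul_le bf bg; move: (Int _) => w h; nra.
Qed.

Lemma n2B f g : bm f -> bm g -> n2 (fun x => f x - g x) <= n2 f + n2 g.
Proof.
move=> bf bg; rewrite -(n2N g); apply: n2D => //.
by case: bg => C bg; exists C; exact: bddN.
Qed.

Lemma n2_sum I (r : seq I) (f : I -> X -> R) : (forall i, bm (f i)) ->
  n2 (fun x => \sum_(i <- r) f i x) <= \sum_(i <- r) n2 (f i).
Proof.
move=> bf; elim: r => [|i r IHr].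
  rewrite [fun x : X => _](_ : _ = fun=> (\big[+%R/0]_(i <- [::]) f i point));
    last by apply/funext => x; rewrite !big_nil.
  by rewrite !big_nil; apply: n2_le => [|//|x]; [exact: bm_cst|rewrite normr0].
rewrite [fun x : X => _](_ : _ = fun x => f i x + \big[+%R/0]_(j <- r) f j x);
  last by apply/funext => x; rewrite big_cons.
by rewrite big_cons (le_trans (n2D _ _))// ?lerD2l//; exact: bm_sum.
Qed.

Lemma n2M_le B f g : bm f -> bm g -> (forall x, `|f x| <= B) ->
  n2 (fun x => f x * g x) <= B * n2 g.
Proof.
move=> bf bg fB.
have B0 : 0 <= B := le_trans (normr_ge0 _) (fB point).
rewrite -[B]ger0_norm// -n2Z// le_n2//; [exact: bmM|exact: bmZ|].
by move=> x; rewrite !normrM ler_wpM2r// (le_trans (fB x))// ler_norm.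
Qed.

Lemma Int_norm_le f : bm f -> Int (fun x => `|f x|) <= n2 f.
Proof.
move=> bf; have := Int_mul_le (bm_norm bf) (bm_cst 1).
under [fun x => _]eq_fun do rewrite mulr1.
rewrite /n2.
under [fun x => `|f x| ^+ 2]eq_fun do rewrite real_normK ?num_real//.
by rewrite Int_cst expr1n sqrtr1 mulr1.
Qed.

End BoundedMeasurable.

(** * Multiple averages and dual functions *)

Section IntegerAction.
Context (X : Type) (T S : X -> X) (TK : cancel T S) (SK : cancel S T).

Definition zpow (n : int) : X -> X :=
  match n with Posz k => iter k T | Negz k => iter k.+1 S end.

Lemma zpow1D a x : zpow (1 + a) x = T (zpow a x).
Proof.
case: a => [k|[|k]]; [by []|by rewrite /= SK|].
have -> : 1 + Negz k.+1 = Negz k by lia.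
by rewrite /= SK.
Qed.

Lemma zpowB1 a x : zpow (a - 1) x = S (zpow a x).
Proof. by rewrite -{2}(subrK 1 a) [a - 1 + 1]addrC zpow1D TK. Qed.

Lemma zpowD a b x : zpow (a + b) x = zpow a (zpow b x).
Proof.
elim/int_rect: a b => [|n IHn|n IHn] b; first by rewrite add0r.
  rewrite (_ : n.+1%:Z + b = 1 + (n%:Z + b)); last by lia.
  by rewrite (_ : n.+1%:Z = 1 + n%:Z) ?zpow1D ?IHn//; lia.
rewrite (_ : - n.+1%:Z + b = (- n%:Z + b) - 1); last by lia.
by rewrite (_ : - n.+1%:Z = - n%:Z - 1) ?zpowB1 ?IHn//; lia.
Qed.

End IntegerAction.

Lemma measure_preserving_zpow d (X : measurableType d) (R : realType)
    (mu : {measure set X -> \bar R}) (T S : X -> X) (TK : cancel T S) n :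
  measurable_fun setT S -> measure_preserving mu T ->
  measure_preserving mu (zpow T S n).
Proof.
move=> mS mpT.
have mpS : measure_preserving mu S.
  split=> // A mA; case: mpT => mT TP; rewrite -(TP (S @^-1` A)).
    by congr (mu _); apply/seteqP; split => x /=; rewrite /preimage /= TK.
  by rewrite -[_ @^-1` _]setTI; exact: mS.
have mpi (U : X -> X) k : measure_preserving mu U -> measure_preserving mu (iter k U).
  move=> [mU UP]; elim: k => [|k [mk kP]]; first by split; [exact: measurable_id|].
  split; first exact: (measurableT_comp mU mk).
  move=> A mA; rewrite -(UP _ mA) -(kP (U @^-1` A))//.
  by rewrite -[_ @^-1` _]setTI; exact: mU.
by case: n => k; exact: mpi.
Qed.

Section MultipleAverages.
Context d (X : measurableType d) (R : realType) (mu : probability X R).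
Context (Z : int -> X -> X).
Hypothesis Zmp : forall a, measure_preserving mu (Z a).
Hypothesis Z0 : forall x, Z 0 x = x.
Hypothesis ZD : forall a b x, Z (a + b) x = Z a (Z b x).
Implicit Types (f g u w : X -> R) (l : seq (int * (X -> R))) (a : int).

Let mZ a : measurable_fun setT (Z a). Proof. by have [] := Zmp a. Qed.

Fixpoint all_bdd1 l := if l is q :: l' then bdd 1 q.2 /\ all_bdd1 l' else True.

Lemma bdd_prod l (F : int -> int) : all_bdd1 l ->
  bdd 1 (fun x => \prod_(q <- l) q.2 (Z (F q.1) x)).
Proof.
elim: l => [|q l IHl] /= => [_|[bq bl]].
  rewrite [fun x : X => _](_ : _ = fun=> 1); last by apply/funext => x; rewrite big_nil.
  by rewrite -[X in bdd X](@normr1 R); exact: bdd_cst.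
rewrite [fun x : X => _](_ : _ = fun x => q.2 (Z (F q.1) x) *
  \prod_(q <- l) q.2 (Z (F q.1) x)); last by apply/funext => x; rewrite big_cons.
rewrite -[X in bdd X]mulr1; apply: bddM; last exact: IHl.
exact: bdd_comp.
Qed.

Definition multiple_avg l n x : R :=
  n%:R^-1 * \sum_(h < n) \prod_(q <- l) q.2 (Z (q.1 * h%:Z) x).

Definition dual_function a g l n x : R :=
  n%:R^-1 * \sum_(m < n)
    g (Z (- a * m%:Z) x) * \prod_(q <- l) q.2 (Z ((q.1 - a) * m%:Z) x).

Definition avg_jump l p q := n2 mu (fun x => multiple_avg l p x - multiple_avg l q x).

Lemma bdd_mean B (F : nat -> X -> R) n : 0 <= B -> (forall h, bdd B (F h)) ->
  bdd B (fun x => n%:R^-1 * \sum_(h < n) F h x).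
Proof.
move=> B0 bF; case: n => [|n].
  rewrite [fun x : X => _](_ : _ = fun=> 0); last first.
    by apply/funext => x; rewrite big_ord0 mulr0.
  by apply: (bdd_le B0); rewrite -[X in bdd X](@normr0 R R); exact: bdd_cst.
rewrite -(_ : `|n.+1%:R^-1| * (\sum_(h < n.+1) B) = B).
  apply: bddZ; exact: (@bdd_sum _ _ _ _ _ (fun=> B) (fun i : 'I_n.+1 => F i)).
by rewrite sumr_const card_ord -[B *+ _]mulr_natl ger0_norm ?invr_ge0// mulKf.
Qed.

Lemma bdd_avg_cons B a u l n : 0 <= B -> bdd B u -> all_bdd1 l ->
  bdd B (multiple_avg ((a, u) :: l) n).
Proof.
move=> B0 bu bl; apply: (@bdd_mean B
  (fun h x => \prod_(q <- (a, u) :: l) q.2 (Z (q.1 * h%:Z) x))) => // h.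
rewrite [fun x : X => _](_ : _ = fun x => u (Z (a * h%:Z) x) *
  \prod_(q <- l) q.2 (Z (q.1 * h%:Z) x)); last by apply/funext => x; rewrite big_cons.
rewrite -[X in bdd X]mulr1; apply: bddM; first exact: bdd_comp.
exact: (bdd_prod (fun a => a * h%:Z)).
Qed.

Lemma bdd_avg l n : all_bdd1 l -> bdd 1 (multiple_avg l n).
Proof.
move=> bl; apply: (@bdd_mean 1 (fun h x => \prod_(q <- l) q.2 (Z (q.1 * h%:Z) x))) => // h.
exact: (bdd_prod (fun a => a * h%:Z)).
Qed.

Lemma bm_avg_cons a u l n : bm u -> all_bdd1 l -> bm (multiple_avg ((a, u) :: l) n).
Proof.
move=> [B bu] bl; exists `|B|; apply: bdd_avg_cons => //.
exact: bdd_le (ler_norm _) bu.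
Qed.

Lemma bdd_dual B a g l n : 0 <= B -> bdd B g -> all_bdd1 l -> bdd B (dual_function a g l n).
Proof.
move=> B0 bg bl; apply: (@bdd_mean B (fun m x => g (Z (- a * m%:Z) x) *
   \prod_(q <- l) q.2 (Z ((q.1 - a) * m%:Z) x))) => // m.
rewrite -[X in bdd X]mulr1; apply: bddM; first exact: bdd_comp.
exact: (bdd_prod (fun b => (b - a) * m%:Z)).
Qed.

Lemma bm_dual a g l n : bm g -> all_bdd1 l -> bm (dual_function a g l n).
Proof.
move=> [B bg] bl; exists `|B|; apply: bdd_dual => //.
exact: bdd_le (ler_norm _) bg.
Qed.

Lemma avgB a u w l n x :
  multiple_avg ((a, fun x => u x - w x) :: l) n x =
    multiple_avg ((a, u) :: l) n x - multiple_avg ((a, w) :: l) n x.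
Proof.
rewrite /multiple_avg -mulrBr -sumrB; congr (_ * _); apply: eq_bigr => h _.
by rewrite !big_cons mulrBl.
Qed.

Lemma avgD a u w l n x :
  multiple_avg ((a, fun x => u x + w x) :: l) n x =
    multiple_avg ((a, u) :: l) n x + multiple_avg ((a, w) :: l) n x.
Proof.
rewrite /multiple_avg -mulrDr -big_split; congr (_ * _); apply: eq_bigr => h _.
by rewrite !big_cons mulrDl.
Qed.

Lemma avgZ a c u l n x :
  multiple_avg ((a, fun x => c * u x) :: l) n x = c * multiple_avg ((a, u) :: l) n x.
Proof.
rewrite /multiple_avg mulrCA; congr (_ * _); rewrite mulr_sumr; apply: eq_bigr => h _.
by rewrite !big_cons mulrA.
Qed.

Lemma dualZ a c g l n x :
  dual_function a (fun x => c * g x) l n x = c * dual_function a g l n x.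
Proof.
rewrite /dual_function mulrCA; congr (_ * _); rewrite mulr_sumr; apply: eq_bigr => h _.
by rewrite mulrA.
Qed.

Lemma n2_dual a g l n : bm g -> all_bdd1 l -> n2 mu (dual_function a g l n) <= n2 mu g.
Proof.
move=> bg bl; case: n => [|n].
  rewrite (_ : dual_function a g l 0 = fun=> 0); last first.
    by apply/funext => x; rewrite /dual_function big_ord0 mulr0.
  rewrite (le_trans _ (n2_ge0 mu g))//.
  by apply: n2_le => [|//|x]; [exact: bm_cst|rewrite normr0].
have bP m := bdd_prod (fun b => (b - a) * m%:Z) bl.
have bt m : bm (fun x => g (Z (- a * m%:Z) x) *
   \prod_(q <- l) q.2 (Z ((q.1 - a) * m%:Z) x)).
  by apply: bmM; [exact: bm_comp|exact: (bdd_bm (bP m))].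
rewrite /dual_function n2Z; last exact: bm_sum.
rewrite ger0_norm ?invr_ge0// ler_pdivrMl ?ltr0n//.
apply: (le_trans (n2_sum _ _ _)) => //.
apply: (@le_trans _ _ (\sum_(m < n.+1) n2 mu g)); last first.
  by rewrite sumr_const card_ord mulr_natl.
apply: ler_sum => m _; rewrite -(n2_comp (Zmp (- a * m%:Z)) bg).
under [fun x => _]eq_fun do rewrite mulrC.
rewrite -[leRHS]mul1r; apply: n2M_le; [exact: (bdd_bm (bP m))|exact: bm_comp|].
by case: (bP m).
Qed.

Lemma avg_dual_pairing a f g l n : bm f -> bm g -> all_bdd1 l ->
  Int mu (fun x => g x * multiple_avg ((a, f) :: l) n x) =
    Int mu (fun x => f x * dual_function a g l n x).
Proof.
move=> bf bg bl.
have bP m : bm (fun x => \prod_(q <- l) q.2 (Z (q.1 * m%:Z) x)).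
  exact: bdd_bm (bdd_prod (fun b => b * m%:Z) bl).
have bP' m : bm (fun x => \prod_(q <- l) q.2 (Z ((q.1 - a) * m%:Z) x)).
  exact: bdd_bm (bdd_prod (fun b => (b - a) * m%:Z) bl).
have b1 m : bm (fun x => g x * (f (Z (a * m%:Z) x) *
    \prod_(q <- l) q.2 (Z (q.1 * m%:Z) x))).
  by apply: bmM => //; apply: bmM => //; exact: bm_comp.
have b2 m : bm (fun x => f x * (g (Z (- a * m%:Z) x) *
   \prod_(q <- l) q.2 (Z ((q.1 - a) * m%:Z) x))).
  by apply: bmM => //; apply: bmM => //; exact: bm_comp.
transitivity (n%:R^-1 * \sum_(m < n) Int mu (fun x => g x * (f (Z (a * m%:Z) x) *
    \prod_(q <- l) q.2 (Z (q.1 * m%:Z) x)))).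
  rewrite -Int_sum// -IntZ; last by apply: bm_sum.
  congr Int; apply/funext => x; rewrite /multiple_avg mulrCA; congr (_ * _).
  by rewrite mulr_sumr; apply: eq_bigr => m _; rewrite big_cons.
transitivity (n%:R^-1 * \sum_(m < n) Int mu (fun x => f x * (g (Z (- a * m%:Z) x) *
   \prod_(q <- l) q.2 (Z ((q.1 - a) * m%:Z) x)))); last first.
  rewrite -Int_sum// -IntZ; last exact: bm_sum.
  congr Int; apply/funext => x; rewrite /dual_function [RHS]mulrCA; congr (_ * _).
  by rewrite mulr_sumr; apply: eq_bigr.
congr (_ * _); apply: eq_bigr => m _.
rewrite -(Int_comp (Zmp (- a * m%:Z)) (b1 m)); congr Int; apply/funext => x.
rewrite -ZD mulNr subrr Z0 mulrCA; congr (_ * (_ * _)).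
by apply: eq_bigr => q _; rewrite -ZD; congr (q.2 (Z _ x)); ring.
Qed.

(* Expand the square: the cross term is the squared norm of the average, by
   duality, and the dual function is not larger than the average. *)
Lemma energy_decrement a u l n : bm u -> all_bdd1 l ->
  let g := multiple_avg ((a, u) :: l) n in
  n2 mu (fun x => u x - dual_function a g l n x) ^+ 2 <= n2 mu u ^+ 2 - n2 mu g ^+ 2.
Proof.
move=> bu bl /=; set g := multiple_avg _ n.
have bg : bm g by exact: bm_avg_cons.
have bD : bm (dual_function a g l n) by exact: bm_dual.
rewrite !sqr_n2 (_ : (fun x => (u x - _) ^+ 2) = fun x =>
  u x ^+ 2 - 2 * (u x * dual_function a g l n x) + dual_function a g l n x ^+ 2); last first.
  by apply/funext => x; ring.
have bu2 := bmX2 bu; have bD2 := bmX2 bD; have buD := bmM bu bD.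
rewrite IntD; [|exact: bmB (bmZ _ _)|by []].
rewrite IntB; [|by []|exact: bmZ].
rewrite IntZ// -avg_dual_pairing// -/g.
have -> : Int mu (fun x => g x * g x) = n2 mu g ^+ 2 by rewrite sqr_n2.
rewrite -!sqr_n2.
have : n2 mu (dual_function a g l n) ^+ 2 <= n2 mu g ^+ 2.
  by rewrite ler_pXn2r ?nnegrE ?n2_ge0// n2_dual.
lra.
Qed.

Lemma sum_shift_le (phi : int -> R) n h : (forall k, `|phi k| <= 1) ->
  `|\sum_(m < n) phi (m%:Z - h%:Z) - \sum_(m < n) phi m%:Z| <= (2 * h)%:R.
Proof.
move=> phi1; elim: h => [|h IHh].
  by rewrite (eq_bigr (fun m : 'I_n => phi m%:Z)) ?subrr ?normr0// => m _; rewrite subr0.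
rewrite mulnS natrD -(subrK (\sum_(m < n) phi (m%:Z - h%:Z)) (\sum_(m < n) _)) -addrA.
rewrite (le_trans (ler_normD _ _))// lerD// {IHh}.
case: n => [|n]; first by rewrite !big_ord0 subrr normr0.
rewrite big_ord_recl big_ord_recr /=.
rewrite (eq_bigr (fun m : 'I_n => phi (m%:Z - h%:Z))); last first.
  by move=> m _; congr phi; rewrite /bump /=; lia.
rewrite [X in _ - X]addrC opprD addrA [X in `|X|]addrAC addrK (le_trans (ler_normB _ _))//.
by rewrite (natrD _ 1 1) lerD.
Qed.

Definition twist a m l : seq (int * (X -> R)) :=
  [seq (q.1, fun x => q.2 x * q.2 (Z ((q.1 - a) * m%:Z) x)) | q <- l].

Lemma all_bdd1_twist a m l : all_bdd1 l -> all_bdd1 (twist a m l).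
Proof.
elim: l => //= q l IHl [bq /IHl]; split=> //.
by rewrite -[X in bdd X]mulr1; apply: bddM => //; exact: bdd_comp.
Qed.

Lemma map_fst_twist a m l : map fst (twist a m l) = map fst l.
Proof. by rewrite -map_comp; exact: eq_map. Qed.

(* Shifting the inner variable [m] by [h] turns the average of a dual function
   into a mean of averages with one function less. *)
Lemma avg_dual_approx a g l n k x : (0 < n)%N -> (0 < k)%N -> bdd 1 g -> all_bdd1 l ->
  `|multiple_avg ((a, dual_function a g l n) :: l) k x -
    n%:R^-1 * \sum_(m < n) g (Z (- a * m%:Z) x) * multiple_avg (twist a m l) k x|
    <= 2 * k%:R / n%:R.
Proof.
move=> n0 k0 bg bl.
pose phi (h : nat) (m : int) := g (Z (- a * m) x) *
  \prod_(q <- l) q.2 (Z ((q.1 - a) * m + q.1 * h%:Z) x).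
have phi1 h m : `|phi h m| <= 1.
  rewrite /phi normrM mulr_ile1//; first by case: bg.
  by case: (bdd_prod (fun b => (b - a) * m + b * h%:Z) bl) => _ /(_ x).
pose psi h := \prod_(q <- l) q.2 (Z (q.1 * h%:Z) x).
have psi1 h : `|psi h| <= 1.
  by case: (bdd_prod (fun b => b * h%:Z) bl) => _ /(_ x).
have -> : multiple_avg ((a, dual_function a g l n) :: l) k x =
    k%:R^-1 * \sum_(h < k) (n%:R^-1 * \sum_(m < n) phi h (m%:Z - h%:Z)) * psi h.
  rewrite /multiple_avg; congr (_ * _); apply: eq_bigr => h _; rewrite big_cons /=.
  congr (_ * _); rewrite /dual_function; congr (_ * _); apply: eq_bigr => m _.
  rewrite /phi -ZD; congr (g (Z _ x) * _); first by ring.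
  by apply: eq_bigr => q _; rewrite -ZD; congr (q.2 (Z _ x)); ring.
have -> : n%:R^-1 * (\sum_(m < n) g (Z (- a * m%:Z) x) * multiple_avg (twist a m l) k x) =
    k%:R^-1 * \sum_(h < k) (n%:R^-1 * \sum_(m < n) phi h m%:Z) * psi h.
  rewrite mulr_sumr (eq_bigr (fun m : 'I_n => \sum_(h < k) k%:R^-1 *
    (n%:R^-1 * phi h m%:Z * psi h))); last first.
    move=> m _; rewrite /multiple_avg -[RHS]mulr_sumr [in LHS]mulrA [in LHS]mulrCA.
    congr (_ * _); rewrite mulr_sumr; apply: eq_bigr => h _.
    rewrite /phi /psi -!mulrA; do 2 congr (_ * _).
    rewrite /twist big_map mulrC -big_split; apply: eq_bigr => q _ /=.
    by rewrite -ZD.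
  rewrite exchange_big mulr_sumr; apply: eq_bigr => h _.
  by rewrite -mulr_sumr; congr (_ * _); rewrite mulr_sumr mulr_suml.
rewrite -mulrBr -sumrB normrM ger0_norm ?invr_ge0//.
rewrite ler_pdivrMl ?ltr0n// (le_trans (ler_norm_sum _ _ _))//.
apply: (@le_trans _ _ (\sum_(h < k) (2 * k%:R / n%:R))); last first.
  by rewrite sumr_const card_ord -[leLHS]mulr_natl.
apply: ler_sum => h _; rewrite -mulrBl -mulrBr !normrM.
rewrite -[leRHS]mulr1 ler_pM//.
rewrite ger0_norm ?invr_ge0// mulrC ler_wpM2r ?invr_ge0//.
apply: (le_trans (sum_shift_le _ _ (phi1 h))).
by rewrite natrM ler_wpM2l// ler_nat ltnW.
Qed.

Lemma bm_avgB l p q : all_bdd1 l -> bm (fun x => multiple_avg l p x - multiple_avg l q x).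
Proof. by move=> bl; apply: bmB; apply: bdd_bm (bdd_avg _ bl). Qed.

Lemma bm_avg_consB a u l p q : bm u -> all_bdd1 l ->
  bm (fun x => multiple_avg ((a, u) :: l) p x - multiple_avg ((a, u) :: l) q x).
Proof. by move=> bu bl; apply: bmB; exact: bm_avg_cons. Qed.

Lemma jump_dual_le a g l n p q : (0 < n)%N -> (0 < p)%N -> (0 < q)%N ->
  bdd 1 g -> all_bdd1 l ->
  avg_jump ((a, dual_function a g l n) :: l) p q <=
    2 * p%:R / n%:R + 2 * q%:R / n%:R +
    n%:R^-1 * \sum_(m < n) avg_jump (twist a m l) p q.
Proof.
move=> n0 p0 q0 bg bl.
pose M k x := n%:R^-1 * \sum_(m < n) g (Z (- a * m%:Z) x) * multiple_avg (twist a m l) k x.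
have bt m k : bdd 1 (fun x => g (Z (- a * m%:Z) x) * multiple_avg (twist a m l) k x).
  rewrite -[X in bdd X]mulr1; apply: bddM; first exact: bdd_comp.
  exact/bdd_avg/all_bdd1_twist.
have bM k : bdd 1 (M k).
  exact: (@bdd_mean 1 (fun m x => g (Z (- a * m%:Z) x) * multiple_avg (twist a m l) k x)).
have bD := bdd_dual a n ler01 bg bl.
have bA k := bdd_avg_cons a k ler01 bD bl.
have h1 k : (0 < k)%N ->
    n2 mu (fun x => multiple_avg ((a, dual_function a g l n) :: l) k x - M k x) <=
      2 * k%:R / n%:R.
  move=> k0; apply: n2_le; first by exists (1 + 1); exact: bddB.
    by rewrite !mulr_ge0// invr_ge0.
  by move=> x; exact: avg_dual_approx.
have h2 : n2 mu (fun x => M p x - M q x) <= n%:R^-1 * \sum_(m < n) avg_jump (twist a m l) p q.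
  rewrite (_ : (fun x => _) = fun x => n%:R^-1 * \sum_(m < n) g (Z (- a * m%:Z) x) *
     (multiple_avg (twist a m l) p x - multiple_avg (twist a m l) q x)); last first.
    apply/funext => x; rewrite -mulrBr -sumrB; congr (_ * _).
    by apply: eq_bigr => m _; rewrite mulrBr.
  have bd m : bm (fun x => g (Z (- a * m%:Z) x) *
     (multiple_avg (twist a m l) p x - multiple_avg (twist a m l) q x)).
    apply: bmM; first exact: bdd_bm (bdd_comp _ bg).
    exact/bm_avgB/all_bdd1_twist.
  rewrite n2Z; last exact: bm_sum.
  rewrite ger0_norm ?invr_ge0// ler_wpM2l ?invr_ge0//.
  apply: (le_trans (n2_sum _ _ _)) => //; apply: ler_sum => m _.
  rewrite -[leRHS]mul1r; apply: n2M_le; first exact: bdd_bm (bdd_comp _ bg).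
    exact/bm_avgB/all_bdd1_twist.
  by case: (bdd_comp (mZ (- a * m%:Z)) bg).
rewrite /avg_jump (_ : (fun x => _) = fun x =>
  ((multiple_avg ((a, dual_function a g l n) :: l) p x - M p x) -
   (multiple_avg ((a, dual_function a g l n) :: l) q x - M q x)) + (M p x - M q x)); last first.
  by apply/funext => x; ring.
have bmA k := bdd_bm (bA k); have bmMk k := bdd_bm (bM k).
rewrite (le_trans (n2D _ _ _))//; [by do !apply: bmB|exact: bmB|].
rewrite lerD// (le_trans (n2B _ _ _))//; [exact: bmB|exact: bmB|].
by rewrite lerD// h1.
Qed.

Lemma jump_le2 l p q : all_bdd1 l -> avg_jump l p q <= 2.
Proof.
move=> bl; apply: n2_le => //; first exact: bm_avgB.
by case: (bddB (bdd_avg p bl) (bdd_avg q bl)).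
Qed.

End MultipleAverages.

(** * Norm convergence of multiple averages *)

Section NormConvergence.
Context d (X : measurableType d) (R : realType) (mu : probability X R).
Context (Z : int -> X -> X).
Hypothesis Zmp : forall a, measure_preserving mu (Z a).
Hypothesis Z0 : forall x, Z 0 x = x.
Hypothesis ZD : forall a b x, Z (a + b) x = Z a (Z b x).
Implicit Types (f g u w : X -> R) (l : seq (int * (X -> R))) (a : int).

Local Notation avg := (multiple_avg Z).
Local Notation dual := (dual_function Z).
Local Notation jump := (avg_jump mu Z).
Local Notation n2 := (n2 mu).

Definition separated (C : nat) (P Q : nat -> nat) :=
  (forall i, 0 < P i /\ 0 < Q i)%N /\
  (forall i j, i < j ->
     [/\ C * P i <= P j, C * P i <= Q j, C * Q i <= P j & C * Q i <= Q j])%N.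

(* A quantitative form of the Cauchy property that is uniform in the functions
   and, the jumps being summed, passes to means over a family of functions. *)
Definition small_jumps (sl : seq int) := forall e : R, 0 < e ->
  exists L C : nat, (0 < L)%N /\ forall P Q, separated C P Q ->
    forall l, map fst l = sl -> all_bdd1 l ->
    \sum_(i < L) jump l (P i) (Q i) <= e * L%:R.

Lemma separatedW C C' P Q : (C' <= C)%N -> separated C P Q -> separated C' P Q.
Proof.
move=> CC [h0 h]; split=> // i j /h[h1 h2 h3 h4].
have le x : (C' * x <= C * x)%N by rewrite leq_mul2r CC orbT.
by split; [apply: leq_trans h1|apply: leq_trans h2|apply: leq_trans h3|apply: leq_trans h4].
Qed.

Lemma separated_shift C k P Q : separated C P Q ->
  separated C (fun i => P (k + i)%N) (fun i => Q (k + i)%N).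
Proof. by move=> [h0 h]; split=> // i j ij; apply: h; rewrite ltn_add2l. Qed.

Lemma small_jumps_nil : small_jumps [::].
Proof.
move=> e e0; exists 1%N, 0%N; split=> // P Q [h0 _] [|//] _ _.
have avg1 n x : (0 < n)%N -> avg [::] n x = 1.
  move=> n0; rewrite /multiple_avg; under eq_bigr do rewrite big_nil.
  by rewrite sumr_const card_ord mulVf// pnatr_eq0 -lt0n.
rewrite big_ord1 mulr1 /avg_jump (le_trans _ (ltW e0))//.
apply: n2_le => // [|x]; last by rewrite !avg1 ?subrr ?normr0//; case: (h0 0%N).
by apply: bm_avgB.
Qed.

Section InductiveStep.
Variables (a : int) (sl : seq int) (e1 e2 delta : R) (L C T : nat).
Variables (P Q : nat -> nat) (f : X -> R) (l : seq (int * (X -> R))).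
Hypotheses (sepPQ : separated C P Q) (bf : bdd 1 f) (bl : all_bdd1 l).
Hypothesis hsl : map fst l = sl.
Hypothesis hL : forall P' Q', separated C P' Q' ->
  forall l', map fst l' = sl -> all_bdd1 l' ->
  \sum_(i < L) jump l' (P' i) (Q' i) <= e1 * L%:R.
Hypotheses (C0 : (0 < C)%N) (hC : e1 + 4 / C%:R <= e2).
Hypotheses (delta0 : 0 < delta) (hT : 1 <= T%:R * delta ^+ 2) (e20 : 0 < e2).

Definition block_jumps u b := \sum_(i < L)
  jump ((a, u) :: l) (P (b * L + i)%N) (Q (b * L + i)%N).

Lemma block_jumps_dual g n b : (0 < n)%N ->
  (forall i, i < L -> C * P (b * L + i) <= n /\ C * Q (b * L + i) <= n)%N ->
  bdd 1 g -> block_jumps (dual a g l n) b <= e2 * L%:R.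
Proof.
move=> n0 hn bg.
have [h0 _] := sepPQ.
apply: (@le_trans _ _ (\sum_(i < L) (4 / C%:R + n%:R^-1 * \sum_(m < n)
  jump (twist Z a m l) (P (b * L + i)%N) (Q (b * L + i)%N)))).
  apply: ler_sum => i _; apply: (le_trans (jump_dual_le Zmp ZD _ _ _ _ _ _)) => //.
  - by case: (h0 (b * L + i)%N).
  - by case: (h0 (b * L + i)%N).
  rewrite lerD2r -mulrDl -mulrDr.
  have [hp hq] := hn i (ltn_ord i).
  rewrite ler_pdivrMr ?ltr0n// -mulrAC ler_pdivlMr ?ltr0n// -!natrM -natrD -!natrM ler_nat.
  by lia.
rewrite big_split /= sumr_const card_ord -[X in X + _]mulr_natr.
apply: (@le_trans _ _ ((e1 + 4 / C%:R) * L%:R)); last by rewrite ler_wpM2r.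
rewrite [leRHS]mulrDl [leLHS]addrC lerD2r -mulr_sumr exchange_big /=.
rewrite ler_pdivrMl ?ltr0n//.
apply: (@le_trans _ _ (\sum_(m < n) (e1 * L%:R))); last first.
  by rewrite sumr_const card_ord -[leLHS]mulr_natl.
apply: ler_sum => m _.
apply: (hL (separated_shift (b * L) sepPQ)); first by rewrite map_fst_twist.
exact: all_bdd1_twist.
Qed.

(* The invariant of the energy argument, [w] being a sum of [t] dual functions
   of scales much larger than those of the blocks below [b]. *)
Definition structured w (t b : nat) := [/\ bdd (2 ^+ t - 1) w,
  n2 (fun x => f x - w x) ^+ 2 <= 1 - t%:R * delta ^+ 2 &
  forall b', (b' < b)%N -> block_jumps w b' <= 2 ^+ t * e2 * L%:R].

Lemma structured_le w t b : structured w t b -> (t <= T)%N.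
Proof.
move=> [_ h _]; rewrite leqNgt; apply/negP => Tt.
have : T.+1%:R <= t%:R :> R by rewrite ler_nat.
have := le_trans (sqr_ge0 (n2 _)) h.
rewrite -natr1; have : 0 < delta ^+ 2 by rewrite exprn_gt0.
have := hT; nra.
Qed.

Lemma structured_update w t b i n : structured w t b.+1 -> (i < L)%N ->
  n = P (b * L + i)%N \/ n = Q (b * L + i)%N ->
  delta < n2 (avg ((a, fun x => f x - w x) :: l) n) ->
  exists w', structured w' t.+1 b.
Proof.
move=> [bw ew jw] iL hn hbad.
have [h0 h1] := sepPQ.
have n0 : (0 < n)%N by have [p q] := h0 (b * L + i)%N; case: hn => ->.
set u := fun x => f x - w x.
have p2 : 0 <= 2 ^+ t :> R by rewrite exprn_ge0.
have bu : bdd (2 ^+ t) u.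
  by apply: bdd_le (bddB bf bw); rewrite addrC subrK.
pose g := avg ((a, u) :: l) n.
have bg : bdd (2 ^+ t) g by exact: bdd_avg_cons.
have bD : bdd (2 ^+ t) (dual a g l n) by exact: bdd_dual.
exists (fun x => w x + dual a g l n x); split.
- by apply: bdd_le (bddD bw bD); rewrite exprS; lra.
- rewrite (_ : (fun x => _) = fun x => u x - dual a g l n x); last first.
    by apply/funext => x; rewrite opprD addrA.
  have := energy_decrement Zmp Z0 ZD a n (bdd_bm bu) bl; rewrite /= -/g.
  have : delta ^+ 2 <= n2 g ^+ 2.
    by rewrite ler_pXn2r ?nnegrE ?n2_ge0 ?ltW.
  have : n2 u ^+ 2 <= 1 - t%:R * delta ^+ 2 by [].
  by rewrite -[t.+1%:R]natr1; nra.
move=> b' b'b.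
have jwb := jw b' (ltnW b'b).
pose g1 x := (2 ^+ t)^-1 * g x.
have p2' : 0 < 2 ^+ t :> R by rewrite exprn_gt0.
have bg1 : bdd 1 g1.
  rewrite (_ : 1 = `|(2 ^+ t)^-1| * 2 ^+ t); first exact: bddZ.
  by rewrite ger0_norm ?invr_ge0// mulVf// gt_eqF.
have gE : g = fun x => 2 ^+ t * g1 x.
  by apply/funext => x; rewrite mulrA mulfV ?mul1r// gt_eqF.
have jD : block_jumps (dual a g1 l n) b' <= e2 * L%:R.
  apply: block_jumps_dual => // j jL.
  have /h1[c1 c2 c3 c4] : (b' * L + j < b * L + i)%N by nia.
  by case: hn => ->.
have bD1 : bdd 1 (dual a g1 l n) by exact: bdd_dual.
apply: (@le_trans _ _ (block_jumps w b' + 2 ^+ t * block_jumps (dual a g1 l n) b')).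
  rewrite /block_jumps mulr_sumr -big_split; apply: ler_sum => j _ /=.
  set p := P _; set q := Q _.
  have bA := bm_avg_consB Zmp a p q (bdd_bm bD1) bl.
  have -> : 2 ^+ t * jump ((a, dual a g1 l n) :: l) p q = n2 (fun x => 2 ^+ t *
    (avg ((a, dual a g1 l n) :: l) p x - avg ((a, dual a g1 l n) :: l) q x)).
    by rewrite n2Z// ger0_norm.
  rewrite /avg_jump [X in n2 X <= _](_ : _ = fun x =>
    (avg ((a, w) :: l) p x - avg ((a, w) :: l) q x) + 2 ^+ t *
    (avg ((a, dual a g1 l n) :: l) p x - avg ((a, dual a g1 l n) :: l) q x)).
    exact: n2D (bm_avg_consB Zmp a p q (bdd_bm bw) bl) (bmZ _ bA).
  apply/funext => x; rewrite !avgD gE.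
  rewrite (_ : dual a (fun y => 2 ^+ t * g1 y) l n = fun y => 2 ^+ t * dual a g1 l n y).
    by rewrite !avgZ; ring.
  by apply/funext => y; rewrite dualZ.
rewrite exprS -!mulrA mulr_natl mulr2n lerD//; first by rewrite mulrA.
by rewrite ler_wpM2l.
Qed.

Lemma sum_block_jumps_le b w t : structured w t b ->
  \sum_(b' < b) block_jumps f b' <=
    2 * L%:R * (T%:R - t%:R) + b%:R * (L%:R * (2 * delta + 2 ^+ T * e2)).
Proof.
elim: b w t => [|b IHb] w t hw.
  rewrite big_ord0 mul0r addr0 mulr_ge0 ?mulr_ge0// subr_ge0 ler_nat.
  exact: structured_le hw.
rewrite big_ord_recr /= -[b.+1%:R]natr1 [(b%:R + 1) * _]mulrDl mul1r addrA.
have bl' : all_bdd1 ((a, f) :: l) by [].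
have [[i [n [iL hn hbad]]]|good] := pselect (exists i n, [/\ (i < L)%N,
  n = P (b * L + i)%N \/ n = Q (b * L + i)%N &
  delta < n2 (avg ((a, fun x => f x - w x) :: l) n)]).
  have [w' hw'] := structured_update hw iL hn hbad.
  have := IHb _ _ hw'.
  have : block_jumps f b <= 2 * L%:R.
    apply: (@le_trans _ _ (\sum_(i < L) 2)); last first.
      by rewrite sumr_const card_ord -[leLHS]mulr_natr.
    by apply: ler_sum => j _; exact: jump_le2.
  have : 0 <= L%:R * (2 * delta + 2 ^+ T * e2).
    by rewrite mulr_ge0// addr_ge0// mulr_ge0 ?exprn_ge0// ltW.
  by rewrite -[t.+1%:R]natr1; lra.
have hwb : structured w t b.
  by case: hw => h1 h2 h3; split=> // b' b'b; apply/h3/ltnW.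
apply: lerD (IHb _ _ hwb) _.
have [bw _ jw] := hw.
have bu := bddB bf bw.
have small i n : (i < L)%N -> n = P (b * L + i)%N \/ n = Q (b * L + i)%N ->
    n2 (avg ((a, fun x => f x - w x) :: l) n) <= delta.
  by move=> iL hn; rewrite leNgt; apply/negP => h; apply: good; exists i, n.
apply: (@le_trans _ _ (\sum_(i < L) (2 * delta) + block_jumps w b)).
  rewrite -big_split; apply: ler_sum => i _ /=.
  set p := P _; set q := Q _.
  rewrite /avg_jump [X in n2 X](_ : _ = fun x =>
    (avg ((a, fun x => f x - w x) :: l) p x - avg ((a, fun x => f x - w x) :: l) q x) +
    (avg ((a, w) :: l) p x - avg ((a, w) :: l) q x)); last first.
    by apply/funext => x; rewrite !avgB; ring.
  have bU := bm_avg_consB Zmp a p q (bdd_bm bu) bl.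
  have bW := bm_avg_consB Zmp a p q (bdd_bm bw) bl.
  apply: (le_trans (n2D mu bU bW)); rewrite lerD2r.
  have bA k := bm_avg_cons Zmp a k (bdd_bm bu) bl.
  apply: (le_trans (n2B mu (bA p) (bA q))).
  by rewrite mulr_natl mulr2n lerD// (small i)//; [left|right].
rewrite sumr_const card_ord -[X in X + _]mulr_natl mulrDr lerD2l.
apply: (le_trans (jw b (ltnSn b))).
rewrite mulrC ler_wpM2l// ler_wpM2r ?(ltW e20)//.
by rewrite ler_eXn2l ?ltr1n//; exact: structured_le hw.
Qed.

End InductiveStep.

Lemma sum_ord_blocks (F : nat -> R) b L :
  \sum_(i < b * L) F i = \sum_(b' < b) \sum_(i < L) F (b' * L + i)%N.
Proof.
elim: b => [|b IHb]; first by rewrite !big_ord0.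
by rewrite mulSnr big_split_ord big_ord_recr /= IHb.
Qed.

Lemma small_jumps_cons a sl : small_jumps sl -> small_jumps (a :: sl).
Proof.
move=> IH e e0.
pose delta := e / 8.
have delta0 : 0 < delta by rewrite divr_gt0.
have delta20 : 0 < delta ^+ 2 by rewrite exprn_gt0.
pose T := Num.bound (delta ^- 2).
have hT : 1 <= T%:R * delta ^+ 2.
  rewrite -ler_pdivrMr// div1r ltW//; apply: le_lt_trans (archi_boundP _).
    exact: lexx.
  by rewrite invr_ge0 ltW.
have p20 : 0 < 2 ^+ T :> R by rewrite exprn_gt0.
pose e2 := e / 8 / 2 ^+ T.
have e20 : 0 < e2 by rewrite divr_gt0.
have e10 : 0 < e2 / 2 by rewrite divr_gt0.
have [L [C1 [L0 hL]]] := IH _ e10.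
pose C := maxn C1 (Num.bound (8 / e2)).+1.
have C0 : (0 < C)%N by rewrite leq_max orbT.
have hC : e2 / 2 + 4 / C%:R <= e2.
  have : 4 / C%:R <= e2 / 2.
    rewrite ler_pdivrMr ?ltr0n// mulrAC ler_pdivlMr//.
    have : 8 / e2 < C%:R.
      apply: (lt_le_trans (archi_boundP _)); first by rewrite divr_ge0// ltW.
      by rewrite ler_nat leq_max leqnSn orbT.
    by rewrite ltr_pdivrMr//; lra.
  by lra.
pose B := (Num.bound (4 * T%:R / e)).+1.
have hB : 4 * T%:R / e < B%:R.
  apply: (lt_le_trans (archi_boundP _)); first by rewrite divr_ge0 ?mulr_ge0// ltW.
  by rewrite ler_nat leqnSn.
exists (B * L)%N, C; split; first by rewrite muln_gt0 L0.
move=> P Q sepPQ [//|[a' f] l] /= [-> hsl] [bf bl].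
have hL' P' Q' : separated C P' Q' -> forall l', map fst l' = sl -> all_bdd1 l' ->
    \sum_(i < L) jump l' (P' i) (Q' i) <= e2 / 2 * L%:R.
  by move=> s; apply: hL; apply: separatedW s; exact: leq_maxl.
have st0 : structured a e2 delta L P Q f l (fun=> 0) 0 B.
  split.
  - rewrite expr0 subrr -[X in bdd X](@normr0 R R); exact: bdd_cst.
  - rewrite mul0r subr0 -[leRHS](expr1n _ 2) ler_pXn2r ?nnegrE ?n2_ge0//.
    rewrite [X in n2 X](_ : _ = f); last by apply/funext => x; rewrite subr0.
    by case: bf => mf f1; apply: n2_le => //; exists 1.
  move=> b' _; rewrite /block_jumps big1 ?mulr_ge0 ?exprn_ge0// ?ltW// => i _.
  have a0 n x : avg ((a, fun=> 0) :: l) n x = 0.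
    rewrite /multiple_avg big1 ?mulr0// => h _; by rewrite big_cons mul0r.
  apply/eqP; rewrite eq_le n2_ge0 andbT; apply: n2_le => // [|x].
    by apply: bm_avg_consB => //; exact: bm_cst.
  by rewrite !a0 subrr normr0.
rewrite (sum_ord_blocks (fun i => jump ((a, f) :: l) (P i) (Q i))).
have := sum_block_jumps_le sepPQ bf bl hsl hL' C0 hC delta0 hT e20 st0.
rewrite /block_jumps subr0 => h; apply: (le_trans h).
rewrite natrM /e2 (_ : 2 ^+ T * (e / 8 / 2 ^+ T) = e / 8); last first.
  by rewrite mulrC divfK// gt_eqF.
move: hB; rewrite ltr_pdivrMr// /delta => hB.
have : L%:R * (4 * T%:R) <= L%:R * (B%:R * e) by rewrite ler_wpM2l// ltW.
have : 0 <= L%:R * (B%:R * e) by rewrite !mulr_ge0// ltW.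
by lra.
Qed.

Lemma small_jumps_all sl : small_jumps sl.
Proof.
elim: sl => [|a sl]; [exact: small_jumps_nil|exact: small_jumps_cons].
Qed.

Theorem avg_cauchy l : all_bdd1 l -> forall e : R, 0 < e ->
  exists N0, forall p q, (N0 <= p)%N -> (N0 <= q)%N -> jump l p q <= e.
Proof.
move=> bl e e0; apply: contrapT => hN.
have e4 : 0 < e / 4 by rewrite divr_gt0.
have [L [C [L0 hL]]] := small_jumps_all (map fst l) e4.
have next N : exists p, (C.+1 * N.+1 <= p)%N /\ e / 2 < jump l N p.
  apply: contrapT => h; apply: hN; exists (C.+1 * N.+1)%N => p q hp hq.
  have small r : (C.+1 * N.+1 <= r)%N -> jump l N r <= e / 2.
    by move=> hr; rewrite leNgt; apply/negP => h'; apply: h; exists r.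
  have := small p hp; have := small q hq.
  rewrite /avg_jump => h1 h2.
  rewrite [X in n2 X](_ : _ = fun x => (avg l N x - avg l q x) - (avg l N x - avg l p x)).
    rewrite (le_trans (n2B _ _ _))//; [exact: bm_avgB|exact: bm_avgB|].
    by lra.
  by apply/funext => x; ring.
have [nx hnx] := choice next.
pose P i := iter i (fun p => nx (nx p)) 1%N.
pose Q i := nx (P i).
have PS i : P i.+1 = nx (Q i) by [].
have stepQ i : (C.+1 * (P i).+1 <= Q i)%N by have [] := hnx (P i).
have stepP i : (C.+1 * (Q i).+1 <= P i.+1)%N by rewrite PS; have [] := hnx (Q i).
have sep : separated C P Q.
  have P0 i : (0 < P i)%N.
    by case: i => // i; apply: leq_trans (stepP i); rewrite muln_gt0.
  split=> [i|i j]; first by split=> //; apply: leq_trans (stepQ i); rewrite muln_gt0.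
  have monP i' k : (P i' <= P (k + i'))%N.
    elim: k => // k IHk; apply: (leq_trans IHk); rewrite addSn.
    by have := stepP (k + i')%N; have := stepQ (k + i')%N; nia.
  move=> ij; have := monP i.+1 (j - i.+1)%N; rewrite subnK// => hPj.
  have := stepP i; have := stepQ i; have := stepQ j.
  by split; nia.
have := hL P Q sep l erefl bl.
have : e / 2 * L%:R <= \sum_(i < L) jump l (P i) (Q i).
  apply: (@le_trans _ _ (\sum_(i < L) (e / 2))).
    by rewrite sumr_const card_ord -[leRHS]mulr_natr.
  by apply: ler_sum => i _; rewrite ltW//; have [] := hnx (P i).
have : 0 < L%:R :> R by rewrite ltr0n.
by nra.
Qed.

End NormConvergence.

(** * Weighted sums: van der Corput and Fourier bounds *)

Section FourierBound.
Context (R : realType).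
Local Notation C := R[i].

Lemma complex_prim_root_exists n : (0 < n)%N -> exists z : C, n.-primitive_root z.
Proof.
move=> n0; have [r Dp] := closed_field_poly_normal ('X^n - 1 : {poly C}).
move: Dp; rewrite (monicP _) ?monicXnsubC// scale1r => Dp.
have sz : size r = n by apply/succn_inj; rewrite -(size_prod_XsubC r id) -Dp size_XnsubC.
have rn1 : all n.-unity_root r by apply/allP => z; rewrite -root_prod_XsubC -Dp.
have n_neq0 : n%:R != 0 :> C by rewrite pnatr_eq0 -lt0n.
have Ur : uniq r.
  by rewrite -separable_prod_XsubC -Dp; exact: separable_Xn_sub_1.
by have /hasP[z _ hz] := has_prim_root n0 rn1 Ur (eq_leq (esym sz)); exists z.
Qed.

Section Parseval.
Variables (N' : nat) (z : C).
Let N := N'.+1.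
Hypothesis pz : N.-primitive_root z.

Let z0 : z != 0. Proof. by rewrite (prim_root_eq0 pz). Qed.

Lemma norm_prim_root k : `|z ^+ k| = 1.
Proof.
suff -> : `|z ^+ k| = `|z| ^+ k by rewrite (_ : `|z| = 1) ?expr1n//; apply/eqP;
  rewrite -(@pexpr_eq1 _ _ N)// -normrX (prim_expr_order pz) normr1.
by rewrite normrX.
Qed.

Lemma conj_prim_root k : (z ^+ k)^* = z ^- k.
Proof.
apply: (mulfI (expf_neq0 k z0)).
by rewrite -normCK norm_prim_root expr1n mulfV// expf_neq0.
Qed.

Lemma sum_prim_root (i j : 'I_N) :
  \sum_(k < N) z ^+ (k * i) * z ^- (k * j) = (if i == j then N%:R else 0) :> C.
Proof.
have [w wE] : exists w, w = z ^+ i / z ^+ j by eexists.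
have -> : \sum_(k < N) z ^+ (k * i) * z ^- (k * j) = \sum_(k < N) w ^+ k.
  apply: eq_bigr => k _; rewrite wE expr_div_n -!exprM; congr (z ^+ _ / z ^+ _); exact: mulnC.
have [ij|ij] := eqVneq i j.
  rewrite (eq_bigr (fun=> 1)) => [|k _]; first by rewrite sumr_const card_ord.
  by rewrite wE ij mulfV ?expr1n// expf_neq0.
have w1 : w - 1 != 0.
  rewrite subr_eq0; apply: contra ij => /eqP w1.
  have : z ^+ i == z ^+ j by rewrite -[z ^+ i](divfK (expf_neq0 j z0)) -wE w1 mul1r.
  by rewrite (eq_prim_root_expr pz) !modn_small.
apply: (mulfI w1); rewrite mulr0 -subrX1 wE expr_div_n -!exprM.
by do 2 rewrite mulnC exprM (prim_expr_order pz) expr1n; rewrite divr1 subrr.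
Qed.

Definition dft (F : 'I_N -> C) (k : nat) := \sum_(j < N) F j * z ^- (k * j).

Lemma parseval (F : 'I_N -> C) :
  \sum_(k < N) `|dft F k| ^+ 2 = N%:R * \sum_(j < N) `|F j| ^+ 2.
Proof.
transitivity (\sum_(k < N) \sum_(i < N) \sum_(j < N)
    F j * (F i)^* * (z ^+ (k * i) * z ^- (k * j))).
  apply: eq_bigr => k _; rewrite normCK /dft rmorph_sum mulr_sumr.
  apply: eq_bigr => i _; rewrite mulr_suml; apply: eq_bigr => j _.
  by rewrite rmorphM /= -(conj_prim_root (k * i)) conjCK; ring.
rewrite exchange_big mulr_sumr; apply: eq_bigr => i _ /=.
rewrite exchange_big (bigD1 i)//= [X in _ + X]big1 ?addr0 => [|j ji].
  by rewrite -mulr_sumr sum_prim_root eqxx normCK mulrC.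
by rewrite -mulr_sumr sum_prim_root eq_sym (negbTE ji) mulr0.
Qed.

Lemma dft_shift (F : 'I_N -> C) (m : 'I_N) (k : nat) :
  dft (fun j => F (m + j)) k = z ^+ (k * m) * dft F k.
Proof.
rewrite /dft mulr_sumr [RHS](reindex (fun j => m + j)); last first.
  by exists (fun j => - m + j) => j _; rewrite addrA ?addNr ?subrr add0r.
apply: eq_bigr => j _; rewrite mulrCA; congr (_ * _).
have -> : z ^+ (k * (m + j)%R) = z ^+ (k * m) * z ^+ (k * j).
  rewrite -exprD -mulnDr; apply/eqP; rewrite (eq_prim_root_expr pz) /=.
  by rewrite modnMmr.
by rewrite invfM mulrA mulfV ?mul1r// expf_neq0.
Qed.

End Parseval.

Definition test_weight (z : C) (b : bool) (k n : nat) : R :=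
  if b then complex.Re (z ^+ (k * n)) else complex.Im (z ^+ (k * n)).

Lemma test_weight_le1 Q z b k n : Q.+1.-primitive_root z ->
  `|test_weight z b k n| <= 1.
Proof.
move=> pz; have := add_Re2_Im2 (z ^+ (k * n)).
rewrite (norm_prim_root pz) expr1n => /(congr1 (@complex.Re R)) /=.
rewrite /test_weight -(ler_pXn2r (n:=2))// ?nnegrE// expr1n real_normK ?num_real//.
case: b => <-; first by rewrite lerDl sqr_ge0.
by rewrite lerDr sqr_ge0.
Qed.

Lemma Re_sum I (r : seq I) (F : I -> C) :
  complex.Re (\sum_(i <- r) F i) = \sum_(i <- r) complex.Re (F i).
Proof. by apply: (big_morph (@complex.Re R)) => [[a b] [c e]|]. Qed.

Lemma Im_sum I (r : seq I) (F : I -> C) :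
  complex.Im (\sum_(i <- r) F i) = \sum_(i <- r) complex.Im (F i).
Proof. by apply: (big_morph (@complex.Im R)) => [[a b] [c e]|]. Qed.

Lemma convolution_bound N Q z (c y : nat -> R) t :
  Q.+1.-primitive_root z -> (2 * N <= Q.+1)%N ->
  (forall b (k : 'I_Q.+1), `|\sum_(n < N) c n * test_weight z b k n| <= t) ->
  \sum_(l < N) (\sum_(n < N) c n * y (n + l)%N) ^+ 2 <=
    2 * t ^+ 2 * \sum_(j < Q.+1) y j ^+ 2.
Proof.
move=> pz NQ ct.
have t0 : 0 <= t := le_trans (normr_ge0 _) (ct true ord0).
pose chat k : C := \sum_(n < N) (c n)%:C%C * z ^+ (k * n).
have chatE k : `|chat k| ^+ 2 = ((\sum_(n < N) c n * test_weight z true k n) ^+ 2 +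
    (\sum_(n < N) c n * test_weight z false k n) ^+ 2)%:C%C.
  rewrite -add_Re2_Im2 /chat Re_sum Im_sum; congr (_ ^+ 2 + _ ^+ 2)%:C%C.
    apply: eq_bigr => n _; rewrite /test_weight; case: (z ^+ _) => u v /=.
    by rewrite mul0r subr0.
  apply: eq_bigr => n _; rewrite /test_weight; case: (z ^+ _) => u v /=.
  by rewrite mul0r addr0.
have chat_le (k : 'I_Q.+1) : `|chat k| ^+ 2 <= (2 * t ^+ 2)%:C%C.
  rewrite chatE lecR mulr_natl mulr2n lerD//.
    by rewrite -[leLHS]real_normK ?num_real// ler_pXn2r// nnegrE.
  by rewrite -[leLHS]real_normK ?num_real// ler_pXn2r// nnegrE.
pose Y (j : 'I_Q.+1) : C := (y j)%:C%C.
pose F (l : 'I_Q.+1) : R := \sum_(n < N) c n * y ((inord n : 'I_Q.+1) + l)%R.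
have dftF k : dft z (fun l => (F l)%:C%C) k = chat k * dft z Y k.
  rewrite /dft /chat mulr_suml.
  transitivity (\sum_(n < N) (c n)%:C%C * dft z (fun j => Y ((inord n : 'I_Q.+1) + j)) k).
    rewrite /dft (eq_bigr (fun j : 'I_Q.+1 => \sum_(n < N)
        (c n)%:C%C * (Y ((inord n : 'I_Q.+1) + j) * z ^- (k * j)))).
      by rewrite exchange_big; apply: eq_bigr => n _; rewrite mulr_sumr.
    move=> j _; rewrite /F rmorph_sum mulr_suml; apply: eq_bigr => n _ /=.
    by rewrite rmorphM /= mulrA.
  apply: eq_bigr => n _; rewrite dft_shift// inordK ?mulrA//.
  by have := ltn_ord n; lia.
have key : \sum_(l < Q.+1) F l ^+ 2 <= 2 * t ^+ 2 * \sum_(j < Q.+1) y j ^+ 2.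
  rewrite -lecR -(ler_pM2l (_ : 0 < Q.+1%:R :> C)) ?ltr0n//.
  have sqE (x : R) : (x ^+ 2)%:C%C = `|x%:C%C| ^+ 2 :> C.
    by rewrite -add_Re2_Im2 /= expr0n addr0.
  rewrite rmorphM !rmorph_sum /=.
  under eq_bigr do rewrite sqE.
  under [in leRHS]eq_bigr do rewrite sqE.
  rewrite -(parseval pz) [leRHS]mulrCA -(parseval pz) mulr_sumr.
  by apply: ler_sum => k _; rewrite dftF normrM exprMn ler_wpM2r// exprn_ge0.
apply: le_trans key.
have NQ' : (N <= Q.+1)%N by lia.
rewrite (big_ord_widen _ (fun l => (\sum_(n < N) c n * y (n + l)%N) ^+ 2) NQ').
rewrite [leRHS](bigID (fun i : 'I_Q.+1 => (i < N)%N))/=.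
rewrite -[leLHS]addr0 lerD//; last by apply: sumr_ge0 => i _; exact: sqr_ge0.
apply: ler_sum => l lN; rewrite /F le_eqVlt; apply/orP; left; apply/eqP.
congr (_ ^+ 2); apply: eq_bigr => n _; congr (_ * y _).
by rewrite /= inordK ?modn_small//; have := ltn_ord n; lia.
Qed.

End FourierBound.

Section RandomWeights.
Context d (X : measurableType d) (R : realType) (mu : probability X R).
Context (Z : int -> X -> X).
Hypothesis Zmp : forall a, measure_preserving mu (Z a).
Hypothesis ZD : forall a b x, Z (a + b) x = Z a (Z b x).
Implicit Types (f g u w : X -> R) (l : seq (int * (X -> R))) (a : int).
Implicit Types (sl : seq int) (c : nat -> R).

Local Notation n2 := (n2 mu).

Let mZ a : measurable_fun setT (Z a). Proof. by have [] := Zmp a. Qed.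

Definition weighted_sum c l N x : R :=
  \sum_(n < N) c n * \prod_(q <- l) q.2 (Z (q.1 * n%:Z) x).

Lemma bdd_weighted_sum c l N : all_bdd1 l ->
  bdd (\sum_(n < N) `|c n|) (weighted_sum c l N).
Proof.
move=> bl; apply: (@bdd_sum _ _ _ _ _ (fun n : 'I_N => `|c n|)
  (fun (n : 'I_N) x => c n * \prod_(q <- l) q.2 (Z (q.1 * n%:Z) x))) => n.
rewrite -[X in bdd X]mulr1; apply: bddZ; exact: (bdd_prod Zmp (fun a => a * n%:Z)).
Qed.

Lemma bm_weighted_sum c l N : all_bdd1 l -> bm (weighted_sum c l N).
Proof. by move=> bl; exact: bdd_bm (bdd_weighted_sum c N bl). Qed.

Definition multi_norm sl N c : R :=
  sup [set r | exists l, [/\ map fst l = sl, all_bdd1 l & r = n2 (weighted_sum c l N)]].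

Lemma le_multi_norm c l N : all_bdd1 l ->
  n2 (weighted_sum c l N) <= multi_norm (map fst l) N c.
Proof.
move=> bl; apply: ub_le_sup; last by exists l.
exists (\sum_(n < N) `|c n|) => _ [l' [_ bl' ->]].
apply: n2_le; first exact: bm_weighted_sum.
  by apply: sumr_ge0.
by case: (bdd_weighted_sum c N bl').
Qed.

Lemma multi_norm_le sl N c b :
  (forall l, map fst l = sl -> all_bdd1 l -> n2 (weighted_sum c l N) <= b) ->
  multi_norm sl N c <= b.
Proof.
move=> h; apply: ge_sup => [|_ [l [hl bl ->]]]; last exact: h.
pose l := [seq (a, fun=> 0 : R) | a <- sl] : seq (int * (X -> R)).
exists (n2 (weighted_sum c l N)), l; split=> //.
  by rewrite -map_comp map_id_in.
rewrite /l; elim: sl {h l} => //= a sl IH; split=> //.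
by apply: (bdd_le ler01); rewrite -[X in bdd X](@normr0 R R); exact: bdd_cst.
Qed.

Lemma multi_norm_ge0 sl N c : 0 <= multi_norm sl N c.
Proof.
pose l := [seq (a, fun=> 0 : R) | a <- sl] : seq (int * (X -> R)).
have <- : map fst l = sl by rewrite -map_comp map_id_in.
apply: le_trans (le_multi_norm _ _ _); first exact: n2_ge0.
rewrite /l; elim: sl {l} => //= a sl IH; split=> //.
by apply: (bdd_le ler01); rewrite -[X in bdd X](@normr0 R R); exact: bdd_cst.
Qed.

Lemma multi_norm_le_size sl N c : (forall n, `|c n| <= 1) -> multi_norm sl N c <= N%:R.
Proof.
move=> c1; apply: multi_norm_le => l _ bl; apply: n2_le => //; first exact: bm_weighted_sum.
move=> x; case: (bdd_weighted_sum c N bl) => _ /(_ x) /le_trans; apply.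
by rewrite -[leRHS](_ : \sum_(n < N) 1 = _) ?ler_sum// sumr_const card_ord.
Qed.

Lemma multi_norm1_le a N Q z c t : (0 < N)%N ->
  Q.+1.-primitive_root z -> Q.+1 = (2 * N)%N ->
  (forall b (k : 'I_Q.+1), `|\sum_(n < N) c n * test_weight z b k n| <= t) ->
  multi_norm [:: a] N c <= 2 * t.
Proof.
move=> N0 pz QN ct.
have t0 : 0 <= t := le_trans (normr_ge0 _) (ct true ord0).
apply: multi_norm_le => -[//|[a' f] [|//]] /= [->] [bf _].
have bf2 : bm f := bdd_bm bf.
have bw := @bm_weighted_sum c [:: (a, f)] N (conj bf I).
set w := weighted_sum _ _ _ in bw *.
have key : N%:R * n2 w ^+ 2 <= 2 * t ^+ 2 * (2 * N)%:R.
  have -> : N%:R * n2 w ^+ 2 = Int mu (fun x => \sum_(l < N) w (Z (a * l%:Z) x) ^+ 2).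
    rewrite Int_sum; last by move=> l; apply: bmX2; exact: bm_comp.
    rewrite (eq_bigr (fun=> n2 w ^+ 2)) ?sumr_const ?card_ord ?mulr_natl// => l _.
    by rewrite -sqr_n2 (n2_comp (Zmp _) bw).
  rewrite -[leRHS](Int_cst mu); apply: le_Int; [|exact: bm_cst|].
    by apply: bm_sum => l; apply: bmX2; exact: bm_comp.
  move=> x; pose y (n : nat) := f (Z (a * n%:Z) x).
  rewrite (eq_bigr (fun l : 'I_N => (\sum_(n < N) c n * y (n + l)%N) ^+ 2)); last first.
    move=> l _; congr (_ ^+ 2); rewrite /w /weighted_sum; apply: eq_bigr => n _.
    by rewrite big_seq1 /y -ZD /=; congr (_ * f (Z _ x)); rewrite PoszD; ring.
  apply: (le_trans (convolution_bound y pz _ ct)); first by rewrite QN.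
  rewrite ler_wpM2l ?mulr_ge0 ?sqr_ge0// -QN.
  apply: (@le_trans _ _ (\sum_(n < Q.+1) 1)); last by rewrite sumr_const card_ord.
  apply: ler_sum => n _; rewrite -[leLHS]real_normK ?num_real// exprn_ile1//.
  by case: bf => _; apply.
rewrite -(ler_pXn2r (n:=2))// ?nnegrE ?n2_ge0 ?mulr_ge0//.
rewrite -(ler_pM2l (_ : 0 < N%:R)) ?ltr0n// (le_trans key)// natrM exprMn.
by rewrite le_eqVlt; apply/orP; left; apply/eqP; ring.
Qed.

Lemma sqr_sum_diagonals (F : nat -> R) N : (\sum_(n < N) F n) ^+ 2 =
  \sum_(n < N) F n ^+ 2 + 2 * \sum_(h < N) \sum_(n < N - h.+1) F n * F (n + h.+1)%N.
Proof.
elim: N => [|N IHN]; first by rewrite !big_ord0 expr0n mulr0 addr0.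
rewrite big_ord_recr /= sqrrD IHN [in RHS]big_ord_recr /=.
rewrite [X in _ = _ + 2 * X]big_ord_recr /= subnn big_ord0 addr0.
have -> : \sum_(h < N) \sum_(n < N.+1 - h.+1) F n * F (n + h.+1)%N =
    \sum_(h < N) \sum_(n < N - h.+1) F n * F (n + h.+1)%N + (\sum_(n < N) F n) * F N.
  rewrite mulr_suml [X in _ = _ + X](reindex_inj rev_ord_inj) -big_split /=.
  apply: eq_bigr => h _; have hN := ltn_ord h.
  rewrite (_ : N.+1 - h.+1 = (N - h.+1).+1)%N; last by lia.
  by rewrite big_ord_recr /= subnK.
by ring.
Qed.

(* Van der Corput: one function is removed, and the weights are replaced by
   their multiplicative differences. *)
Lemma multi_norm_step a sl N c : (forall n, `|c n| <= 1) ->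
  multi_norm (a :: sl) N c ^+ 2 <= N%:R + 2 * \sum_(h < N)
    multi_norm [seq b - a | b <- sl] (N - h.+1) (fun n => c n * c (n + h.+1)%N).
Proof.
move=> c1.
set S := (X in _ <= X).
have S0 : 0 <= S.
  by rewrite addr_ge0// mulr_ge0// sumr_ge0// => h _; exact: multi_norm_ge0.
suff h : multi_norm (a :: sl) N c <= Num.sqrt S.
  by rewrite -(sqr_sqrtr S0) ler_pXn2r// nnegrE ?sqrtr_ge0// multi_norm_ge0.
apply: multi_norm_le => -[//|[a' f] l] /= [-> hsl] [bf bl].
rewrite -(ler_pXn2r (n:=2))// ?nnegrE ?n2_ge0 ?sqrtr_ge0// sqr_n2 sqr_sqrtr//.
pose F n x := c n * (f (Z (a * n%:Z) x) * \prod_(q <- l) q.2 (Z (q.1 * n%:Z) x)).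
have bF n : bdd 1 (F n).
  apply: (@bdd_le _ _ _ (`|c n| * (1 * 1))); first by rewrite !mulr1.
  apply/bddZ/bddM; first exact: bdd_comp.
  exact: (bdd_prod Zmp (fun a => a * n%:Z)).
have bmF n : bm (F n) := bdd_bm (bF n).
have bmFF n m : bm (fun x => F n x * F m x) by exact: bmM.
rewrite (_ : (fun x => _) = fun x => \sum_(n < N) F n x ^+ 2 +
    2 * \sum_(h < N) \sum_(n < N - h.+1) F n x * F (n + h.+1)%N x); last first.
  apply/funext => x; rewrite -(sqr_sum_diagonals (fun n => F n x)); congr (_ ^+ 2).
  by apply: eq_bigr => n _; rewrite big_cons.
have bmS h : bm (fun x => \sum_(n < N - h.+1) F n x * F (n + h.+1)%N x).
  exact: bm_sum.
rewrite IntD; [|by apply: bm_sum => n; exact: bmX2|by apply: bmZ; exact: bm_sum].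
rewrite IntZ; last exact: bm_sum.
rewrite lerD//.
  rewrite -[leRHS](Int_cst mu); apply: le_Int; [|exact: bm_cst|].
    by apply: bm_sum => n; exact: bmX2.
  move=> x; apply: (@le_trans _ _ (\sum_(n < N) 1)); last by rewrite sumr_const card_ord.
  apply: ler_sum => n _; rewrite -[leLHS]real_normK ?num_real// exprn_ile1//.
  by case: (bF n) => _; apply.
rewrite ler_wpM2l// Int_sum//; apply: ler_sum => h _.
pose l' := [seq (q.1 - a, fun x => q.2 x * q.2 (Z (q.1 * h.+1%:Z) x)) | q <- l]
  : seq (int * (X -> R)).
have bl' : all_bdd1 l'.
  rewrite /l'; elim: (l) bl => //= q r IHr [bq /IHr]; split=> //.
  by rewrite -[X in bdd X]mulr1; apply: bddM => //; exact: bdd_comp.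
pose G x := f x * f (Z (a * h.+1%:Z) x).
have bG : bdd 1 G by rewrite -[X in bdd X]mulr1; apply: bddM => //; exact: bdd_comp.
pose c' n := c n * c (n + h.+1)%N.
have -> : [seq b - a | b <- sl] = map fst l'.
  by rewrite -hsl -!map_comp; exact: eq_map.
have -> : Int mu (fun x => \sum_(n < N - h.+1) F n x * F (n + h.+1)%N x) =
    Int mu (fun x => G x * weighted_sum c' l' (N - h.+1) x).
  have bmt n : bm (fun x => G x * (c' n * \prod_(q <- l') q.2 (Z (q.1 * n%:Z) x))).
    apply: bmM; first exact: bdd_bm bG.
    apply: bmZ; exact: bdd_bm (bdd_prod Zmp (fun a => a * n%:Z) bl').
  rewrite Int_sum//.
  transitivity (\sum_(n < N - h.+1) Int mu (fun x => G x *
      (c' n * \prod_(q <- l') q.2 (Z (q.1 * n%:Z) x)))); last first.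
    by rewrite -Int_sum//; congr Int; apply/funext => x; rewrite -mulr_sumr.
  apply: eq_bigr => n _; rewrite -(Int_comp (Zmp (a * n%:Z)) (bmt n)).
  congr Int; apply/funext => x; rewrite /F /G /c'.
  rewrite /l' big_map /= big_split /=.
  have -> : \prod_(q <- l) q.2 (Z ((q.1 - a) * n%:Z) (Z (a * n%:Z) x)) =
      \prod_(q <- l) q.2 (Z (q.1 * n%:Z) x).
    by apply: eq_bigr => q _; rewrite -ZD; congr (q.2 (Z _ x)); ring.
  have -> : \prod_(q <- l) q.2 (Z (q.1 * h.+1%:Z) (Z ((q.1 - a) * n%:Z) (Z (a * n%:Z) x))) =
      \prod_(q <- l) q.2 (Z (q.1 * (n + h.+1)%N%:Z) x).
    by apply: eq_bigr => q _; rewrite -!ZD PoszD; congr (q.2 (Z _ x)); ring.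
  have -> : f (Z (a * h.+1%:Z) (Z (a * n%:Z) x)) = f (Z (a * (n + h.+1)%N%:Z) x).
    by rewrite -ZD PoszD; congr (f (Z _ x)); ring.
  by ring.
have bmw := bm_weighted_sum c' (N - h.+1) bl'.
apply: (le_trans (Int_mul_le mu (bdd_bm bG) bmw)).
apply: (@le_trans _ _ (1 * n2 (weighted_sum c' l' (N - h.+1)))).
  rewrite ler_wpM2r ?n2_ge0//; apply: n2_le => //; first exact: bdd_bm bG.
  by case: bG.
by rewrite mul1r le_multi_norm.
Qed.

End RandomWeights.

(** * Exponential moments of products of independent coins *)

Section CoinTossing.
Context (R : realType) (q : nat -> R).
Hypothesis q01 : forall n, 0 <= q n <= 1.
Implicit Types (F G : (nat -> bool) -> R) (e : nat -> bool).

Let q0 n : 0 <= q n. Proof. by case/andP: (q01 n). Qed.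
Let q1 n : q n <= 1. Proof. by case/andP: (q01 n). Qed.

Definition upd e k b n := if n == k then b else e n.

Definition cond_Ex k F e : R := q k * F (upd e k true) + (1 - q k) * F (upd e k false).

(* Expectation of [F e] for independent coins [e i] with success probabilities
   [q i], [i < K]; the coins from [K] on are set to [false]. *)
Fixpoint Ex (K : nat) F : R :=
  if K is K'.+1 then Ex K' (cond_Ex K' F) else F (fun=> false).

Lemma le_cond_Ex k F G e : (forall e, F e <= G e) -> cond_Ex k F e <= cond_Ex k G e.
Proof. by move=> FG; rewrite lerD// ler_wpM2l// subr_ge0. Qed.

Lemma le_Ex K F G : (forall e, F e <= G e) -> Ex K F <= Ex K G.
Proof.
elim: K F G => [|K IHK] F G FG; first exact: FG.
by apply: IHK => e; exact: le_cond_Ex.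
Qed.

Lemma eq_Ex K F G : (forall e, F e = G e) -> Ex K F = Ex K G.
Proof. by move=> FG; congr Ex; apply/funext. Qed.

Lemma ExD K F G : Ex K (fun e => F e + G e) = Ex K F + Ex K G.
Proof.
elim: K F G => [|K IHK] F G //=; rewrite -IHK; apply: eq_Ex => e.
by rewrite /cond_Ex; ring.
Qed.

Lemma ExZ K c F : Ex K (fun e => c * F e) = c * Ex K F.
Proof.
elim: K F => [|K IHK] F //=; rewrite -IHK; apply: eq_Ex => e.
by rewrite /cond_Ex; ring.
Qed.

Lemma Ex_cst K c : Ex K (fun=> c) = c.
Proof.
elim: K => [|K IHK] //=; rewrite -[RHS]IHK; apply: eq_Ex => e.
by rewrite /cond_Ex; ring.
Qed.

Lemma Ex_sum K I (r : seq I) (F : I -> (nat -> bool) -> R) :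
  Ex K (fun e => \sum_(i <- r) F i e) = \sum_(i <- r) Ex K (F i).
Proof.
elim: r => [|i r IHr].
  by rewrite big_nil -[RHS](Ex_cst K); apply: eq_Ex => e; rewrite big_nil.
by rewrite big_cons -IHr -ExD; apply: eq_Ex => e; rewrite big_cons.
Qed.

Definition depends_below K F :=
  forall e e', (forall i, (i < K)%N -> e i = e' i) -> F e = F e'.

Lemma Ex_depends K K' F : depends_below K F -> (K <= K')%N -> Ex K' F = Ex K F.
Proof.
move=> dF /subnK <-; elim: (K' - K)%N => // n IHn; rewrite -[RHS]IHn /=.
apply: eq_Ex => e; rewrite /cond_Ex.
have E b : F (upd e (n + K) b) = F e.
  apply: dF => i iK; rewrite /upd ifF//; apply/negbTE; rewrite neq_ltn.
  by rewrite (leq_trans iK) ?leq_addl.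
by rewrite !E; ring.
Qed.

Lemma Ex_supermartingale (H : nat) (Phi : nat -> (nat -> bool) -> R) :
  (forall n, depends_below (n + H).+1 (Phi n)) ->
  (forall n e, cond_Ex (n + H) (fun e => expR (Phi n e)) e <= 1) ->
  forall N K, (N + H <= K)%N -> Ex K (fun e => expR (\sum_(n < N) Phi n e)) <= 1.
Proof.
move=> dPhi hPhi N K NK.
have dS M : depends_below (M + H) (fun e => \sum_(n < M) Phi n e).
  move=> e e' ee'; apply: eq_bigr => n _; apply: dPhi => i iH.
  apply: ee'; apply: leq_trans iH _; have := ltn_ord n; lia.
rewrite (@Ex_depends (N + H))//; last by move=> e e' /dS ->.
elim: N {NK} => [|N IHN].
  rewrite -[leRHS](Ex_cst (0 + H) 1); apply: le_Ex => e.
  by rewrite big_ord0 expR0.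
apply: le_trans IHN; rewrite addSn /=; apply: le_Ex => e.
have E b : \sum_(n < N) Phi n (upd e (N + H) b) = \sum_(n < N) Phi n e.
  apply: dS => i iN; rewrite /upd ifF//; apply/negbTE; rewrite neq_ltn.
  by rewrite iN.
rewrite /cond_Ex !big_ord_recr /= !expRD !E mulrCA [X in _ + X]mulrCA -mulrDr.
by rewrite -[leRHS]mulr1 ler_wpM2l ?expR_ge0//; exact: hPhi.
Qed.

Lemma expR_le_quadratic (u : R) : u <= 1 / 2 -> expR u <= 1 + u + 2 * u ^+ 2.
Proof.
move=> u2; have := expR_ge1Dx (- u); rewrite expRN => h.
have u1 : 0 < 1 - u by lra.
have e0 := expR_gt0 u.
have : expR u * (1 - u) <= 1.
  by rewrite -[leRHS](mulfV (lt0r_neq0 e0)) ler_pM2l.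
have : 1 <= (1 + u + 2 * u ^+ 2) * (1 - u).
  have : 0 <= u ^+ 2 by exact: sqr_ge0.
  by nra.
move=> h1 h2; rewrite -(ler_pM2r u1); exact: le_trans h2 h1.
Qed.

Definition coin n e : R := (e n)%:R - q n.

Lemma coin_le1 n e : `|coin n e| <= 1.
Proof.
rewrite /coin ler_norml; have := q0 n; have := q1 n.
by case: (e n) => /=; lra.
Qed.

Lemma coin_upd n e b : coin n (upd e n b) = b%:R - q n.
Proof. by rewrite /coin /upd eqxx. Qed.

Lemma cond_exp_coin_sq n e c : 0 <= c <= 1 / 2 ->
  cond_Ex n (fun e => expR (c * coin n e ^+ 2 - 2 * c * q n)) e <= 1.
Proof.
move=> /andP[c0 c1]; rewrite /cond_Ex !coin_upd /= sub0r sqrrN.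
have := q0 n; have := q1 n; move: (q n) => p p1 p0.
have le (x : R) : 0 <= x <= 1 -> expR (c * x - 2 * c * p) <=
    (1 + 2 * (c * x)) * expR (- (2 * c * p)).
  move=> /andP[x0 x1]; rewrite expRD ler_wpM2r ?expR_ge0//.
  have cx0 : 0 <= c * x by exact: mulr_ge0.
  have cx1 : c * x <= 1 / 2 by nra.
  by apply: (le_trans (expR_le_quadratic cx1)); nra.
have h1 := le ((1 - p) ^+ 2) _; have h2 := le (p ^+ 2) _.
apply: (@le_trans _ _ ((1 + 2 * c * p) * expR (- (2 * c * p)))); last first.
  rewrite expRN ler_pdivrMr ?expR_gt0// mul1r; exact: expR_ge1Dx.
have E0 := expR_ge0 (- (2 * c * p)).
apply: (@le_trans _ _ (p * ((1 + 2 * (c * (1 - p) ^+ 2)) * expR (- (2 * c * p))) +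
   (1 - p) * ((1 + 2 * (c * p ^+ 2)) * expR (- (2 * c * p))))).
  apply: lerD; rewrite ler_wpM2l ?subr_ge0//.
    by apply: h1; apply/andP; split; nra.
  by apply: h2; apply/andP; split; nra.
rewrite !mulrA -mulrDl ler_wpM2r//.
have : 0 <= c * p by exact: mulr_ge0.
by nra.
Qed.

Lemma cond_exp_coin n e c : `|c| <= 1 / 2 ->
  cond_Ex n (fun e => expR (c * coin n e - 2 * c ^+ 2 * q n)) e <= 1.
Proof.
rewrite ler_norml => /andP[c0 c1]; rewrite /cond_Ex !coin_upd /= sub0r.
have := q0 n; have := q1 n; move: (q n) => p p1 p0.
have le (x : R) : -1 <= x <= 1 -> expR (c * x - 2 * c ^+ 2 * p) <=
    (1 + c * x + 2 * (c * x) ^+ 2) * expR (- (2 * c ^+ 2 * p)).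
  move=> /andP[x0 x1]; rewrite expRD ler_wpM2r ?expR_ge0//.
  by apply: expR_le_quadratic; nra.
have h1 := le (1 - p) _; have h2 := le (- p) _.
apply: (@le_trans _ _ ((1 + 2 * c ^+ 2 * p) * expR (- (2 * c ^+ 2 * p)))); last first.
  rewrite expRN ler_pdivrMr ?expR_gt0// mul1r; exact: expR_ge1Dx.
have E0 := expR_ge0 (- (2 * c ^+ 2 * p)).
apply: (@le_trans _ _
  (p * ((1 + c * (1 - p) + 2 * (c * (1 - p)) ^+ 2) * expR (- (2 * c ^+ 2 * p))) +
   (1 - p) * ((1 + c * (- p) + 2 * (c * (- p)) ^+ 2) * expR (- (2 * c ^+ 2 * p))))).
  apply: lerD; rewrite ler_wpM2l ?subr_ge0//.
    by apply: h1; apply/andP; split; lra.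
  by apply: h2; apply/andP; split; lra.
rewrite !mulrA -mulrDl ler_wpM2r//.
have h : 0 <= c ^+ 2 * p ^+ 2 by rewrite mulr_ge0 ?sqr_ge0.
rewrite [leLHS](_ : _ = 1 + 2 * c ^+ 2 * p - 2 * (c ^+ 2 * p ^+ 2)); last by ring.
lra.
Qed.

Definition coin_prod (s : seq nat) n e : R := \prod_(i <- s) coin (n + i) e.
Definition prob_prod (s : seq nat) n : R := \prod_(i <- s) q (n + i).

Lemma prob_prod01 s n : 0 <= prob_prod s n <= 1.
Proof.
apply/andP; split; first by apply: prodr_ge0.
by apply: Num.Theory.prodr_ile1 => i _; rewrite q0 q1.
Qed.

Lemma coin_prod_le1 s n e : `|coin_prod s n e| <= 1.
Proof.
rewrite /coin_prod normr_prod; apply: Num.Theory.prodr_ile1 => i _.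
by rewrite normr_ge0 coin_le1.
Qed.

Lemma coin_prod_sq01 s n e : 0 <= coin_prod s n e ^+ 2 <= 1.
Proof. by rewrite sqr_ge0 -real_normK ?num_real// exprn_ile1 ?coin_prod_le1. Qed.

Lemma coin_prod_depends s n H : {in s, forall i, (i < H)%N} ->
  depends_below (n + H) (coin_prod s n).
Proof.
move=> sH e e' ee'; apply: eq_big_seq => i /sH iH.
by rewrite /coin ee'// ltn_add2l.
Qed.

Lemma coin_prod_rcons s h n e :
  coin_prod (rcons s h) n e = coin_prod s n e * coin (n + h) e.
Proof. by rewrite /coin_prod -cats1 big_cat big_seq1. Qed.

Definition square_sum (s1 s2 : seq nat) N e :=
  \sum_(n < N) coin_prod s1 n e ^+ 2 * prob_prod s2 n.

Lemma upd_coin_prod s n e b h : {in s, forall i, (i < h)%N} ->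
  coin_prod s n (upd e (n + h) b) = coin_prod s n e.
Proof.
move=> sh; apply: (@coin_prod_depends s n h) => // i ih.
by rewrite /upd ifF//; apply/negbTE; rewrite neq_ltn ih.
Qed.

(* AM-GM for [expR (F - G)] and [expR G]. *)
Lemma Ex_exp_le_half K (F G : (nat -> bool) -> R) a :
  0 <= a -> Ex K (fun e => expR (2 * F e - 2 * G e)) <= 1 ->
  Ex K (fun e => expR (2 * G e)) <= expR a -> Ex K (fun e => expR (F e)) <= expR a.
Proof.
move=> a0 h1 h2.
apply: (@le_trans _ _ (Ex K (fun e => 2^-1 *
    (expR (2 * F e - 2 * G e) + expR (2 * G e))))).
  apply: le_Ex => e.
  have -> : expR (2 * F e - 2 * G e) = expR (F e - G e) ^+ 2.
    by rewrite -expRM_natl mulrBr.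
  have -> : expR (2 * G e) = expR (G e) ^+ 2 by rewrite -expRM_natl.
  have -> : expR (F e) = expR (F e - G e) * expR (G e) by rewrite -expRD subrK.
  set x := expR (_ - _); set y := expR _; have := sqr_ge0 (x - y); rewrite sqrrB. lra.
rewrite ExZ ExD.
have : 1 <= expR a by rewrite -expR0 ler_expR.
lra.
Qed.

Lemma Ex_exp_square_sum s1 s2 N K c : pairwise ltn s1 ->
  {in s1, forall i, (N + i <= K)%N} -> 0 <= c -> c * 4 ^+ size s1 <= 1 ->
  Ex K (fun e => expR (c * square_sum s1 s2 N e)) <=
    expR (4 ^+ size s1 * c * \sum_(n < N) prob_prod (s1 ++ s2) n).
Proof.
elim/last_ind: s1 s2 c => [|s h IHs] s2 c.
  move=> _ _ _ _; rewrite -[leRHS](Ex_cst K); apply: le_Ex => e.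
  rewrite ler_expR expr0 mul1r /square_sum le_eqVlt; apply/orP; left; apply/eqP.
  by congr (_ * _); apply: eq_bigr => n _; rewrite /coin_prod big_nil expr1n mul1r.
rewrite pairwise_rcons size_rcons => /andP[/allP sh ps] sK c0 c1.
have s4 : 1 <= 4 ^+ size s :> R by rewrite exprn_ege1// ler1n.
have c4 : c <= 1 / 4 by move: c1; rewrite exprS; nra.
apply: (@Ex_exp_le_half _ _ (fun e => 2 * c * square_sum s (h :: s2) N e)).
- apply: mulr_ge0; first by apply: mulr_ge0; rewrite ?exprn_ge0.
  by apply: sumr_ge0 => n _; case/andP: (prob_prod01 (rcons s h ++ s2) n).
- pose y n e := 2 * c * (coin_prod s n e ^+ 2 * prob_prod s2 n).
  pose Phi n e := y n e * coin (n + h) e ^+ 2 - 2 * y n e * q (n + h).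
  rewrite (@eq_Ex _ _ (fun e => expR (\sum_(n < N) Phi n e))); last first.
    move=> e; congr expR; rewrite /square_sum !mulr_sumr -sumrB.
    apply: eq_bigr => n _; rewrite /Phi /y coin_prod_rcons /prob_prod big_cons.
    by ring.
  apply: (@Ex_supermartingale h) => [n|n e|]; last first.
  - by apply: sK; rewrite mem_rcons mem_head.
  - have yE b : y n (upd e (n + h) b) = y n e by rewrite /y upd_coin_prod.
    have := @cond_exp_coin_sq (n + h) e (y n e) _.
    rewrite /cond_Ex /Phi !yE; apply.
    have /andP[u0 u1] := coin_prod_sq01 s n e.
    have /andP[v0 v1] := prob_prod01 s2 n.
    rewrite /y; apply/andP; split; first by apply: mulr_ge0; exact: mulr_ge0.
    have : coin_prod s n e ^+ 2 * prob_prod s2 n <= 1 by rewrite mulr_ile1.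
    have : 0 <= coin_prod s n e ^+ 2 * prob_prod s2 n by exact: mulr_ge0.
    by nra.
  - move=> e e' ee'; rewrite /Phi /y.
    have -> : coin_prod s n e = coin_prod s n e'.
      by apply: (coin_prod_depends sh) => i ih; apply: ee'; exact: leqW.
    by rewrite /coin ee'.
rewrite (@eq_Ex _ _ (fun e => expR (4 * c * square_sum s (h :: s2) N e))); last first.
  by move=> e; congr expR; ring.
apply: (le_trans (IHs _ _ _ _ _ _)) => //.
- by move=> i si; apply: sK; rewrite mem_rcons in_cons si orbT.
- exact: mulr_ge0.
- by rewrite mulrAC -exprS mulrC.
rewrite ler_expR -cat_rcons le_eqVlt; apply/orP; left; apply/eqP.
by rewrite exprS; ring.
Qed.

Lemma Ex_exp_weighted_coins s N K (w : nat -> R) c : s != [::] -> pairwise ltn s ->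
  {in s, forall i, (N + i <= K)%N} -> (forall n, `|w n| <= 1) ->
  `|c| <= 1 / 4 -> 8 * c ^+ 2 * 4 ^+ size s <= 1 ->
  Ex K (fun e => expR (c * \sum_(n < N) w n * coin_prod s n e)) <=
    expR (4 ^+ size s * (8 * c ^+ 2) * \sum_(n < N) prob_prod s n).
Proof.
case/lastP: s => [//|s h] _; rewrite pairwise_rcons size_rcons.
move=> /andP[/allP sh ps] sK w1 c1 c2.
have c20 : 0 <= c ^+ 2 by exact: sqr_ge0.
apply: (@Ex_exp_le_half _ _ (fun e => 4 * c ^+ 2 * square_sum s [:: h] N e)).
- apply: mulr_ge0; first by rewrite mulr_ge0 ?exprn_ge0// mulr_ge0.
  by apply: sumr_ge0 => n _; case/andP: (prob_prod01 (rcons s h) n).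
- pose y n e := 2 * c * (w n * coin_prod s n e).
  pose y2 n e := 2 * c * coin_prod s n e.
  pose Phi n e := y n e * coin (n + h) e - 2 * y2 n e ^+ 2 * q (n + h).
  rewrite (@eq_Ex _ _ (fun e => expR (\sum_(n < N) Phi n e))); last first.
    move=> e; congr expR; rewrite /square_sum !mulr_sumr -sumrB.
    apply: eq_bigr => n _; rewrite /Phi /y /y2 coin_prod_rcons /prob_prod big_seq1.
    by ring.
  apply: (@Ex_supermartingale h) => [n|n e|]; last first.
  - by apply: sK; rewrite mem_rcons mem_head.
  - have yE b : y n (upd e (n + h) b) = y n e by rewrite /y upd_coin_prod.
    have y2E b : y2 n (upd e (n + h) b) = y2 n e by rewrite /y2 upd_coin_prod.
    have w_le1 : `|w n * coin_prod s n e| <= 1.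
      by rewrite normrM mulr_ile1// coin_prod_le1.
    apply: le_trans (@cond_exp_coin (n + h) e (y n e) _); last first.
      rewrite /y 2!normrM ger0_norm//; move: c1 w_le1.
      have := normr_ge0 c; have := normr_ge0 (w n * coin_prod s n e).
      move: `|c| `|_ * _| => a b; nra.
    rewrite /cond_Ex /Phi !yE !y2E.
    have hy : 2 * y n e ^+ 2 * q (n + h) <= 2 * y2 n e ^+ 2 * q (n + h).
      rewrite ler_wpM2r// ler_wpM2l// /y /y2 mulrA exprMn [leRHS]exprMn.
      rewrite ler_wpM2r ?sqr_ge0// exprMn ler_piMr ?sqr_ge0//.
      by rewrite -real_normK ?num_real// exprn_ile1.
    by rewrite lerD// ler_wpM2l ?subr_ge0// ler_expR lerB.
  - move=> e e' ee'; rewrite /Phi /y /y2.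
    have -> : coin_prod s n e = coin_prod s n e'.
      by apply: (coin_prod_depends sh) => i ih; apply: ee'; exact: leqW.
    by rewrite /coin ee'.
rewrite (@eq_Ex _ _ (fun e => expR (8 * c ^+ 2 * square_sum s [:: h] N e))); last first.
  by move=> e; congr expR; ring.
apply: (le_trans (Ex_exp_square_sum _ _ _ _ _)) => //.
- by move=> i si; apply: sK; rewrite mem_rcons in_cons si orbT.
- exact: mulr_ge0.
- have : 0 <= c ^+ 2 * 4 ^+ size s by apply: mulr_ge0 => //; exact: exprn_ge0.
  by move: c2; rewrite [4 ^+ _.+1]exprS; move: (4 ^+ size s) => a; lra.
rewrite ler_expR cats1 ler_wpM2r//.
  by apply: sumr_ge0 => n _; case/andP: (prob_prod01 (rcons s h) n).
apply: ler_wpM2r; first exact: mulr_ge0.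
by rewrite ler_eXn2l ?ltr1n.
Qed.

End CoinTossing.

(** * Mean size of random weighted sums *)

Section RandomNormBound.
Context d (X : measurableType d) (R : realType) (mu : probability X R).
Context (Z : int -> X -> X).
Hypothesis Zmp : forall a, measure_preserving mu (Z a).
Hypothesis ZD : forall a b x, Z (a + b) x = Z a (Z b x).
Context (q : nat -> R).
Hypothesis q01 : forall n, 0 <= q n <= 1.
Hypothesis q_mono : forall m n, (m <= n)%N -> q n <= q m.

Local Notation multi_norm := (multi_norm mu Z).
Local Notation Ex := (Ex q).
Local Notation coin_prod := (coin_prod q).

Lemma prob_prod_le s n : prob_prod q s n <= q n ^+ size s.
Proof.
rewrite -[leRHS](_ : \prod_(i <- s) q n = _); last first.
  by rewrite big_const_seq count_predT -Monoid.iteropE.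
apply: ler_prod => i _; rewrite q_mono ?leq_addr// andbT.
by case/andP: (q01 (n + i)).
Qed.

Lemma coin_prod_perm s s' n e : perm_eq s s' -> coin_prod s n e = coin_prod s' n e.
Proof. exact: perm_big. Qed.

Lemma multi_norm0 sl c : multi_norm sl 0 c <= 0.
Proof.
apply: multi_norm_le => // l _ bl; apply: n2_le => //; first exact: bm_weighted_sum.
by move=> x; rewrite /weighted_sum big_ord0 normr0.
Qed.

Lemma Ex_multi_norm1_le a s N N' K v : (0 < N)%N -> (N' <= N)%N ->
  uniq s -> s != [::] -> {in s, forall i, (N' + i <= K)%N} -> 1 <= v ->
  \sum_(n < N) q n ^+ size s <= v ->
  Ex K (fun e => multi_norm [:: a] N' (fun n => coin_prod s n e)) <=
    2 ^+ (size s + 3) * Num.sqrt v * (ln N%:R + 8 * expR 1).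
Proof.
move=> N0 N'N us s0 sK v1 hv.
have N1 : 1 <= N%:R :> R by rewrite ler1n.
have lnN : 0 <= ln N%:R :> R by exact: ln_ge0.
have sv1 : 1 <= Num.sqrt v by rewrite -[leLHS]sqrtr1 ler_wsqrtr.
have sv0 : 0 < Num.sqrt v by exact: lt_le_trans sv1.
case: N' => [|N''] in N'N sK *.
  apply: (@le_trans _ _ 0).
    by rewrite -[leRHS](Ex_cst q K); apply: le_Ex => // e; exact: multi_norm0.
  by rewrite !mulr_ge0 ?exprn_ge0 ?addr_ge0 ?mulr_ge0 ?expR_ge0// ltW.
set N' := N''.+1 in N'N sK *.
pose D := size s.
have p2 : 0 < 2 ^+ (D + 2) :> R by rewrite exprn_gt0.
have p24 : 4 <= 2 ^+ (D + 2) :> R.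
  by rewrite exprD (_ : 2 ^+ 2 = 4 :> R) ?ler_peMl ?exprn_ege1 ?ler1n//; ring.
pose lam := (2 ^+ (D + 2) * Num.sqrt v)^-1.
have lam0 : 0 < lam by rewrite invr_gt0 mulr_gt0.
have lam1 : lam <= 1 / 4.
  rewrite div1r lef_pV2 ?posrE ?mulr_gt0//.
  by rewrite -[leLHS]mulr1 ler_pM.
have lam2 : 8 * lam ^+ 2 * 4 ^+ D = (2 * v)^-1.
  rewrite /lam exprVn exprMn sqr_sqrtr; last by exact: le_trans v1.
  rewrite exprD exprMn -exprM mulnC exprM (_ : 2 ^+ 2 = 4 :> R); last by ring.
  have : v != 0 by rewrite gt_eqF// (lt_le_trans _ v1).
  have : 4 ^+ D != 0 :> R by rewrite expf_neq0.
  by move=> h1 h2; field; rewrite h1 h2.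
have v0 : 0 < v by exact: lt_le_trans v1.
have hv2 : (2 * v)^-1 <= 1 by rewrite invf_le1 ?mulr_gt0//; lra.
have [z pz] : exists z : R[i], (N''.*2.+1).+1.-primitive_root z.
  exact: complex_prim_root_exists.
have QN : (N''.*2.+1).+1 = (2 * N')%N by rewrite /N' mul2n doubleS.
set Q := N''.*2.+1 in pz QN.
pose S b k e := \sum_(n < N') test_weight z b k n * coin_prod s n e.
pose E1 c b k e := expR (c * S b k e).
pose U e := \sum_(b : bool) \sum_(k < Q.+1) (E1 lam b k e + E1 (- lam) b k e).
have ExE c b k : `|c| = lam -> Ex K (E1 c b k) <= expR 1.
  move=> cl; pose s' := sort leq s.
  have ps' : perm_eq s s' by rewrite perm_sym perm_sort.
  have sz' : size s' = D by rewrite size_sort.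
  rewrite (@eq_Ex _ _ _ _ (fun e => expR (c * \sum_(n < N')
    test_weight z b k n * coin_prod s' n e))); last first.
    move=> e; congr (expR (_ * _)); apply: eq_bigr => n _.
    by rewrite (coin_prod_perm _ _ ps').
  have c2 : c ^+ 2 = lam ^+ 2 by rewrite -cl real_normK ?num_real.
  apply: (le_trans (Ex_exp_weighted_coins q01 _ _ _ _ _ _)) => //.
  - by rewrite -size_eq0 sz' size_eq0.
  - rewrite -sorted_pairwise; last exact: ltn_trans.
    by rewrite ltn_sorted_uniq_leq sort_uniq us sort_sorted//; exact: leq_total.
  - by move=> i; rewrite mem_sort; exact: sK.
  - by move=> n; exact: test_weight_le1 pz.
  - by rewrite cl.
  - by rewrite sz' c2 lam2.
  rewrite ler_expR sz' c2 [X in X * _]mulrC lam2.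
  apply: (@le_trans _ _ ((2 * v)^-1 * v)); last by rewrite invfM mulfVK ?gt_eqF//; lra.
  apply: ler_wpM2l; first by rewrite invr_ge0 mulr_ge0// ltW.
  apply: le_trans hv; apply: (@le_trans _ _ (\sum_(n < N') q n ^+ D)).
    by apply: ler_sum => n _; rewrite -sz'; exact: prob_prod_le.
  rewrite (big_ord_widen _ (fun n => q n ^+ D) N'N).
  rewrite [leRHS](bigID (fun i : 'I_N => (i < N')%N))/= lerDl.
  by apply: sumr_ge0 => n _; rewrite exprn_ge0//; case/andP: (q01 n).
have hU e : multi_norm [:: a] N' (fun n => coin_prod s n e) <=
    2 * (lam^-1 * (ln N%:R + N%:R^-1 * U e)).
  apply: (multi_norm1_le Zmp ZD _ _ pz QN) => // b k.
  rewrite (eq_bigr (fun n : 'I_N' => test_weight z b k n * coin_prod s n e)); last first.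
    by move=> n _; rewrite mulrC.
  rewrite -/(S b k e) mulrC ler_pdivlMr// mulrC.
  have : expR (lam * `|S b k e|) <= U e.
    have E0 c b' k' : 0 <= E1 c b' k' e := expR_ge0 _.
    rewrite /U (bigD1 b)//= (bigD1 k)//=.
    apply: (@le_trans _ _ (E1 lam b k e + E1 (- lam) b k e)).
      rewrite /E1; have [Sp|Sn] := leP 0 (S b k e).
        by rewrite ger0_norm// lerDl expR_ge0.
      by rewrite ltr0_norm// mulrN -mulNr lerDr expR_ge0.
    rewrite -addrA lerDl addr_ge0//; first by apply: sumr_ge0 => k' _; rewrite addr_ge0.
    by apply: sumr_ge0 => b' _; apply: sumr_ge0 => k' _; rewrite addr_ge0.
  move=> hS; have := expR_ge1Dx (lam * `|S b k e| - ln N%:R).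
  rewrite expRD expRN lnK ?posrE ?ltr0n// => h.
  have : expR (lam * `|S b k e|) / N%:R <= U e / N%:R by rewrite ler_wpM2r ?invr_ge0.
  by rewrite [N%:R^-1 * _]mulrC; lra.
apply: (le_trans (le_Ex q01 _ hU)).
rewrite (@eq_Ex _ _ _ _ (fun e => 2 * lam^-1 * ln N%:R + 2 * lam^-1 / N%:R * U e)); last first.
  by move=> e; ring.
rewrite ExD Ex_cst ExZ /U Ex_sum.
have ExU : \sum_(b : bool) Ex K (fun e => \sum_(k < Q.+1) (E1 lam b k e + E1 (- lam) b k e)) <=
    8 * expR 1 * N%:R.
  apply: (@le_trans _ _ (\sum_(b : bool) \sum_(k < Q.+1) (2 * expR 1))).
    apply: ler_sum => b _; rewrite Ex_sum; apply: ler_sum => k _; rewrite ExD.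
    have := ExE lam b k (gtr0_norm lam0).
    have := ExE (- lam) b k _; rewrite normrN => /(_ (gtr0_norm lam0)).
    lra.
  rewrite !sumr_const card_bool card_ord -mulrnA -[leLHS]mulr_natr QN.
  have : N'%:R <= N%:R :> R by rewrite ler_nat.
  rewrite !natrM; have := expR_gt0 (1 : R); move: (expR 1) => x; nra.
have l0 : 0 <= 2 * lam^-1 / N%:R by rewrite divr_ge0// mulr_ge0// invr_ge0 ltW.
apply: (@le_trans _ _ (2 * lam^-1 * ln N%:R + 2 * lam^-1 / N%:R * (8 * expR 1 * N%:R))).
  by rewrite lerD2l ler_wpM2l.
rewrite le_eqVlt; apply/orP; left; apply/eqP.
rewrite /lam invrK (_ : D + 3 = (D + 2).+1)%N; last by rewrite addnS.
have : N%:R != 0 :> R by rewrite pnatr_eq0 -lt0n.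
by rewrite [2 ^+ _.+1]exprS => h; field.
Qed.

End RandomNormBound.

Section PowerSums.
Context (R : realType).

Lemma weighted_amgm (a x y : R) : 0 <= a < 1 -> 0 <= x -> 0 <= y ->
  x `^ (1 - a) * y `^ a <= (1 - a) * x + a * y.
Proof.
move=> /andP[a0 a1] x0 y0; have [->|an0] := eqVneq a 0.
  by rewrite subr0 powRr1// powRr0 mulr1 mul1r mul0r addr0.
have ap : 0 < a by rewrite lt_def an0.
have ap1 : 0 < 1 - a by lra.
have := @conjugate_powR R (x `^ (1 - a)) (y `^ a) (1 - a)^-1 a^-1 (powR_ge0 _ _) (powR_ge0 _ _).
rewrite !invr_gt0 !invrK subrK => /(_ ap1 ap erefl).
rewrite -!powRrM !mulfV ?gt_eqF// !powRr1//.
by rewrite [x * _]mulrC [y * _]mulrC.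
Qed.

Lemma sum_powR_le (a : R) N : 0 <= a < 1 ->
  \sum_(n < N) n.+1%:R `^ (- a) <= N%:R `^ (1 - a) / (1 - a).
Proof.
move=> a01; have /andP[a0 a1] := a01; have ap1 : 0 < 1 - a by lra.
elim: N => [|N IHN]; first by rewrite big_ord0 mulr_ge0 ?powR_ge0// invr_ge0 ltW.
rewrite big_ord_recr /= (le_trans (lerD IHN (lexx _)))//.
rewrite -(ler_pM2r ap1) mulrDl !divfK ?gt_eqF//.
have N0 : 0 <= N%:R :> R by [].
have N1 : 0 <= N.+1%:R :> R by [].
have := weighted_amgm a01 N0 N1.
have E : N.+1%:R `^ a * N.+1%:R `^ (- a) = 1 :> R.
  by rewrite -powRD ?subrr ?powRr0// pnatr_eq0 implybT.
have -> : N.+1%:R `^ (1 - a) = N.+1%:R * N.+1%:R `^ (- a) :> R.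
  by rewrite powRD ?pnatr_eq0 ?implybT// powRr1.
move=> /(ler_wpM2r (powR_ge0 N.+1%:R (- a))).
rewrite -mulrA E mulr1 -(natr1 N).
have := powR_ge0 (N%:R + 1 : R) (- a); move: (powR _ _) (powR _ _) => u v u0 h.
apply: le_trans (lerD h (lexx _)) _.
by rewrite le_eqVlt; apply/orP; left; apply/eqP; ring.
Qed.

Lemma ln_le_powR (e x : R) : 0 < e -> 1 <= x -> ln x <= x `^ e / e.
Proof.
move=> e0 x1; rewrite ler_pdivlMr// mulrC -ln_powR ltW// ln_sublinear//.
by rewrite powR_gt0// (lt_le_trans _ x1).
Qed.

End PowerSums.

Section RandomNormInduction.
Context d (X : measurableType d) (R : realType) (mu : probability X R).
Context (Z : int -> X -> X).
Hypothesis Zmp : forall a, measure_preserving mu (Z a).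
Hypothesis ZD : forall a b x, Z (a + b) x = Z a (Z b x).
Context (q : nat -> R).
Hypothesis q01 : forall n, 0 <= q n <= 1.

Local Notation multi_norm := (multi_norm mu Z).
Local Notation Ex := (Ex q).
Local Notation coin_prod := (coin_prod q).

Lemma coin_prod_shift s n h e :
  coin_prod s n e * coin_prod s (n + h) e = coin_prod (s ++ map (addn h) s) n e.
Proof.
rewrite /coin_prod big_cat big_map; congr (_ * _).
by apply: eq_bigr => i _; rewrite addnA.
Qed.

Lemma sum_eq_ord (N c : nat) : (\sum_(h < N) (h == c :> nat) <= 1)%N.
Proof.
suff -> : (\sum_(h < N) (h == c :> nat) = (c < N))%N by case: ltnP.
elim: N => [|N IHN]; first by rewrite big_ord0.
by rewrite big_ord_recr /= IHN ltnS; case: ltngtP.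
Qed.

Lemma count_degenerate_shifts s N : uniq s ->
  (\sum_(h < N) ~~ uniq (s ++ map (addn h.+1) s) <= size s ^ 2)%N.
Proof.
move=> us.
apply: (@leq_trans (\sum_(i <- s) \sum_(j <- s) \sum_(h < N) (h == (i - j).-1 :> nat))%N).
  rewrite (eq_bigr (fun i => \sum_(h < N) \sum_(j <- s) (h == (i - j).-1 :> nat))%N);
    last by move=> i _; rewrite exchange_big.
  rewrite [leqRHS]exchange_big; apply: leq_sum => h _ /=.
  case: (boolP (uniq _)) => //= hu.
  have [i [j [si sj ij]]] : exists i j, [/\ i \in s, j \in s & i = (h.+1 + j)%N].
    move: hu; rewrite cat_uniq us /= map_inj_uniq ?us ?andbT; last exact: addnI.
    by rewrite negbK => /hasP[i /mapP[j sj ->] si]; exists (h.+1 + j)%N, j.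
  rewrite (big_rem i)//= (big_rem j)//= (_ : h == _ :> nat)//.
  by apply/eqP; lia.
apply: (@leq_trans (\sum_(i <- s) \sum_(j <- s) 1)%N).
  by apply: leq_sum => i _; apply: leq_sum => j _; exact: sum_eq_ord.
rewrite (eq_bigr (fun=> size s)) => [|i _]; last by rewrite sum1_size.
by rewrite big_const_seq count_predT iter_addn_0 mulnn.
Qed.

Lemma Ex_multi_norm_step a sl s N N' K b : (0 < N)%N -> (N' <= N)%N -> uniq s ->
  {in s, forall i, (N' + i <= K)%N} -> 0 <= b ->
  (forall N'' s', (N'' <= N)%N -> uniq s' -> size s' = (2 * size s)%N ->
    {in s', forall i, (N'' + i <= K)%N} ->
    Ex K (fun e => multi_norm [seq c - a | c <- sl] N'' (fun n => coin_prod s' n e)) <= b) ->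
  Ex K (fun e => multi_norm (a :: sl) N' (fun n => coin_prod s n e)) <=
    Num.sqrt (N%:R * (1 + 2 * (size s ^ 2)%:R) + 2 * N%:R * b).
Proof.
move=> N0 N'N us sK b0 IH.
set S := N%:R * _ + _.
have N1 : 0 < N%:R :> R by rewrite ltr0n.
have S0 : 0 < S.
  rewrite ltr_wpDr ?mulr_ge0 ?ler0n// mulr_gt0// ltr_wpDr ?mulr_ge0//.
set B := Num.sqrt S.
have B0 : 0 < B by rewrite sqrtr_gt0.
have BS : B ^+ 2 = S by rewrite sqr_sqrtr// ltW.
pose F e := multi_norm (a :: sl) N' (fun n => coin_prod s n e).
have c1 s' n e : `|coin_prod s' n e| <= 1 := coin_prod_le1 q01 s' n e.
have amgm (y b' : R) : 0 < b' -> y <= 2^-1 * b'^-1 * y ^+ 2 + 2^-1 * b'.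
  move=> b'0; rewrite -(ler_pM2l b'0).
  rewrite [leRHS](_ : _ = 2^-1 * y ^+ 2 + 2^-1 * b' ^+ 2).
    by have := sqr_ge0 (y - b'); rewrite sqrrB; lra.
  by field; rewrite gt_eqF.
suff h : Ex K (fun e => F e ^+ 2) <= S.
  apply: (@le_trans _ _ (Ex K (fun e => 2^-1 * B^-1 * F e ^+ 2 + 2^-1 * B))).
    by apply: le_Ex => // e; exact: amgm.
  rewrite ExD ExZ Ex_cst.
  have : 2^-1 * B^-1 * Ex K (fun e => F e ^+ 2) <= 2^-1 * B.
    rewrite -mulrA ler_wpM2l ?invr_ge0// mulrC ler_pdivrMr// -expr2 BS//.
  lra.
pose G h e := multi_norm [seq c - a | c <- sl] (N' - h.+1)
  (fun n => coin_prod (s ++ map (addn h.+1) s) n e).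
have GN h e : G h e <= N%:R.
  apply: (le_trans (multi_norm_le_size Zmp _ _ _)) => //.
  by rewrite ler_nat (leq_trans _ N'N)// leq_subr.
have ExG h : (h < N')%N ->
    Ex K (G h) <= b + N%:R * (~~ uniq (s ++ map (addn h.+1) s))%:R.
  move=> hN; case: (boolP (uniq _)) => hu /=.
    rewrite mulr0 addr0; apply: IH => //.
    - by rewrite (leq_trans _ N'N)// leq_subr.
    - by rewrite size_cat size_map addnn mul2n.
    - move=> i; rewrite mem_cat => /orP[/sK|/mapP[j /sK jK ->]]; lia.
  rewrite mulr1 -[leLHS]add0r lerD//.
  by rewrite -[leRHS](Ex_cst q K); apply: le_Ex => // e; exact: GN.
apply: (@le_trans _ _ (Ex K (fun e => N%:R + 2 * \sum_(h < N') G h e))).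
  apply: le_Ex => // e; apply: (le_trans (multi_norm_step Zmp ZD _ _ _ _)) => //.
  rewrite lerD ?ler_nat// ler_wpM2l//; apply: ler_sum => h _.
  rewrite le_eqVlt; apply/orP; left; apply/eqP; congr multi_norm.
  by apply/funext => n; rewrite coin_prod_shift.
rewrite ExD Ex_cst ExZ Ex_sum.
have : \sum_(h < N') Ex K (G h) <= N%:R * b + N%:R * (size s ^ 2)%:R.
  apply: (@le_trans _ _ (\sum_(h < N') (b + N%:R * (~~ uniq (s ++ map (addn h.+1) s))%:R))).
    by apply: ler_sum => h _; exact: ExG.
  rewrite big_split /= sumr_const card_ord -[X in X + _]mulr_natl lerD//.
    by rewrite ler_wpM2r// ler_nat.
  rewrite -mulr_sumr ler_wpM2l// -natr_sum ler_nat; exact: count_degenerate_shifts.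
rewrite /S; lra.
Qed.

Lemma Ex_multi_norm_powR m (D : nat) (C1 eta : R) N K : (0 < N)%N ->
  0 <= C1 -> eta <= 1 ->
  (forall a s N', uniq s -> size s = D -> (N' <= N)%N ->
    {in s, forall i, (N' + i <= K)%N} ->
    Ex K (fun e => multi_norm [:: a] N' (fun n => coin_prod s n e)) <=
      C1 * N%:R `^ (1 - eta)) ->
  forall sl s N', size sl = m.+1 -> uniq s -> (size s * 2 ^ m)%N = D -> (N' <= N)%N ->
    {in s, forall i, (N' + i <= K)%N} ->
    Ex K (fun e => multi_norm sl N' (fun n => coin_prod s n e)) <=
      iter m (fun C => Num.sqrt (1 + 2 * (D ^ 2)%:R + 2 * C)) C1 * N%:R `^ (1 - eta / 2 ^+ m).
Proof.
move=> N0 C10 eta1 base.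
have N1 : 1 <= N%:R :> R by rewrite ler1n.
elim: m => [|m IHm] sl s N'.
  case: sl => [//|a [|//]] _ us; rewrite muln1 => sD N'N sK.
  by rewrite expr0 divr1; exact: base.
case: sl => [//|a sl] /= [ssl] us sD N'N sK.
set Cm := iter m _ C1 in IHm *.
have Cm0 : 0 <= Cm by rewrite /Cm; case: (m) => //= n; exact: sqrtr_ge0.
have sD' : (size s <= D)%N by rewrite -sD leq_pmulr// expn_gt0.
apply: (le_trans (@Ex_multi_norm_step a sl s N N' K
  (Cm * N%:R `^ (1 - eta / 2 ^+ m)) _ _ _ _ _ _)) => //.
- by rewrite mulr_ge0 ?powR_ge0.
- move=> N'' s' N''N us' ss' sK'; apply: IHm => //; first by rewrite size_map.
  by rewrite ss' -sD expnS mulnA [(size s * 2)%N]mulnC.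
set x := 1 - eta / 2 ^+ m.
have xE : 1 + x = 2 * (1 - eta / 2 ^+ m.+1).
  by rewrite /x exprS; field; rewrite expf_neq0.
have p1 : 1 <= 2 ^+ m :> R by rewrite exprn_ege1 ?ler1n.
have x0 : 0 <= x.
  rewrite subr_ge0 ler_pdivrMr ?mul1r ?(le_trans eta1)//; exact: lt_le_trans p1.
have -> : N%:R `^ (1 - eta / 2 ^+ m.+1) = Num.sqrt (N%:R `^ (1 + x)) :> R.
  by rewrite xE -powR12_sqrt ?powR_ge0// -powRrM mulrAC mulfV ?mul1r.
rewrite -sqrtrM; last by rewrite !addr_ge0// mulr_ge0.
apply: ler_wsqrtr.
have NN : N%:R `^ (1 + x) = N%:R * N%:R `^ x :> R.
  by rewrite powRD ?powRr1// pnatr_eq0 -lt0n N0 implybT.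
have Nx1 : 1 <= N%:R `^ x :> R by rewrite -[leLHS](powRr0 N%:R) ler_powR.
rewrite NN [leRHS]mulrDl lerD//; last first.
  by rewrite le_eqVlt; apply/orP; left; apply/eqP; ring.
rewrite [leLHS]mulrC; apply: ler_pM => //.
- by rewrite lerD2l ler_wpM2l// ler_nat leq_exp2r.
- by rewrite ler_peMr.
Qed.

End RandomNormInduction.

Section RandomNormFinal.
Context d (X : measurableType d) (R : realType) (mu : probability X R).
Context (Z : int -> X -> X).
Hypothesis Zmp : forall a, measure_preserving mu (Z a).
Hypothesis ZD : forall a b x, Z (a + b) x = Z a (Z b x).

Lemma random_norm_bound m (gamma : R) : 0 <= gamma -> 2 ^+ m * gamma < 1 ->
  exists C kappa : R, [/\ 0 <= C, 0 < kappa, 2 * kappa <= 1 - gamma &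
    forall sl, size sl = m.+1 ->
    forall N, (0 < N)%N ->
    Ex (fun n => n.+1%:R `^ (- gamma)) N
      (fun e => multi_norm mu Z sl N
        (fun n => coin (fun n => n.+1%:R `^ (- gamma)) n e)) <=
      C * N%:R `^ (1 - gamma - 2 * kappa)].
Proof.
move=> g0 g1; pose q n : R := n.+1%:R `^ (- gamma); rewrite -/q.
have q01 n : 0 <= q n <= 1.
  rewrite powR_ge0 /= -[leRHS](powRr0 n.+1%:R) ler_powR ?ler1n//; lra.
have q_mono a b : (a <= b)%N -> q b <= q a.
  move=> ab; rewrite /q !powRN lef_pV2 ?posrE ?powR_gt0//.
  by rewrite ge0_ler_powR ?nnegrE// ler_nat.
pose D := (2 ^ m)%N.
have DR : D%:R = 2 ^+ m :> R by rewrite /D natrX.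
have D0 : 0 < D%:R :> R by rewrite ltr0n expn_gt0.
pose a := D%:R * gamma.
have a0 : 0 <= a by rewrite mulr_ge0.
have a1 : a < 1 by rewrite /a DR.
pose ep := (1 - a) / 4.
have ep0 : 0 < ep by rewrite divr_gt0//; lra.
pose eta := (1 + a) / 2 - ep.
have eta1 : eta <= 1 by rewrite /eta /ep; lra.
pose kappa := (1 - a) / (8 * D%:R).
have k0 : 0 < kappa by rewrite divr_gt0 ?mulr_gt0//; lra.
pose C1 := 2 ^+ (D + 3) * Num.sqrt (1 - a)^-1 * (ep^-1 + 8 * expR 1).
have C10 : 0 <= C1.
  apply: mulr_ge0; first by rewrite mulr_ge0 ?exprn_ge0 ?sqrtr_ge0.
  by rewrite addr_ge0 ?invr_ge0 ?(ltW ep0)// mulr_ge0 ?expR_ge0.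
exists (iter m (fun C => Num.sqrt (1 + 2 * (D ^ 2)%:R + 2 * C)) C1), kappa.
split=> //; first by case: (m) => //= n; exact: sqrtr_ge0.
  rewrite /kappa invfM mulrA mulrA ler_pdivrMr//.
  have D1 : 1 <= D%:R :> R by rewrite ler1n expn_gt0.
  by rewrite /a; nra.
move=> sl ssl N N0.
have N1 : 1 <= N%:R :> R by rewrite ler1n.
have base b s N' : uniq s -> size s = D -> (N' <= N)%N ->
    {in s, forall i, (N' + i <= N)%N} ->
    Ex q N (fun e => multi_norm mu Z [:: b] N' (fun n => coin_prod q s n e)) <=
      C1 * N%:R `^ (1 - eta).
  move=> us sD N'N sN; pose v := N%:R `^ (1 - a) / (1 - a).
  have v1 : 1 <= v.
    rewrite ler_pdivlMr ?mul1r; last by lra.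
    apply: (@le_trans _ _ 1); first by lra.
    by rewrite -[leLHS](powRr0 N%:R) ler_powR//; lra.
  have hv : \sum_(n < N) q n ^+ size s <= v.
    rewrite sD; apply: le_trans (sum_powR_le N _); last by rewrite a0.
    apply: ler_sum => n _; rewrite le_eqVlt; apply/orP; left; apply/eqP.
    by rewrite /q -powR_mulrn ?powR_ge0// -powRrM mulNr mulrC.
  have s0 : s != [::] by rewrite -size_eq0 sD -lt0n expn_gt0.
  apply: (le_trans (Ex_multi_norm1_le Zmp ZD q01 q_mono b N0 N'N us s0 sN v1 hv)).
  rewrite sD /v sqrtrM ?powR_ge0// -powR12_sqrt ?powR_ge0// -powRrM.
  rewrite /C1 -!mulrA ler_wpM2l ?exprn_ge0// mulrCA ler_wpM2l ?sqrtr_ge0//.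
  have -> : 1 - eta = (1 - a) * 2^-1 + ep by rewrite /eta; lra.
  rewrite powRD; last by rewrite pnatr_eq0 -lt0n N0 implybT.
  rewrite [leRHS]mulrCA ler_wpM2l ?powR_ge0// [leRHS]mulrDl lerD//.
    by rewrite mulrC ln_le_powR.
  rewrite ler_peMr ?mulr_ge0 ?expR_ge0//.
  by rewrite -[leLHS](powRr0 N%:R) ler_powR// ltW.
have := @Ex_multi_norm_powR _ _ _ mu Z Zmp ZD q q01 m D C1 eta N N N0 C10 eta1 base
  sl [:: 0%N] N ssl _ _ (leqnn N) _.
rewrite (_ : 1 - gamma - 2 * kappa = 1 - eta / 2 ^+ m); last first.
  rewrite -DR /kappa /eta /ep /a; field; rewrite gt_eqF//.
rewrite (@eq_Ex _ _ _ _ (fun e => multi_norm mu Z sl N (fun n => coin q n e))).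
  by apply=> //; [rewrite mul1n|move=> i; rewrite inE => /eqP ->; rewrite addn0].
move=> e; congr multi_norm; apply/funext => n.
by rewrite /coin_prod big_seq1 addn0.
Qed.

End RandomNormFinal.

(** * Almost sure smallness *)

Section CoinLaw.
Context (R : realType) (q : nat -> R).

Fixpoint bool_seqs K : seq (seq bool) :=
  if K is K'.+1 then [seq rcons v b | v <- bool_seqs K', b <- [:: true; false]]
  else [:: [::]].

Lemma size_bool_seqs K v : v \in bool_seqs K -> size v = K.
Proof.
elim: K v => [|K IHK] v /=; first by rewrite inE => /eqP ->.
by move=> /flatten_mapP[u /IHK su]; rewrite !inE => /orP[]/eqP ->; rewrite size_rcons su.
Qed.

Lemma mkseq_bool_seqs (e : nat -> bool) K : mkseq e K \in bool_seqs K.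
Proof.
elim: K => [|K IHK]; first by rewrite inE.
rewrite mkseqS /=; apply/flatten_mapP; exists (mkseq e K) => //.
by rewrite !inE; case: (e K); rewrite eqxx ?orbT.
Qed.

Definition coin_weight (v : seq bool) : R :=
  \prod_(i < size v) (if nth false v i then q i else 1 - q i).

Lemma Ex_bool_seqs K (F : (nat -> bool) -> R) :
  Ex q K F = \sum_(v <- bool_seqs K) coin_weight v * F (nth false v).
Proof.
elim: K F => [|K IHK] F /=.
  rewrite big_seq1 /coin_weight big_ord0 mul1r; congr F.
  by apply/funext => n; rewrite nth_nil.
rewrite IHK big_flatten big_map /=; apply: eq_big_seq => v /size_bool_seqs sv.
have upE b : upd (nth false v) K b = nth false (rcons v b).
  apply/funext => n; rewrite /upd nth_rcons sv; case: ltngtP => // Kn.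
  by rewrite nth_default// sv ltnW.
have wE b : coin_weight (rcons v b) = coin_weight v * (if b then q K else 1 - q K).
  rewrite /coin_weight size_rcons big_ord_recr /= nth_rcons ltnn eqxx sv; congr (_ * _).
  by apply: eq_bigr => i _; rewrite nth_rcons sv ltn_ord.
by rewrite big_cons big_seq1 !wE /cond_Ex !upE; ring.
Qed.

End CoinLaw.

Section CoinEvents.
Context d (Omega : measurableType d) (R : realType) (P : probability Omega R).
Context (s : nat -> {RV P >-> R}) (q : nat -> R).
Hypothesis hs_indep : jointly_independent [set n | (1 <= n)%N] s.
Hypothesis hs1 : forall n, P [set w | s n.+1 w = 1] = (q n)%:E.
Hypothesis q01 : forall n, 0 <= q n <= 1.

Definition coins (w : Omega) (n : nat) : bool := s n.+1 w == 1.

Definition cylinder (v : seq bool) : set Omega :=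
  [set w | forall i, (i < size v)%N -> coins w i = nth false v i].

Let side (b : bool) : set R := if b then [set 1] else ~` [set 1].

Let m_side b : measurable (side b).
Proof. by case: b; rewrite /side; [|apply: measurableC]; exact: measurable_set1. Qed.

Let coinsE w n b : (coins w n = b) <-> side b (s n.+1 w).
Proof.
rewrite /coins /side; case: b; split => /=; last first.
- by move=> /eqP/negbTE.
- by move=> /negbT/eqP.
- by move=> ->; rewrite eqxx.
- by move=> /eqP.
Qed.

Let P_side n b : P (s n.+1 @^-1` side b) = (if b then q n else 1 - q n)%:E.
Proof.
have hT : P (s n.+1 @^-1` [set 1]) = (q n)%:E by rewrite -hs1.
case: b; first exact: hT.
rewrite /side /= -preimage_setC probability_setC ?hT//.
Qed.

Let index_set K : {fset nat} := seq_fset tt (iota 1 K).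

Let mem_index_set K i : (i \in index_set K) = (0 < i <= K)%N.
Proof. by rewrite seq_fsetE mem_iota add1n ltnS. Qed.

Lemma cylinderE v : cylinder v =
  \bigcap_(i in [set` index_set (size v)]) s i @^-1` side (nth false v i.-1).
Proof.
apply/seteqP; split => w h.
  move=> i; rewrite -[X in X -> _]/(is_true (i \in index_set _)) mem_index_set.
  case: i => // i iv; exact/coinsE/h.
move=> i iv; apply/coinsE; apply: (h i.+1).
by change (i.+1 \in index_set (size v)); rewrite mem_index_set.
Qed.

Lemma measurable_cylinder v : measurable (cylinder v).
Proof.
rewrite cylinderE; apply: fin_bigcap_measurable => [|i _]; first exact: finite_fset.
by rewrite -[_ @^-1` _]setTI; exact: measurable_funP.
Qed.

Lemma probability_cylinder v : P (cylinder v) = (coin_weight q v)%:E.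
Proof.
rewrite cylinderE hs_indep; last 2 first.
- move=> i; rewrite -[X in X -> _]/(is_true (i \in index_set _)) mem_index_set.
  by case/andP.
- by move=> i _; exact: m_side.
rewrite (perm_big _ (seq_fset_perm tt _)) undup_id ?iota_uniq//=.
rewrite /coin_weight -prodEFin.
rewrite -[iota 1 _]/(iota (1 + 0) (size v)) iotaDl big_map.
rewrite -[X in iota 0 X]subn0 -/(index_iota 0 (size v)).
by rewrite big_mkord; apply: eq_bigr => i _; rewrite -P_side.
Qed.

Definition coin_event K (A : pred (nat -> bool)) : set Omega :=
  \big[setU/set0]_(v <- bool_seqs K | A (nth false v)) cylinder v.

Lemma measurable_coin_event K A : measurable (coin_event K A).
Proof. by apply: bigsetU_measurable => v _; exact: measurable_cylinder. Qed.

Lemma mem_coin_event K (A : pred (nat -> bool)) w :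
  (forall e e', (forall i, (i < K)%N -> e i = e' i) -> A e = A e') ->
  A (coins w) -> coin_event K A w.
Proof.
move=> dA Aw; rewrite /coin_event -bigcup_seq_cond.
have agree i : (i < K)%N -> nth false (mkseq (coins w) K) i = coins w i.
  by move=> iK; rewrite nth_mkseq.
exists (mkseq (coins w) K).
  by rewrite /= mkseq_bool_seqs (dA _ _ agree).
by move=> i; rewrite size_mkseq => /agree.
Qed.

Lemma coin_weight_ge0 v : 0 <= coin_weight q v.
Proof.
apply: prodr_ge0 => i _; have /andP[h0 h1] := q01 i.
by case: ifP => // _; rewrite subr_ge0.
Qed.

Lemma coin_event_le K (A : pred (nat -> bool)) (F : (nat -> bool) -> R) t : 0 < t ->
  (forall e, 0 <= F e) -> (forall e, A e -> t <= F e) ->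
  (P (coin_event K A) <= (Ex q K F / t)%:E)%E.
Proof.
move=> t0 F0 AF.
apply: (@le_trans _ _ (\sum_(v <- bool_seqs K | A (nth false v)) (coin_weight q v)%:E)%E).
  rewrite /coin_event; elim: (bool_seqs K) => [|v r IHr].
    by rewrite !big_nil measure0.
  rewrite !big_cons; case: ifP => // _.
  apply: (le_trans (measureU2 _ _ _)).
  - exact: measurable_cylinder.
  - by apply: bigsetU_measurable => u _; exact: measurable_cylinder.
  by apply: leeD => //; rewrite -probability_cylinder; exact: lexx.
rewrite sumEFin lee_fin Ex_bool_seqs mulr_suml big_mkcond /=.
apply: ler_sum => v _; have w0 := coin_weight_ge0 v.
case: ifP => [Av|_]; last by rewrite !mulr_ge0// invr_ge0 ltW.
by rewrite -mulrA ler_peMr// ler_pdivlMr// mul1r AF.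
Qed.

End CoinEvents.

Section AlmostSure.
Context d (Omega : measurableType d) (R : realType) (P : probability Omega R).

Lemma sum_inv_sqr_le N : \sum_(n < N) (n.+1%:R ^- 2) <= 2 :> R.
Proof.
suff : \sum_(n < N) (n.+1%:R ^- 2) <= 2 - 2 / N.+1%:R :> R.
  by move=> h; apply: (le_trans h); rewrite gerBl divr_ge0.
elim: N => [|N IHN]; first by rewrite big_ord0 divr1 subrr.
rewrite big_ord_recr /= (le_trans (lerD IHN (lexx _)))//.
rewrite -(natr1 N.+1); have : 1 <= N.+1%:R :> R by rewrite ler1n.
move: N.+1%:R => x x1; have x0 : 0 < x by lra.
have x2 : 0 < x + 1 by lra.
rewrite -subr_ge0 [leRHS](_ : _ = (x - 1) / (x ^+ 2 * (x + 1))); last first.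
  by field; rewrite !gt_eqF.
by rewrite divr_ge0 ?subr_ge0// mulr_ge0 ?sqr_ge0// ltW.
Qed.

Lemma borel_cantelli_inv_sqr (E : nat -> set Omega) C : 0 <= C ->
  (forall j, measurable (E j)) -> (forall j, P (E j) <= (C * j.+1%:R ^- 2)%:E)%E ->
  {ae P, forall w, exists j0, forall j, (j0 <= j)%N -> ~ E j w}.
Proof.
move=> C0 mE hE; exists (lim_sup_set E); split.
- by apply: bigcapT_measurable => k; apply: bigcup_measurable => j _; exact: mE.
- apply: lim_sup_set_cvg0 => //.
  apply: (@le_lt_trans _ _ (C * 2)%:E); last exact: ltry.
  apply: lime_le; first exact: is_cvg_nneseries.
  apply: nearW => n; rewrite big_mkord.
  apply: (@le_trans _ _ (\sum_(j < n) (C * j.+1%:R ^- 2)%:E)%E).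
    by apply: lee_sum => j _; exact: hE.
  by rewrite sumEFin lee_fin -mulr_sumr ler_wpM2l// sum_inv_sqr_le.
move=> w /= hw n _; apply: contrapT => h; apply: hw; exists n => j nj Ej.
by apply: h; exists j.
Qed.

End AlmostSure.

Section UniformSmallness.
Context d (X : measurableType d) (R : realType) (mu : probability X R).
Context (Z : int -> X -> X).
Hypothesis Zmp : forall a, measure_preserving mu (Z a).
Hypothesis ZD : forall a b x, Z (a + b) x = Z a (Z b x).
Context (gamma : R).
Hypothesis g0 : 0 <= gamma.

Local Notation multi_norm := (multi_norm mu Z).
Local Notation weighted_sum := (weighted_sum Z).
Local Notation n2 := (n2 mu).

Definition success_prob n : R := n.+1%:R `^ (- gamma).
Local Notation q := success_prob.
Local Notation c := (coin q).

Lemma success_prob01 n : 0 <= q n <= 1.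
Proof.
by rewrite powR_ge0 /= -[leRHS](powRr0 n.+1%:R) ler_powR ?ler1n// oppr_le0.
Qed.

Lemma success_prob_mono m n : (m <= n)%N -> q n <= q m.
Proof.
move=> mn; rewrite /q !powRN lef_pV2 ?posrE ?powR_gt0//.
by rewrite ge0_ler_powR ?nnegrE// ler_nat.
Qed.

Lemma multi_norm_ext sl N (c1 c2 : nat -> R) : (forall n, (n < N)%N -> c1 n = c2 n) ->
  multi_norm sl N c1 = multi_norm sl N c2.
Proof.
move=> c12; rewrite /multi_norm; congr sup; apply/funext => r.
suff E l : weighted_sum c1 l N = weighted_sum c2 l N.
  by apply/propext; split=> -[l [h1 h2 ->]]; exists l; rewrite E.
by apply/funext => x; apply: eq_bigr => n _; rewrite c12.
Qed.

Lemma norm_coin_le n e : `|c n e| <= c n e + 2 * q n.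
Proof.
have /andP[q0 q1] := success_prob01 n.
rewrite /coin; case: (e n) => /=.
  by rewrite ger0_norm ?subr_ge0//; lra.
by rewrite sub0r normrN ger0_norm//; lra.
Qed.

Lemma weighted_sum1 (sl : seq int) N (c1 : nat -> R) x :
  weighted_sum c1 [seq (a, fun=> 1 : R) | a <- sl] N x = \sum_(n < N) c1 n.
Proof. by apply: eq_bigr => n _; rewrite big_map big1 ?mulr1. Qed.

Lemma all_bdd1_cst1 (sl : seq int) : all_bdd1 (X := X) [seq (a, fun=> 1 : R) | a <- sl].
Proof.
elim: sl => //= a sl IH; split=> //.
by rewrite -[X in bdd X](@normr1 R); exact: bdd_cst.
Qed.

Lemma norm_sum_le_multi_norm sl N (c1 : nat -> R) : `|\sum_(n < N) c1 n| <= multi_norm sl N c1.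
Proof.
have := le_multi_norm Zmp c1 N (all_bdd1_cst1 sl).
rewrite -map_comp map_id_in//; apply: le_trans.
rewrite /n2 (_ : (fun x => _) = fun=> (\sum_(n < N) c1 n) ^+ 2); last first.
  by apply/funext => x; rewrite weighted_sum1.
by rewrite Int_cst sqrtr_sqr.
Qed.

Lemma exprD1_le (x : R) L : 0 <= x <= 1 -> (1 + x) ^+ L <= 1 + (2 ^+ L - 1) * x.
Proof.
move=> /andP[x0 x1]; elim: L => [|L IHL]; first by rewrite !expr0 subrr mul0r addr0.
rewrite exprS [2 ^+ _.+1]exprS.
have p1 : 1 <= 2 ^+ L :> R by rewrite exprn_ege1 ?ler1n.
apply: (le_trans (ler_wpM2l _ IHL)); first by lra.
have h : 0 <= (2 ^+ L - 1) * (x * (1 - x)).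
  by apply: mulr_ge0; [lra|apply: mulr_ge0; lra].
by move: (2 ^+ L) p1 h => p p1 h; lra.
Qed.

Lemma n2_weighted_sum_between sl e L (kappa : R) j0 : (0 < L)%N ->
  0 < kappa -> kappa <= 1 - gamma -> 1 <= L%:R * kappa ->
  (forall j, (j0 <= j)%N -> multi_norm sl (j.+1 ^ L) (c^~ e) <=
     (j.+1 ^ L)%:R `^ (1 - gamma - kappa)) ->
  forall l, map fst l = sl -> all_bdd1 l -> forall j N, (j0 <= j)%N ->
    (j.+1 ^ L <= N)%N -> (N < j.+2 ^ L)%N ->
    n2 (weighted_sum (c^~ e) l N) <= (2 + 3 * 2 ^+ L) / j.+1%:R * N%:R `^ (1 - gamma).
Proof.
move=> L0 k0 kg Lk hj l hl bl j N j0j jN ltN.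
have j1 : 0 < j.+1%:R :> R by rewrite ltr0n.
set Nj := (j.+1 ^ L)%N in jN *; set Nj' := (j.+2 ^ L)%N in ltN *.
have NN' : (Nj <= Nj')%N by exact: leq_trans jN (ltnW ltN).
have Nj0 : (0 < Nj)%N by rewrite expn_gt0.
have x1 : 1 <= Nj%:R :> R by rewrite ler1n.
have x0 : 0 < Nj%:R :> R by exact: lt_le_trans x1.
set b := 1 - gamma - kappa.
have b0 : 0 <= b by rewrite /b subr_ge0.
have b1 : b <= 1 by move: g0 k0; rewrite /b; lra.
have g1 : 0 <= 1 - gamma by lra.
have p2 : 1 <= 2 ^+ L :> R by rewrite exprn_ege1 ?ler1n.
pose xg := Nj%:R `^ (1 - gamma).
have xg0 : 0 <= xg by exact: powR_ge0.
have hb : Nj%:R `^ b <= xg / j.+1%:R.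
  rewrite /b powRD; last by apply/implyP => _; exact: lt0r_neq0.
  apply: ler_wpM2l => //.
  rewrite powRN lef_pV2 ?posrE ?powR_gt0// /Nj natrX -powR_mulrn// -powRrM.
  by rewrite -[leLHS]powRr1// ler_powR ?ler1n.
have hx' : Nj'%:R <= 2 ^+ L * Nj%:R :> R.
  rewrite -natrX -natrM ler_nat -expnMn leq_exp2r//; lia.
have hb' : Nj'%:R `^ b <= 2 ^+ L * (xg / j.+1%:R).
  apply: (@le_trans _ _ ((2 ^+ L * Nj%:R) `^ b)).
    by rewrite ge0_ler_powR ?nnegrE// mulr_ge0// exprn_ge0.
  rewrite powRM ?exprn_ge0//; apply: ler_pM; rewrite ?powR_ge0//.
  exact: ler1_powR.
have hd : (Nj' - Nj)%:R * Nj%:R `^ (- gamma) <= 2 ^+ L * (xg / j.+1%:R).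
  have xgE : xg = Nj%:R * Nj%:R `^ (- gamma).
    rewrite /xg powRD; last by apply/implyP => _; exact: lt0r_neq0.
    by rewrite powRr1// ltW.
  rewrite xgE [leRHS](_ : _ = 2 ^+ L * Nj%:R / j.+1%:R * Nj%:R `^ (- gamma)); last by ring.
  apply: ler_wpM2r; rewrite ?powR_ge0// natrB//.
  have E : Nj'%:R = Nj%:R * (1 + j.+1%:R^-1) ^+ L :> R.
    rewrite /Nj' /Nj !natrX -exprMn mulrDr mulr1 mulfV ?gt_eqF//.
    by rewrite natr1.
  have h : (1 + j.+1%:R^-1) ^+ L <= 1 + (2 ^+ L - 1) * j.+1%:R^-1 :> R.
    by apply: exprD1_le; rewrite invr_ge0 ltW//= invf_le1// ler1n.
  have ji : 0 < j.+1%:R^-1 :> R by rewrite invr_gt0.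
  have aux (A B i x : R) : A <= 1 + (B - 1) * i -> 0 < i -> 0 < x -> x * A - x <= B * x * i.
    by move=> hA i0 xp; have := ler_wpM2l (ltW xp) hA; have := mulr_gt0 xp i0; lra.
  by rewrite E; exact: aux.
pose D := \sum_(Nj <= n < Nj') `|c n e|.
have D0 k : (k <= Nj')%N -> (Nj <= k)%N -> \sum_(Nj <= n < k) `|c n e| <= D.
  move=> kN Nk; rewrite /D (big_cat_nat Nk kN)//= lerDl.
  by apply: sumr_ge0.
have hD : D <= Nj'%:R `^ b + Nj%:R `^ b + 2 * (2 ^+ L * (xg / j.+1%:R)).
  apply: (@le_trans _ _ (\sum_(Nj <= n < Nj') (c n e + 2 * q n))).
    by apply: ler_sum => n _; exact: norm_coin_le.
  rewrite big_split /=; apply: lerD.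
    have E : \sum_(n < Nj') c n e = \sum_(n < Nj) c n e + \sum_(Nj <= n < Nj') c n e.
      by rewrite -!(big_mkord xpredT (fun n => c n e)) (big_cat_nat (leq0n Nj) NN').
    have h1 := le_trans (norm_sum_le_multi_norm sl Nj (c^~ e)) (hj _ j0j).
    have h2 := le_trans (norm_sum_le_multi_norm sl Nj' (c^~ e)) (hj _ (leqW j0j)).
    move: h1 h2; rewrite -/Nj -/Nj' E -/b !ler_norml.
    by move=> /andP[? ?] /andP[? ?]; lra.
  rewrite -mulr_sumr ler_wpM2l//; apply: le_trans hd.
  apply: (@le_trans _ _ (\sum_(Nj <= n < Nj') Nj%:R `^ (- gamma))).
    apply: ler_sum_nat => n /andP[Njn _].
    apply: (@le_trans _ _ (q Nj.-1)).
      by apply: success_prob_mono; rewrite (leq_trans _ Njn)// leq_pred.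
    by rewrite /q prednK.
  by rewrite sumr_const_nat -[leLHS]mulr_natl.
have bw := bm_weighted_sum Zmp (c^~ e) _ bl.
apply: (@le_trans _ _ (n2 (weighted_sum (c^~ e) l Nj) + D)).
  pose t x := weighted_sum (c^~ e) l N x - weighted_sum (c^~ e) l Nj x.
  have bt : bm t by exact: bmB.
  rewrite (_ : weighted_sum (c^~ e) l N =
    fun x => weighted_sum (c^~ e) l Nj x + t x); last first.
    by apply/funext => x; rewrite /t addrC subrK.
  apply: (le_trans (n2D mu (bw Nj) bt)); rewrite lerD2l; apply: n2_le => //.
    by rewrite /D sumr_ge0.
  move=> x; apply: le_trans (D0 N (ltnW ltN) jN).
  rewrite /t /weighted_sum.
  pose F n := c n e * \prod_(r <- l) r.2 (Z (r.1 * n%:Z) x).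
  rewrite -!(big_mkord xpredT F) (big_cat_nat (leq0n Nj) jN)//= addrAC subrr add0r.
  apply: (le_trans (ler_norm_sum _ _ _)); apply: ler_sum => n _.
  rewrite /F normrM ler_piMr//.
  by case: (bdd_prod Zmp (fun a => a * n%:Z) bl) => _ /(_ x).
have hn : n2 (weighted_sum (c^~ e) l Nj) <= Nj%:R `^ b.
  by apply: le_trans (hj _ j0j); rewrite -hl; exact: le_multi_norm.
have aux (n D1 A B p t : R) : n <= A -> D1 <= B + A + 2 * (p * t) -> A <= t ->
  B <= p * t -> n + D1 <= (2 + 3 * p) * t by lra.
apply: (le_trans (aux _ _ _ _ _ _ hn hD hb hb')).
rewrite mulrA mulrAC; apply: ler_wpM2l.
  by rewrite mulr_ge0 ?invr_ge0 ?addr_ge0 ?mulr_ge0 ?exprn_ge0.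
by rewrite ge0_ler_powR ?nnegrE// ler_nat.
Qed.

End UniformSmallness.
Section AlmostSureSmallness.
Context d (X : measurableType d) (R : realType) (mu : probability X R).
Context (Z : int -> X -> X).
Hypothesis Zmp : forall a, measure_preserving mu (Z a).
Hypothesis ZD : forall a b x, Z (a + b) x = Z a (Z b x).
Context dO (Omega : measurableType dO) (P : probability Omega R).
Context (gamma : R) (s : nat -> {RV P >-> R}) (m : nat).
Hypothesis g0 : 0 <= gamma.
Hypothesis g1 : 2 ^+ m * gamma < 1.
Hypothesis hs_indep : jointly_independent [set n | (1 <= n)%N] s.
Hypothesis hs1 : forall n, P [set w | s n.+1 w = 1] = (success_prob gamma n)%:E.

Local Notation q := (success_prob gamma).

Lemma ae_weighted_sum_small (sl : seq int) : size sl = m.+1 ->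
  {ae P, forall w, forall l, map fst l = sl -> all_bdd1 l ->
    forall e : R, 0 < e -> exists N0, forall N, (N0 <= N)%N ->
    n2 mu (weighted_sum Z ((coin q)^~ (coins s w)) l N) <= e * N%:R `^ (1 - gamma)}.
Proof.
move=> ssl.
have [C [kappa [C0 k0 kg hC]]] := random_norm_bound Zmp ZD g0 g1.
have q01 n := success_prob01 g0 n.
pose L := (Num.bound (2 / kappa)).+1.
have Lk : 2 <= L%:R * kappa.
  rewrite -ler_pdivrMr// ltW//; apply: (lt_trans (archi_boundP _)).
    by rewrite divr_ge0// ltW.
  by rewrite ltr_nat.
have k1 : kappa <= 1 - gamma by lra.
pose Nj j := (j.+1 ^ L)%N.
pose A j (e : nat -> bool) := (Nj j)%:R `^ (1 - gamma - kappa) <=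
  multi_norm mu Z sl (Nj j) ((coin q)^~ e).
have mE j : measurable (coin_event s (Nj j) (A j)) by exact: measurable_coin_event.
have PE j : (P (coin_event s (Nj j) (A j)) <= (C * j.+1%:R ^- 2)%:E)%E.
  have N0 : (0 < Nj j)%N by rewrite expn_gt0.
  have NR : 0 < (Nj j)%:R :> R by rewrite ltr0n.
  have t0 : 0 < (Nj j)%:R `^ (1 - gamma - kappa) by exact: powR_gt0.
  have h := coin_event_le hs_indep hs1 q01 (Nj j) t0
    (fun e => multi_norm_ge0 Zmp sl (Nj j) ((coin q)^~ e)) (fun e => id).
  apply: (le_trans h); rewrite lee_fin.
  apply: (@le_trans _ _ (C * (Nj j)%:R `^ (1 - gamma - 2 * kappa) /
     (Nj j)%:R `^ (1 - gamma - kappa))).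
    by rewrite ler_wpM2r ?invr_ge0 ?powR_ge0// hC.
  rewrite -mulrA ler_wpM2l// -powRB; last by apply/implyP => _; exact: lt0r_neq0.
  rewrite [X in _ `^ X](_ : _ = - kappa); last by ring.
  rewrite powRN lef_pV2 ?posrE ?powR_gt0 ?exprn_gt0//.
  rewrite /Nj natrX -powR_mulrn// -powRrM -powR_mulrn//.
  by rewrite ler_powR ?ler1n.
apply: filterS (borel_cantelli_inv_sqr C0 mE PE) => w [j0 hw] l hl bl e e0.
have hj j : (j0 <= j)%N -> multi_norm mu Z sl (j.+1 ^ L) ((coin q)^~ (coins s w)) <=
     (j.+1 ^ L)%:R `^ (1 - gamma - kappa).
  move=> j0j; rewrite ltW// ltNge; apply/negP => hA; apply: (hw j j0j).
  apply: mem_coin_event; last exact: hA.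
  move=> e1 e2 e12; rewrite /A; congr (_ <= _); apply: multi_norm_ext => n nN.
  by rewrite /coin e12.
pose B : R := 2 + 3 * 2 ^+ L.
have B0 : 0 < B by rewrite ltr_pwDl// mulr_ge0// exprn_ge0.
pose J := maxn j0 (Num.bound (B / e)).
exists (J.+1 ^ L)%N => N JN.
have [j [Jj jN Nj']] : exists j, [/\ (J <= j)%N, (j.+1 ^ L <= N)%N & (N < j.+2 ^ L)%N].
  have ex : exists j, (j.+1 ^ L <= N)%N by exists J.
  have bnd j : (j.+1 ^ L <= N)%N -> (j <= N)%N.
    by move=> h; rewrite (leq_trans _ h)// (leq_trans (leqnSn j))// -{1}(expn1 j.+1) leq_pexp2l.
  exists (ex_maxn ex bnd); case: ex_maxnP => i hi himax; split=> //; first exact: himax.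
  by rewrite ltnNge; apply/negP => /himax; rewrite ltnn.
have j0j : (j0 <= j)%N by rewrite (leq_trans _ Jj)// leq_maxl.
have Lk1 : 1 <= L%:R * kappa by lra.
apply: (le_trans (n2_weighted_sum_between Zmp g0 _ k0 k1 Lk1 hj hl bl j0j jN Nj')) => //.
rewrite ler_wpM2r ?powR_ge0// ler_pdivrMr ?ltr0n// -/B.
rewrite mulrC -ler_pdivrMr// ltW//; apply: (lt_le_trans (archi_boundP _)).
  by rewrite divr_ge0 ?ltW.
by rewrite ler_nat (leq_trans _ (leqW Jj))// leq_maxr.
Qed.

End AlmostSureSmallness.

(** * Convergence along the random sequence *)

Section Completeness.
Context d (X : measurableType d) (R : realType) (mu : probability X R).

Lemma ae_cvg_of_summable (F : nat -> X -> R) : (forall n, bdd 1 (F n)) ->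
  (forall n, n2 mu (fun x => F n.+1 x - F n x) <= (2 ^+ n)^-1) ->
  {ae mu, forall x, cvgn (F^~ x)}.
Proof.
move=> bF hF.
pose D n x := `|F n.+1 x - F n x|.
have bD n : bm (D n) by apply: bm_norm; apply: bmB; exact: bdd_bm (bF _).
have mD n : measurable_fun setT (D n) by case: (bD n) => B [].
pose G x := (\sum_(n <oo) (D n x)%:E)%E.
have mDE n : measurable_fun setT (fun x => (D n x)%:E) by exact/measurable_EFinP.
have iG : (\int[mu]_x G x < +oo)%E.
  rewrite /G integral_nneseries//; last by move=> n x _; rewrite lee_fin normr_ge0.
  apply: (@le_lt_trans _ _ (\sum_(n <oo) ((2 ^+ n)^-1 : R)%:E)%E).
    apply: lee_nneseries => [n _ _|n _].
      by apply: integral_ge0 => x _; rewrite lee_fin normr_ge0.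
    have fi : (\int[mu]_x (D n x)%:E)%E \is a fin_num.
      by apply: integrable_fin_num => //; exact: bm_integrable.
    rewrite -(fineK fi) lee_fin; apply: le_trans (hF n).
    apply: (@Int_norm_le _ _ _ mu (fun x => F n.+1 x - F n x)).
    by apply: bmB; exact: bdd_bm (bF _).
  apply: (@le_lt_trans _ _ 2%:E); last exact: ltry.
  apply: lime_le; first by apply: is_cvg_nneseries => n _ _; rewrite lee_fin invr_ge0 exprn_ge0.
  apply: nearW => n; rewrite big_mkord sumEFin lee_fin.
  suff -> : \sum_(i < n) (2 ^+ i)^-1 = 2 - 2 * (2 ^+ n)^-1 :> R.
    by rewrite gerBl mulr_ge0 ?invr_ge0 ?exprn_ge0.
  elim: n => [|n IHn]; first by rewrite big_ord0 expr0 invr1 mulr1 subrr.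
  by rewrite big_ord_recr /= IHn exprS; field; rewrite expf_neq0.
have mG : measurable_fun setT G.
  by apply: ge0_emeasurable_sum => // n x _ _; rewrite lee_fin normr_ge0.
have G0 x : (0 <= G x)%E by apply: nneseries_ge0 => n _ _; rewrite lee_fin normr_ge0.
have intG : mu.-integrable setT G.
  apply/integrableP; split=> //.
  by under eq_integral do rewrite gee0_abs//.
apply: filterS (integrable_ae measurableT intG) => x /(_ I) fG.
have cD : cvgn (series (D^~ x)).
  apply: nondecreasing_is_cvgn.
    by apply/nondecreasing_seqP => n; rewrite /series /= big_nat_recr//= lerDl normr_ge0.
  exists (fine (G x)) => _ [n _ <-]; rewrite -lee_fin fineK// /series /= -sumEFin.
  by apply: (@nneseries_lim_ge _ _ xpredT 0%N) => i _ _; rewrite lee_fin normr_ge0.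
have cS : cvgn (series (fun n => F n.+1 x - F n x)).
  by apply: normed_cvg.
have E : F^~ x = fun n => F 0%N x + series (fun n => F n.+1 x - F n x) n.
  apply/funext => n; rewrite /series /= telescope_sumr// addrC subrK//.
rewrite E; apply: is_cvgD => //; exact: is_cvg_cst.
Qed.

Lemma bdd1_complete (F : nat -> X -> R) : (forall n, bdd 1 (F n)) ->
  (forall e : R, 0 < e -> exists N0, forall p q, (N0 <= p)%N -> (N0 <= q)%N ->
     n2 mu (fun x => F p x - F q x) <= e) ->
  exists g, bdd 1 g /\ forall e : R, 0 < e -> exists N0, forall N, (N0 <= N)%N ->
    n2 mu (fun x => F N x - g x) <= e.
Proof.
move=> bF hF.
have h2 n : 0 < (2 ^+ n)^-1 :> R by rewrite invr_gt0 exprn_gt0.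
have [Nf hNf] := choice (fun n => hF _ (h2 n)).
pose phi := fix phi n := if n is n'.+1 then maxn (Nf n'.+1) (phi n').+1 else Nf 0%N.
have phiN n : (Nf n <= phi n)%N by case: n => //= n; rewrite leq_maxl.
have phiS n : (phi n < phi n.+1)%N by rewrite /= leq_maxr.
have phi_ge n : (n <= phi n)%N by elim: n => // n IHn; exact: leq_ltn_trans IHn (phiS n).
pose G n := F (phi n).
have bG n : bdd 1 (G n) by exact: bF.
have cG : {ae mu, forall x, cvgn (G^~ x)}.
  apply: ae_cvg_of_summable => // n; apply: hNf; last exact: phiN.
  exact: leq_trans (phiN n) (ltnW (phiS n)).
have ub x : has_ubound (range (G^~ x)).
  by exists 1 => _ [n _ <-]; case: (bG n) => _ /(_ x); rewrite ler_norml => /andP[].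
have lb x : has_lbound (range (G^~ x)).
  by exists (-1) => _ [n _ <-]; case: (bG n) => _ /(_ x); rewrite ler_norml => /andP[].
pose g0 x := limn_sup (G^~ x).
have mg0 : measurable_fun setT g0.
  by apply: measurable_fun_limn_sup => // n; case: (bG n).
pose g x := Num.max (-1) (Num.min 1 (g0 x)).
have bg : bdd 1 g.
  split.
    apply: measurable_maxr => //; exact: measurable_minr.
  move=> x; rewrite ler_norml /g le_max lexx /= ge_max ge_min lexx /= andbT; lra.
have cGg : {ae mu, forall x, G^~ x @ \oo --> g x}.
  apply: filterS cG => x cx.
  have -> : g x = limn (G^~ x).
    have -> : limn (G^~ x) = g0 x by rewrite /g0 cvg_limn_supE.
    have g01 : -1 <= g0 x <= 1.
      rewrite /g0 cvg_limn_supE//; apply/andP; split.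
        apply: limr_ge => //; apply: nearW => n.
        by case: (bG n) => _ /(_ x); rewrite ler_norml => /andP[].
      apply: limr_le => //; apply: nearW => n.
      by case: (bG n) => _ /(_ x); rewrite ler_norml => /andP[].
    case/andP: g01 => h1 h2'; rewrite /g min_r// max_r//.
  exact: cx.
exists g; split=> // e e0.
have bmG n : bm (fun x => G n x - g x) by apply: bmB; [exact: bdd_bm (bG n)|exact: bdd_bm bg].
have L1 : (\int[mu]_x `|(G n x)%:E - (g x)%:E|)%E @[n --> \oo] --> 0%E.
  have mGE n : measurable_fun setT (fun x => (G n x)%:E).
    by apply/measurable_EFinP; case: (bG n).
  have mgE : measurable_fun setT (fun x => (g x)%:E).
    by apply/measurable_EFinP; case: bg.
  have i1 : mu.-integrable setT (EFin \o (fun=> 1 : R)).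
    by apply: bm_integrable; exact: bm_cst.
  have [] := @dominated_convergence _ X R mu setT measurableT (fun n x => (G n x)%:E)
    (fun x => (g x)%:E) (fun=> 1%:E) mGE mgE _ i1 _ => //.
    apply: filterS cGg => x hx _; apply: cvg_EFin; last exact: hx.
    by apply: nearW.
  by apply: aeW => x n _; rewrite lee_fin; case: (bG n).
have e20 : 0 < (e / 2) ^+ 2 / 2 by rewrite divr_gt0// exprn_gt0// divr_gt0.
have [n0 hn0] : exists n0, forall n, (n0 <= n)%N ->
    Int mu (fun x => `|G n x - g x|) <= (e / 2) ^+ 2 / 2.
  have /fine_cvgP[_] := L1.
  move=> /cvgr0Pnorm_lt/(_ _ e20)[n0 _ hn0]; exists n0 => n n0n.
  by have := hn0 n n0n => /ltW; apply: le_trans; exact: ler_norm.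
have e2 : 0 < e / 2 by rewrite divr_gt0.
have [N1 hN1] := hF _ e2.
exists N1 => N N1N; pose n := maxn n0 N1.
rewrite (_ : (fun x => F N x - g x) = fun x => (F N x - G n x) + (G n x - g x)); last first.
  by apply/funext => x; rewrite addrA subrK.
apply: (le_trans (n2D _ _ _)) => //; first by apply: bmB; exact: bdd_bm (bF _).
rewrite [leRHS](_ : _ = e / 2 + e / 2); last by lra.
apply: lerD.
  by apply: hN1 => //; rewrite (leq_trans _ (phi_ge n))// leq_maxr.
rewrite -(ler_pXn2r (n:=2))// ?nnegrE ?n2_ge0 ?(ltW e2)// sqr_n2.
apply: (@le_trans _ _ (Int mu (fun x => 2 * `|G n x - g x|))).
  apply: le_Int; [exact: bmX2|by apply: bmZ; exact: bm_norm|move=> x].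
  rewrite -[leLHS]real_normK ?num_real// expr2 ler_wpM2r//.
  rewrite (le_trans (ler_normB _ _))// (natrD _ 1 1) lerD//; first by case: (bG n).
  by case: bg.
rewrite IntZ; last exact: bm_norm.
by have := hn0 n (leq_maxl _ _); lra.
Qed.

End Completeness.

Section WeightedAverages.
Context d (X : measurableType d) (R : realType) (mu : probability X R).
Context (Z : int -> X -> X).
Hypothesis Zmp : forall a, measure_preserving mu (Z a).

Local Notation n2 := (n2 mu).

Lemma abel_summation (a dl : nat -> R) N : \sum_(n < N) a n * dl n =
  \sum_(n < N) (a n - a n.+1) * (\sum_(k < n.+1) dl k) + a N * \sum_(k < N) dl k.
Proof.
elim: N => [|N IHN]; first by rewrite !big_ord0 mulr0 addr0.
by rewrite big_ord_recr IHN [in RHS]big_ord_recr /= [\sum_(k < N.+1) _]big_ord_recr /=; ring.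
Qed.

Lemma weighted_cesaro (l : seq (int * (X -> R))) (g : X -> R) (a : nat -> R) :
  all_bdd1 l -> bdd 1 g ->
  (forall e : R, 0 < e -> exists N0, forall N, (N0 <= N)%N ->
    n2 (fun x => multiple_avg Z l N x - g x) <= e) ->
  (forall n, 0 <= a n) -> (forall n, a n.+1 <= a n) ->
  forall e : R, 0 < e -> exists2 K, 0 <= K & forall N,
    n2 (fun x => weighted_sum Z a l N x - (\sum_(n < N) a n) * g x) <=
      e * (\sum_(n < N) a n) + K.
Proof.
move=> bl bg hg a0 a_mono e e0; have [N0 hN0] := hg e e0.
pose u n x : R := \prod_(q <- l) q.2 (Z (q.1 * n%:Z) x).
have bu n : bdd 1 (u n) by exact: (bdd_prod Zmp (fun b => b * n%:Z)).
have bug n : bdd (1 + 1) (fun x => u n x - g x) by exact: bddB.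
pose S n x := \sum_(k < n) (u k x - g x).
have bS n : bdd (\sum_(k < n) (1 + 1)) (S n).
  exact: (@bdd_sum _ _ _ _ _ (fun=> 1 + 1) (fun (k : 'I_n) x => u k x - g x)).
have bmS n : bm (S n) := bdd_bm (bS n).
have hS n : n2 (S n) <= e * n%:R + 2 * N0%:R.
  have [Nn|nN] := leqP N0 n; last first.
    apply: (@le_trans _ _ (2 * N0%:R)); last by rewrite lerDr mulr_ge0// ltW.
    apply: n2_le => // x; case: (bS n) => _ /(_ x) /le_trans; apply.
    rewrite sumr_const card_ord -[leLHS]mulr_natr -(natrD _ 1 1) ler_wpM2l//.
    by rewrite ler_nat ltnW.
  apply: (@le_trans _ _ (e * n%:R)); last by rewrite lerDl mulr_ge0.
  have [n0|n0] := posnP n.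
    by rewrite n0 mulr0; apply: n2_le => // x; rewrite /S big_ord0 normr0.
  have -> : S n = fun x => n%:R * (multiple_avg Z l n x - g x).
    apply/funext => x; rewrite /S sumrB sumr_const card_ord mulrBr -[g x *+ n]mulr_natl.
    by rewrite /multiple_avg mulVKf// pnatr_eq0 -lt0n.
  rewrite n2Z; last by apply: bmB; [exact: bdd_bm (bdd_avg Zmp n bl)|exact: bdd_bm bg].
  by rewrite ger0_norm// mulrC ler_wpM2r// hN0.
exists (2 * N0%:R * a 0%N); first by rewrite !mulr_ge0.
move=> N.
have d0 n : 0 <= a n - a n.+1 by rewrite subr_ge0.
rewrite (_ : (fun x => _) = fun x =>
  \sum_(n < N) (a n - a n.+1) * S n.+1 x + a N * S N x); last first.
  apply/funext => x; rewrite -(abel_summation a (fun n => u n x - g x)).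
  rewrite /weighted_sum mulr_suml -sumrB; apply: eq_bigr => n _.
  by rewrite mulrBr.
have bmt n : bm (fun x => (a n - a n.+1) * S n.+1 x) by exact: bmZ.
apply: (le_trans (n2D mu (bm_sum _ (fun n : 'I_N => bmt n)) (bmZ (a N) (bmS N)))).
apply: (@le_trans _ _ (\sum_(n < N) (a n - a n.+1) * (e * n.+1%:R + 2 * N0%:R) +
    a N * (e * N%:R + 2 * N0%:R))).
  apply: lerD; last by rewrite n2Z// ger0_norm// ler_wpM2l.
  apply: (le_trans (n2_sum mu _ (fun n : 'I_N => bmt n))); apply: ler_sum => n _.
  by rewrite n2Z// ger0_norm// ler_wpM2l.
have E1 := abel_summation a (fun=> e) N.
rewrite le_eqVlt; apply/orP; left; apply/eqP.
have -> : \sum_(n < N) (a n - a n.+1) * (e * n.+1%:R + 2 * N0%:R) =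
  \sum_(n < N) (a n - a n.+1) * (\sum_(k < n.+1) e) + 2 * N0%:R * \sum_(n < N) (a n - a n.+1).
  rewrite mulr_sumr -big_split; apply: eq_bigr => n _ /=.
  by rewrite sumr_const card_ord -[e *+ _]mulr_natr; ring.
have -> : \sum_(n < N) (a n - a n.+1) = a 0%N - a N.
  elim: (N) => [|n IHn]; first by rewrite big_ord0 subrr.
  by rewrite big_ord_recr /= IHn; ring.
move: E1; rewrite [\sum_(k < N) e]sumr_const card_ord -[e *+ N]mulr_natr -mulr_suml.
by move=> E1; rewrite [e * \sum_(n < N) a n]mulrC E1; ring.
Qed.

End WeightedAverages.

Section RandomAverages.
Context d (X : measurableType d) (R : realType) (mu : probability X R).
Context (Z : int -> X -> X).
Hypothesis Zmp : forall a, measure_preserving mu (Z a).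
Context (gamma : R) (e : nat -> bool) (sl : seq int).
Hypothesis g0 : 0 <= gamma.
Hypothesis g1 : gamma < 1.

Local Notation n2 := (n2 mu).
Local Notation q := (success_prob gamma).

Hypothesis small : forall l, map fst l = sl -> all_bdd1 l ->
  forall eps : R, 0 < eps -> exists N0, forall N, (N0 <= N)%N ->
    n2 (weighted_sum Z ((coin q)^~ e) l N) <= eps * N%:R `^ (1 - gamma).

Lemma sum_success_prob_ge N : N%:R `^ (1 - gamma) <= \sum_(n < N) q n.
Proof.
case: N => [|N]; first by rewrite big_ord0 powR0// subr_eq0 gt_eqF.
apply: (@le_trans _ _ (\sum_(n < N.+1) q N)).
  rewrite sumr_const card_ord -[leRHS]mulr_natl /success_prob powRD.
    by rewrite powRr1.
  by rewrite pnatr_eq0 implybT.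
by apply: ler_sum => n _; apply: success_prob_mono => //; rewrite -ltnS.
Qed.

Lemma powR_unbounded (K : R) : exists N0, forall N, (N0 <= N)%N -> K <= N%:R `^ (1 - gamma).
Proof.
have g1' : 0 < 1 - gamma by rewrite subr_gt0.
pose K' := Num.max K 0.
have K'0 : 0 <= K' by rewrite le_max lexx orbT.
exists (Num.bound (K' `^ (1 - gamma)^-1)) => N hN.
apply: (@le_trans _ _ K'); first by rewrite le_max lexx.
have -> : K' = (K' `^ (1 - gamma)^-1) `^ (1 - gamma).
  by rewrite -powRrM mulVf ?lt0r_neq0// powRr1.
rewrite ge0_ler_powR ?nnegrE ?powR_ge0 ?(ltW g1')//.
rewrite ltW//; apply: (lt_le_trans (archi_boundP (powR_ge0 _ _))).
by rewrite ler_nat.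
Qed.

Lemma sum_coins_close (eps : R) : 0 < eps -> exists N0, forall N, (N0 <= N)%N ->
  `|\sum_(n < N) (e n)%:R - \sum_(n < N) q n| <= eps * \sum_(n < N) q n.
Proof.
move=> eps0; pose l1 := [seq (a, fun=> 1 : R) | a <- sl] : seq (int * (X -> R)).
have hl1 : map fst l1 = sl by rewrite -map_comp map_id_in.
have [N0 hN0] := small hl1 (all_bdd1_cst1 X R sl) eps0.
exists N0 => N N0N.
have -> : \sum_(n < N) (e n)%:R - \sum_(n < N) q n = \sum_(n < N) coin q n e.
  by rewrite -sumrB.
have := hN0 N N0N; rewrite {1}/n2 (_ : (fun x => _) =
    fun=> (\sum_(n < N) coin q n e) ^+ 2); last first.
  by apply/funext => x; rewrite weighted_sum1.
rewrite Int_cst sqrtr_sqr => /le_trans; apply.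
by rewrite ler_wpM2l ?(ltW eps0)// sum_success_prob_ge.
Qed.

Lemma sum_coins_unbounded k : exists n, (k <= \sum_(i < n) e i)%N.
Proof.
have h2 : 0 < 1 / 2 :> R by lra.
have [N0 hN0] := sum_coins_close h2; have [N1 hN1] := powR_unbounded (2 * k%:R).
pose N := maxn N0 N1; exists N.
have := hN0 N (leq_maxl _ _); have := hN1 N (leq_maxr _ _).
have := sum_success_prob_ge N; rewrite ler_norml => h3 h4 /andP[h5 h6].
rewrite -(ler_nat R) natr_sum.
lra.
Qed.

Lemma random_average_cvg (l : seq (int * (X -> R))) (g : X -> R) :
  map fst l = sl -> all_bdd1 l -> bdd 1 g ->
  (forall eps : R, 0 < eps -> exists N0, forall N, (N0 <= N)%N ->
    n2 (fun x => multiple_avg Z l N x - g x) <= eps) ->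
  forall eps : R, 0 < eps -> exists N0, forall N, (N0 <= N)%N ->
    n2 (fun x => (\sum_(n < N) (e n)%:R)^-1 *
      weighted_sum Z (fun n => (e n)%:R) l N x - g x) <= eps.
Proof.
move=> hl bl bg hg eps eps0.
pose dl := Num.min (eps / 8) (1 / 2).
have dl0 : 0 < dl by rewrite lt_min; apply/andP; split; lra.
have dl1 : dl <= 1 / 2 by rewrite ge_min lexx orbT.
have dl8 : 8 * dl <= eps.
  have : dl <= eps / 8 by rewrite ge_min lexx.
  lra.
have [Na hNa] := small hl bl dl0.
have [Nb hNb] := sum_coins_close dl0.
have q0 n : 0 <= q n by case/andP: (success_prob01 g0 n).
have [K K0 hK] := weighted_cesaro Zmp bl bg hg q0
  (fun n => success_prob_mono g0 (leqnSn n)) dl0.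
have [Nc hNc] := powR_unbounded (Num.max (K / dl) 1).
pose N0 := maxn Na (maxn Nb Nc).
exists N0 => N N0N.
have Na' : (Na <= N)%N by rewrite (leq_trans _ N0N)// leq_maxl.
have Nb' : (Nb <= N)%N by rewrite (leq_trans _ N0N)// !leq_max leqnn orbT.
have Nc' : (Nc <= N)%N by rewrite (leq_trans _ N0N)// !leq_max leqnn !orbT.
pose W := \sum_(n < N) q n.
pose Kn : R := \sum_(n < N) (e n)%:R.
have NW : N%:R `^ (1 - gamma) <= W := sum_success_prob_ge N.
have W1 : 1 <= W.
  by apply: le_trans NW; apply: le_trans (hNc N Nc'); rewrite le_max lexx orbT.
have KW : K <= dl * W.
  rewrite mulrC -ler_pdivrMr//; apply: le_trans NW; apply: le_trans (hNc N Nc').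
  by rewrite le_max lexx.
have hd : `|Kn - W| <= dl * W := hNb N Nb'.
have hKn : W / 2 <= Kn.
  move: hd; rewrite ler_norml => /andP[h _].
  have : dl * W <= 1 / 2 * W by rewrite ler_wpM2r//; lra.
  lra.
have Kn0 : 0 < Kn by lra.
have bw a := bm_weighted_sum Zmp a N bl.
have bmg := bdd_bm bg.
pose E1 := weighted_sum Z ((coin q)^~ e) l N.
pose E2 x := weighted_sum Z q l N x - W * g x.
have bE1 : bm E1 by exact: bw.
have bE2 : bm E2 by apply: bmB; [exact: bw|exact: bmZ].
have -> : (fun x => Kn^-1 * weighted_sum Z (fun n => (e n)%:R) l N x - g x) =
    fun x => Kn^-1 * ((E1 x + E2 x) - (Kn - W) * g x).
  apply/funext => x.
  have -> : E1 x = weighted_sum Z (fun n => (e n)%:R) l N x - weighted_sum Z q l N x.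
    by rewrite /E1 /weighted_sum -sumrB; apply: eq_bigr => n _; rewrite mulrBl.
  by rewrite /E2; field; rewrite gt_eqF.
have bE12 := bmD bE1 bE2; have bEg := bmZ (Kn - W) bmg.
rewrite n2Z; last exact: bmB.
rewrite gtr0_norm ?invr_gt0// ler_pdivrMl//.
have h1 : n2 E1 <= dl * W.
  by apply: (le_trans (hNa N Na')); rewrite ler_wpM2l ?(ltW dl0).
have h2 : n2 E2 <= dl * W + K := hK N.
have h3 : n2 (fun x => (Kn - W) * g x) <= dl * W.
  rewrite n2Z// -[leRHS]mulr1; apply: ler_pM => //; first exact: n2_ge0.
  by case: bg => mg gg; apply: n2_le => //; exact: bdd_bm (conj mg gg).
have h4 := n2B mu bE12 bEg; have h5 := n2D mu bE1 bE2.
have h6 : dl * W <= Kn * eps / 4.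
  have : 8 * dl * (W / 2) <= eps * Kn.
    by apply: ler_pM => //; rewrite ?mulr_ge0 ?(ltW dl0)//; lra.
  lra.
apply: (le_trans h4); move: h1 h2 h3 h5 h6 KW; clear.
move: (n2 E1) (n2 E2) => a b; lra.
Qed.

End RandomAverages.

Section Enumeration.
Variable e : nat -> bool.
Hypothesis e_inf : forall k, exists n, (k <= \sum_(i < n) e i)%N.

Let cnt n := (\sum_(i < n) e i)%N.

Let cntS n : cnt n.+1 = (cnt n + e n)%N. Proof. by rewrite /cnt big_ord_recr. Qed.

Let cnt_mono m n : (m <= n)%N -> (cnt m <= cnt n)%N.
Proof.
move=> /subnK <-; elim: (n - m)%N => // k IHk.
by rewrite addSn cntS (leq_trans IHk)// leq_addr.
Qed.

Lemma enumerate_infinite : exists (nk N : nat -> nat),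
  increasing_listing [set n | (1 <= n)%N /\ e n.-1] nk /\
  forall K, [/\ (K <= N K)%N, (\sum_(i < N K) e i = K)%N &
    forall (R : pzRingType) (G : nat -> R),
      \sum_(k < K) G (nk k) = \sum_(n < N K) (e n)%:R * G n.+1].
Proof.
pose nk k := ex_minn (e_inf k.+1).
have nkP k : exists n, [/\ nk k = n.+1, e n & cnt n = k].
  rewrite /nk; case: ex_minnP => -[|n]; first by rewrite big_ord0.
  rewrite -/(cnt n.+1) cntS => h hmin; exists n.
  have hn : (cnt n <= k)%N.
    by rewrite leqNgt; apply/negP => /hmin; rewrite ltnn.
  by move: h; case: (e n) => /=; split=> //; lia.
have nk_cnt n : e n -> nk (cnt n) = n.+1.
  move=> en; have [n' [-> en' cn']] := nkP (cnt n); congr S.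
  have [lt|gt|//] := ltngtP n n'.
    by have := cnt_mono lt; rewrite cntS en cn' addn1 ltnn.
  by have := cnt_mono gt; rewrite cntS en' cn' addn1 ltnn.
have sumG (R : pzRingType) (G : nat -> R) n :
    \sum_(k < cnt n) G (nk k) = \sum_(i < n) (e i)%:R * G i.+1.
  elim: n => [|n IHn]; first by rewrite /cnt !big_ord0.
  rewrite cntS [RHS]big_ord_recr /= -IHn; case: (boolP (e n)) => en.
    by rewrite addn1 big_ord_recr /= nk_cnt// mul1r.
  by rewrite addn0 mul0r addr0.
have cnt_le n : (cnt n <= n)%N.
  elim: n => [|n IHn]; first by rewrite /cnt big_ord0.
  by rewrite cntS -addn1 leq_add// leq_b1.
pose N K := if K is k.+1 then nk k else 0%N.
have cntN K : cnt (N K) = K.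
  case: K => [|k] /=; first by rewrite /cnt big_ord0.
  by have [n [-> en cn]] := nkP k; rewrite cntS en cn addn1.
exists nk, N; split; last first.
  move=> K; split; [by rewrite -{1}(cntN K)|exact: cntN|].
  by move=> R G; rewrite -sumG cntN.
split.
  move=> i j ij; rewrite ltnNge; apply/negP => /cnt_mono.
  have [n [-> en cn]] := nkP i; have [n' [-> en' cn']] := nkP j.
  rewrite !cntS en en' cn cn'; lia.
apply/seteqP; split => n.
  by move=> [k _ <-]; have [n' [-> en' _]] := nkP k.
case: n => [[]//|n] [_ /= en]; exists (cnt n) => //; exact: nk_cnt.
Qed.

End Enumeration.

Section RealCase.
Context d (X : measurableType d) (R : realType) (mu : probability X R).
Context (T S : X -> X).
Hypotheses (TK : cancel T S) (SK : cancel S T).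
Hypotheses (mS : measurable_fun setT S) (mpT : measure_preserving mu T).
Context (m : nat).

Local Notation Z := (zpow T S).

Let Zmp a : measure_preserving mu (Z a).
Proof. exact: measure_preserving_zpow. Qed.

Let ZD a b x : Z (a + b) x = Z a (Z b x).
Proof. exact: zpowD. Qed.

Definition slopes : seq int := [seq (val j).+1%:Z | j <- enum 'I_m.+1].

Lemma real_average_cvg (e : nat -> bool) (gamma : R) (nk N : nat -> nat) :
  0 <= gamma -> gamma < 1 ->
  (forall l, map fst l = slopes -> all_bdd1 l ->
    forall eps : R, 0 < eps -> exists N0, forall N, (N0 <= N)%N ->
    n2 mu (weighted_sum Z ((coin (success_prob gamma))^~ e) l N) <=
      eps * N%:R `^ (1 - gamma)) ->
  (forall K, [/\ (K <= N K)%N, (\sum_(i < N K) e i = K)%N &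
    forall (R : pzRingType) (G : nat -> R),
      \sum_(k < K) G (nk k) = \sum_(n < N K) (e n)%:R * G n.+1]) ->
  forall f : 'I_m.+1 -> X -> R, (forall j, bdd 1 (f j)) ->
  exists g, bdd 1 g /\ forall eps : R, 0 < eps -> exists K0, forall K, (K0 <= K)%N ->
    n2 mu (fun x => K%:R^-1 * \sum_(k < K)
      \prod_(j < m.+1) f j (iter (j.+1 * nk k) T x) - g x) <= eps.
Proof.
move=> g0 g1 small hN f bf.
pose l := [seq ((val j).+1%:Z, fun x => f j (iter j.+1 T x)) | j <- enum 'I_m.+1]
  : seq (int * (X -> R)).
have hl : map fst l = slopes by rewrite -map_comp; exact: eq_map.
have bl : all_bdd1 l.
  rewrite /l; elim: (enum _) => //= j r IHr; split=> //.
  by apply: bdd_comp => //; case: (Zmp j.+1%:Z).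
have bA n := bdd_avg Zmp n bl.
have [g [bg hg]] := bdd1_complete bA (avg_cauchy Zmp (fun=> erefl) ZD bl).
exists g; split=> // eps eps0.
have [N0 hN0] := random_average_cvg Zmp g0 g1 small hl bl bg hg eps0.
exists N0 => K N0K; have [KN cK sK] := hN K.
have := hN0 (N K) (leq_trans N0K KN).
rewrite -natr_sum cK; congr (n2 _ _ <= _); apply/funext => x; congr (_ * _ - _).
rewrite (sK _ (fun n => \prod_(j < m.+1) f j (iter (j.+1 * n) T x))).
apply: eq_bigr => n _; congr (_ * _); rewrite /l big_map big_enum /=.
apply: eq_bigr => j _.
have E : iter j.+1 T (iter (j.+1 * n) T x) = iter (j.+1 * n.+1) T x by rewrite mulnS iterD.
exact: (congr1 (f j) E).
Qed.

End RealCase.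

Section ComplexFunctions.
Context d (X : measurableType d) (R : realType) (mu : probability X R).
Local Notation C := R[i].
Implicit Types (h : X -> C).

Definition cmeas h := measurable_fun setT (fun x => complex.Re (h x)) /\
  measurable_fun setT (fun x => complex.Im (h x)).

Lemma cmeas_cst (z : C) : cmeas (fun=> z).
Proof. by split. Qed.

Lemma cmeas_real (f : X -> R) : measurable_fun setT f -> cmeas (fun x => (f x)%:C%C).
Proof. by move=> mf; split. Qed.

Lemma cmeasD h1 h2 : cmeas h1 -> cmeas h2 -> cmeas (fun x => h1 x + h2 x).
Proof.
move=> [r1 i1] [r2 i2]; split.
  rewrite (_ : (fun x => _) = fun x => complex.Re (h1 x) + complex.Re (h2 x)).
    exact: measurable_funD.
  by apply/funext => x; case: (h1 x) (h2 x) => ? ? [].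
rewrite (_ : (fun x => _) = fun x => complex.Im (h1 x) + complex.Im (h2 x)).
  exact: measurable_funD.
by apply/funext => x; case: (h1 x) (h2 x) => ? ? [].
Qed.

Lemma cmeasM h1 h2 : cmeas h1 -> cmeas h2 -> cmeas (fun x => h1 x * h2 x).
Proof.
move=> [r1 i1] [r2 i2]; split.
  rewrite (_ : (fun x => _) = fun x => complex.Re (h1 x) * complex.Re (h2 x) -
    complex.Im (h1 x) * complex.Im (h2 x)).
    by apply: measurable_funB; exact: measurable_funM.
  by apply/funext => x; case: (h1 x) (h2 x) => ? ? [].
rewrite (_ : (fun x => _) = fun x => complex.Re (h1 x) * complex.Im (h2 x) +
    complex.Im (h1 x) * complex.Re (h2 x)).
  by apply: measurable_funD; exact: measurable_funM.
by apply/funext => x; case: (h1 x) (h2 x) => ? ? [].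
Qed.

Lemma cmeas_sum I (r : seq I) (h : I -> X -> C) :
  (forall i, cmeas (h i)) -> cmeas (fun x => \sum_(i <- r) h i x).
Proof.
move=> mh; elim: r => [|i r IHr].
  rewrite (_ : (fun x => _) = fun=> 0); first exact: cmeas_cst.
  by apply/funext => x; rewrite big_nil.
rewrite (_ : (fun x => _) = fun x => h i x + \sum_(j <- r) h j x); first exact: cmeasD.
by apply/funext => x; rewrite big_cons.
Qed.

Lemma cmeas_prod I (r : seq I) (h : I -> X -> C) :
  (forall i, cmeas (h i)) -> cmeas (fun x => \prod_(i <- r) h i x).
Proof.
move=> mh; elim: r => [|i r IHr].
  rewrite (_ : (fun x => _) = fun=> 1); first exact: cmeas_cst.
  by apply/funext => x; rewrite big_nil.
rewrite (_ : (fun x => _) = fun x => h i x * \prod_(j <- r) h j x); first exact: cmeasM.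
by apply/funext => x; rewrite big_cons.
Qed.

Lemma cmeas_comp h (t : X -> X) : measurable_fun setT t -> cmeas h ->
  cmeas (fun x => h (t x)).
Proof.
move=> mt [r i]; split; first exact: (measurableT_comp r mt).
exact: (measurableT_comp i mt).
Qed.

Lemma cmod_ge0 (z : C) : 0 <= cmod z.
Proof. by case: z => a b; exact: sqrtr_ge0. Qed.

Lemma cmodE (z : C) : (cmod z)%:C%C = `|z|.
Proof. by rewrite normc_def; case: z. Qed.

Lemma cmodM (z1 z2 : C) : cmod (z1 * z2) = cmod z1 * cmod z2.
Proof. exact: ComplexField.Normc.normcM. Qed.

Lemma cmod_real (r : R) : cmod (r%:C)%C = `|r|.
Proof. by rewrite /cmod /= expr0n addr0 sqrtr_sqr. Qed.

Lemma cmod_sum I (r : seq I) (z : I -> C) :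
  cmod (\sum_(i <- r) z i) <= \sum_(i <- r) cmod (z i).
Proof.
rewrite -lecR cmodE rmorph_sum /=; apply: (le_trans (ler_norm_sum _ _ _)).
by rewrite le_eqVlt; apply/orP; left; apply/eqP; apply: eq_bigr => i _; rewrite cmodE.
Qed.

Lemma norm_Re_le_cmod (z : C) : `|complex.Re z| <= cmod z.
Proof.
case: z => a b; rewrite /cmod /= -sqrtr_sqr; apply: ler_wsqrtr.
by rewrite lerDl sqr_ge0.
Qed.

Lemma norm_Im_le_cmod (z : C) : `|complex.Im z| <= cmod z.
Proof.
case: z => a b; rewrite /cmod /= -sqrtr_sqr; apply: ler_wsqrtr.
by rewrite lerDr sqr_ge0.
Qed.

Lemma measurable_cmod h : cmeas h -> measurable_fun setT (fun x => cmod (h x)).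
Proof.
move=> [r i]; rewrite (_ : (fun x => _) = fun x =>
  (complex.Re (h x) ^+ 2 + complex.Im (h x) ^+ 2) `^ 2^-1).
  apply: (measurableT_comp (measurable_powR _)).
  by apply: measurable_funD; exact: measurable_funX.
apply/funext => x; case: (h x) => a b /=.
by rewrite powR12_sqrt// addr_ge0 ?sqr_ge0.
Qed.

Lemma cLnorm1E h : cLnorm mu 1%E h = (\int[mu]_x (cmod (h x))%:E)%E.
Proof.
rewrite /cLnorm Lnorm1; apply: eq_integral => x _ /=.
by rewrite ger0_norm// cmod_ge0.
Qed.

Lemma ae_cmod_le h : cLfun mu +oo%E h ->
  exists2 B : R, 0 < B & {ae mu, forall x, cmod (h x) <= B}.
Proof.
move=> [_ _]; rewrite /cLnorm unlock /=.
have -> : (0 < mu setT)%E by rewrite [X in (_ < X)%E](_ : _ = 1%E)//; exact: probability_setT.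
set s := ess_sup _ _ => s_oo.
have hs : {ae mu, forall x, ((cmod (h x))%:E <= s)%E}.
  apply: filterS (ess_sup_ge mu (abse \o (EFin \o (@cmod R \o h)))) => x /=.
  by apply: le_trans; rewrite lee_fin ler_norm.
exists (Num.max (fine s) 1); first by rewrite lt_max ltr01 orbT.
apply: filterS hs => x; case: s s_oo => [r _|//|_] /=.
  by rewrite lee_fin le_max => ->.
by rewrite leeNy_eq.
Qed.

Lemma ae_measure_preserving (Q : X -> Prop) (t : X -> X) :
  measure_preserving mu t -> {ae mu, forall x, Q x} -> {ae mu, forall x, Q (t x)}.
Proof.
move=> [mt tP] [N [mN N0 QN]]; exists (t @^-1` N); split.
- by rewrite -[_ @^-1` _]setTI; exact: mt.
- by rewrite tP.
by move=> x /= hx; exact: QN.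
Qed.

Definition clamp (y : R) : R := Num.max (-1) (Num.min 1 y).

Lemma bdd_clamp (f : X -> R) : measurable_fun setT f -> bdd 1 (fun x => clamp (f x)).
Proof.
move=> mf; split; first by apply: measurable_maxr => //; exact: measurable_minr.
move=> x; rewrite ler_norml /clamp le_max lexx /= ge_max ge_min lexx /= andbT; lra.
Qed.

Lemma clamp_id y : `|y| <= 1 -> clamp y = y.
Proof. by rewrite ler_norml => /andP[h1 h2]; rewrite /clamp min_r// max_r. Qed.

(* [false] selects the real part and [true] the imaginary part. *)
Definition normalized_part (B : R) (z : C) (b : bool) : R :=
  clamp ((if b then complex.Im z else complex.Re z) / B).

Definition part_weight (B : R) (b : bool) : C := if b then (B *i)%C else (B%:C)%C.

Lemma normalized_partE B z : 0 < B -> cmod z <= B ->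
  z = \sum_(b : bool) part_weight B b * (normalized_part B z b)%:C%C.
Proof.
move=> B0 zB.
have le1 (y : R) : `|y| <= cmod z -> `|y / B| <= 1.
  move=> yz; rewrite normrM (@gtr0_norm _ B^-1) ?invr_gt0// ler_pdivrMr// mul1r.
  exact: le_trans zB.
rewrite big_bool /= /normalized_part !clamp_id ?le1 ?norm_Re_le_cmod ?norm_Im_le_cmod//.
case: z {zB le1} => a b; apply/eqP; rewrite eq_complex /=; apply/andP; split; apply/eqP.
  by field; rewrite gt_eqF.
by field; rewrite gt_eqF.
Qed.

End ComplexFunctions.

Section ComplexCase.
Context d (X : measurableType d) (R : realType) (mu : probability X R).
Context (T : X -> X) (mpT : forall n, measure_preserving mu (iter n T)).
Context (m : nat) (nk : nat -> nat).
Local Notation C := R[i].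

Hypothesis real_case : forall f : 'I_m -> X -> R, (forall j, bdd 1 (f j)) ->
  exists g, bdd 1 g /\ forall eps : R, 0 < eps -> exists K0, forall K, (K0 <= K)%N ->
    n2 mu (fun x => K%:R^-1 * \sum_(k < K)
      \prod_(j < m) f j (iter (j.+1 * nk k) T x) - g x) <= eps.

Lemma complex_average_cvg (f : 'I_m -> X -> C) : (forall j, cLfun mu +oo%E (f j)) ->
  exists g : X -> C, cLfun mu 1%E g /\ cvg_in_L1 mu (multiple_average T f nk) g.
Proof.
move=> hf.
have mT n : measurable_fun setT (iter n T) by have [] := mpT n.
have mf j : cmeas (f j) by have [? ? _] := hf j.
have [B [B0 hB]] : exists B : R, 0 < B /\ forall j, {ae mu, forall x, cmod (f j x) <= B}.
  have h j : exists B : R, 0 < B /\ {ae mu, forall x, cmod (f j x) <= B}.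
    by have [B B0 hB] := ae_cmod_le (hf j); exists B.
  have [b hb] := choice h; exists (1 + \sum_j b j); split.
    by rewrite ltr_pwDl// sumr_ge0// => j _; have [/ltW] := hb j.
  move=> j; have [_] := hb j; apply: filterS => x hx; apply: (le_trans hx).
  rewrite (bigD1 j)//= addrCA lerDl addr_ge0// sumr_ge0// => i _.
  by have [/ltW] := hb i.
have good : {ae mu, forall x, forall j n, cmod (f j (iter n T x)) <= B}.
  have h j : {ae mu, forall x, forall n, cmod (f j (iter n T x)) <= B}.
    apply: ae_foralln => n.
    exact: (ae_measure_preserving (Q := fun x => cmod (f j x) <= B) (mpT n) (hB j)).
  exact: filter_forall.
pose u j b x := normalized_part B (f j x) b.
have bu j b : bdd 1 (u j b).
  apply: bdd_clamp; case: (mf j) => mr mi.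
  by case: b; apply: measurable_funM.
pose W (c : {ffun 'I_m -> bool}) : C := \prod_j part_weight B (c j).
pose a (c : {ffun 'I_m -> bool}) K x : R :=
  K%:R^-1 * \sum_(k < K) \prod_(j < m) u j (c j) (iter (j.+1 * nk k) T x).
have [g hg] := choice (fun c : {ffun 'I_m -> bool} => real_case (fun j => bu j (c j))).
have bg c : bdd 1 (g c) by case: (hg c).
have ba c K : bm (a c K).
  apply: bmZ; apply: bm_sum => k; exists 1.
  by apply: bdd_prod1 => j _; apply: bdd_comp.
have bag c K : bm (fun x => a c K x - g c x) by apply: bmB => //; exact: bdd_bm (bg c).
pose G x : C := \sum_c W c * (g c x)%:C%C.
have mG : cmeas G.
  apply: cmeas_sum => c; apply: cmeasM; first exact: cmeas_cst.
  by apply: cmeas_real; case: (bg c).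
have mF K : cmeas (multiple_average T f nk K).
  apply: cmeasM; first exact: cmeas_cst.
  by apply: cmeas_sum => k; apply: cmeas_prod => j; exact: cmeas_comp.
have FE K x : (forall j n, cmod (f j (iter n T x)) <= B) ->
    multiple_average T f nk K x = \sum_c W c * (a c K x)%:C%C.
  move=> hx; rewrite /multiple_average.
  transitivity (K%:R^-1 * \sum_(k < K) \sum_(c : {ffun 'I_m -> bool})
     W c * (\prod_(j < m) u j (c j) (iter (j.+1 * nk k) T x))%:C%C).
    congr (_ * _); apply: eq_bigr => k _.
    rewrite (eq_bigr (fun j : 'I_m => \sum_(b : bool) part_weight B b *
       (u j b (iter (j.+1 * nk k) T x))%:C%C)); last first.
      by move=> j _; rewrite /u -normalized_partE.
    rewrite bigA_distr_bigA; apply: eq_bigr => c _.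
    by rewrite big_split rmorph_prod.
  rewrite exchange_big mulr_sumr; apply: eq_bigr => c _.
  rewrite -mulr_sumr mulrCA; congr (_ * _).
  by rewrite /a rmorphM rmorph_sum /= fmorphV rmorph_nat.
exists G; split.
  case: (mG) => mr mi; split=> //.
  rewrite cLnorm1E; apply: (@le_lt_trans _ _ (\int[mu]_x (\sum_c cmod (W c))%:E)%E).
    apply: ge0_le_integral => //.
    - by move=> x _; rewrite lee_fin cmod_ge0.
    - by apply/measurable_EFinP; exact: measurable_cmod.
    move=> x _; rewrite lee_fin; apply: (le_trans (cmod_sum _ _)).
    apply: ler_sum => c _; rewrite cmodM cmod_real ler_piMr ?cmod_ge0//.
    by case: (bg c).
  rewrite integral_cst// [X in (_ * X)%E](_ : _ = 1%E); last exact: probability_setT.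
  by rewrite mule1 ltry.
rewrite /cvg_in_L1.
pose r K : R := \sum_c cmod (W c) * n2 mu (fun x => a c K x - g c x).
have hr : r K @[K --> \oo] --> (0 : R).
  rewrite /r; elim: (index_enum _) => [|c s IHs].
    by under eq_fun do rewrite big_nil; exact: cvg_cst.
  under eq_fun do rewrite big_cons.
  have hc : n2 mu (fun x => a c K x - g c x) @[K --> \oo] --> (0 : R).
    apply/cvgrPdist_le => eps eps0; have [_ /(_ _ eps0)[K0 hK0]] := hg c.
    exists K0 => // K /= K0K; rewrite sub0r normrN ger0_norm ?n2_ge0//.
    exact: hK0.
  have : (cmod (W c) * n2 mu (fun x => a c K x - g c x) +
      \sum_(j <- s) cmod (W j) * n2 mu (fun x => a j K x - g j x)) @[K --> \oo]
      --> cmod (W c) * 0 + 0.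
    by apply: cvgD => //; apply: cvgM => //; exact: cvg_cst.
  by rewrite mulr0 addr0.
apply: (@squeeze_cvge _ _ _ _ (fun=> 0%E) _ (fun K => (r K)%:E)); last 2 first.
- exact: cvg_cst.
- by apply: cvg_EFin => //; apply: nearW.
apply: nearW => K; rewrite cLnorm1E; apply/andP; split.
  by apply: integral_ge0 => x _; rewrite lee_fin cmod_ge0.
pose H x := \sum_c cmod (W c) * `|a c K x - g c x|.
have bH : bm H by apply: bm_sum => c; apply: bmZ; exact: bm_norm.
have mH : measurable_fun setT H by case: bH => ? [].
apply: (@le_trans _ _ (\int[mu]_x (H x)%:E)%E).
  apply: ae_ge0_le_integral => //.
  - by move=> x _; rewrite lee_fin cmod_ge0.
  - apply/measurable_EFinP; apply: measurable_cmod.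
    rewrite (_ : (fun x => _) = fun x => multiple_average T f nk K x + (-1) * G x).
      by apply: cmeasD => //; apply: cmeasM => //; exact: cmeas_cst.
    by apply/funext => x; rewrite mulN1r.
  - move=> x _; rewrite lee_fin; apply: sumr_ge0 => c _.
    by rewrite mulr_ge0 ?cmod_ge0.
  - exact/measurable_EFinP.
  apply: filterS good => x hx _; rewrite lee_fin FE// /G -sumrB.
  apply: (le_trans (cmod_sum _ _)); apply: ler_sum => c _.
  by rewrite -mulrBr -rmorphB cmodM cmod_real.
have fi : (\int[mu]_x (H x)%:E)%E \is a fin_num.
  by apply: integrable_fin_num => //; exact: bm_integrable.
rewrite -(fineK fi) lee_fin.
have bt c : bm (fun x => cmod (W c) * `|a c K x - g c x|) by apply: bmZ; exact: bm_norm.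
have -> : fine (\int[mu]_x (H x)%:E)%E =
    \sum_c Int mu (fun x => cmod (W c) * `|a c K x - g c x|).
  by rewrite -Int_sum.
apply: ler_sum => c _; rewrite IntZ; last exact: bm_norm.
by rewrite ler_wpM2l ?cmod_ge0// Int_norm_le.
Qed.

End ComplexCase.

Theorem theorem3p2 (R : realType)
    (dO : measure_display) (Omega : measurableType dO)
    (P : probability Omega R)
    (dX : measure_display) (X : measurableType dX)
    (mu : probability X R) (T : X -> X)
    (M : nat) (gamma : R) (s : nat -> {RV P >-> R})
    (hM : (1 <= M)%N)
    (hT : invertible_measure_preserving mu T)
    (hgamma0 : 0 <= gamma) (hgamma : gamma < 2 `^ (- M%:R + 1))
    (hs_indep : jointly_independent [set n | (1 <= n)%N] s)
    (hs1 : forall n, (1 <= n)%N ->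
       P [set w | s n w = 1] = (n%:R `^ (- gamma))%:E)
    (hs0 : forall n, (1 <= n)%N ->
       P [set w | s n w = 0] = (1 - n%:R `^ (- gamma))%:E) :
  {ae P, forall w, exists nk : nat -> nat,
     increasing_listing [set n | (1 <= n)%N /\ s n w = 1] nk /\
     forall f : 'I_M -> X -> R[i],
       (forall j, cLfun mu +oo%E (f j)) ->
       exists g : X -> R[i],
         cLfun mu 1%E g /\ cvg_in_L1 mu (multiple_average T f nk) g}.
Proof.
case: M hM hgamma => [//|m] _ hgamma.
have [mpT [S [mS TK SK]]] := hT.
have p1 : 1 <= 2 ^+ m :> R by rewrite exprn_ege1 ?ler1n.
have hg2 : 2 ^+ m * gamma < 1.
  move: hgamma; rewrite -[m.+1%:R]natr1 opprD subrK powRN powR_mulrn// => h.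
  by rewrite mulrC -ltr_pdivlMr ?(lt_le_trans _ p1)// div1r.
have hg1 : gamma < 1.
  by apply: le_lt_trans hg2; rewrite ler_peMl.
have Zmp a : measure_preserving mu (zpow T S a) := measure_preserving_zpow TK a mS mpT.
have ZD a b x := zpowD TK SK a b x.
have hs1' n : P [set w | s n.+1 w = 1] = (success_prob gamma n)%:E by exact: hs1.
have sz : size (slopes m) = m.+1 by rewrite size_map size_enum_ord.
apply: filterS (ae_weighted_sum_small Zmp ZD hgamma0 hg2 hs_indep hs1' sz) => w small.
have [nk [N [hnk hN]]] := enumerate_infinite
  (sum_coins_unbounded hgamma0 hg1 small).
exists nk; split.
  rewrite (_ : [set n | _] = [set n | (1 <= n)%N /\ coins s w n.-1])//.
  apply/seteqP; split=> -[|n] /= [] // _ h; split=> //; last exact/eqP.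
  by rewrite /coins h.
apply: complex_average_cvg; first by move=> n; exact: (Zmp n%:Z).
exact: (real_average_cvg TK SK mS mpT hgamma0 hg1 small hN).
Qed.
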